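(* Fix $p\in[1,2]$. For all $n,d,\Delta\in\mathbb{N}$ there is a turnstile streaming algorithm using at most $\mathrm{polylog}(n,d,\Delta)$ bits of space which, given (via the stream) a set $X\subset[\Delta]^d$ of size $n$, outputs $\hat{\eta}\in\mathbb{R}$ satisfying \[\mathsf{MST}_{\ell_p}(X)\le \hat\eta\le \tilde O(\log n)\cdot \mathsf{MST}_{\ell_p}(X)\] with high probability.
   Context: $[\Delta]=\{1,\dots,\Delta\}$. For a finite (multi-)set $X$ in a metric space with distance $\ell_p$, $\mathsf{MST}_{\ell_p}(X)=\min_{T}\sum_{(a,b)\in T}\|a-b\|_p$ over spanning trees $T$ of $X$. In the turnstile (geometric) streaming model the algorithm receives an arbitrarily ordered sequence of insertions and deletions of points of $[\Delta]^d$, and $X$ is the resulting multiset at the end of the stream. Space is measured in the random-oracle model: the algorithm has free access to an arbitrarily long string of random bits which do not count against its space; the space is the number of bits stored between updates. $\tilde O(\log n)$ denotes a quantity at most $\log n\cdot\mathrm{poly}(\log\log n)$ (up to absolute constants, independent of $d,\Delta$). *)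

(* Defs.v *)
From HB Require Import structures.
From mathcomp Require Import all_boot all_order all_algebra.
From mathcomp Require Import boolp classical_sets reals exp.

Set Implicit Arguments.
Unset Strict Implicit.
Unset Printing Implicit Defensive.

Import Order.TTheory GRing.Theory Num.Theory.

Local Open Scope ring_scope.

Definition lp_dist (R : realType) (p : R) (d : nat) (u v : 'rV[R]_d) : R :=
  (\sum_(i < d) `|u 0 i - v 0 i| `^ p) `^ p^-1.

(* 'I_Delta is {0, .., Delta - 1}, hence the shift by one in [coords]. *)
Definition point (d Delta : nat) : finType := {ffun 'I_d -> 'I_Delta}.

Definition coords (R : realType) (d Delta : nat) (x : point d Delta) :
  'rV[R]_d := \row_i ((x i).+1)%:R.

Definition point_dist (R : realType) (p : R) (d Delta : nat)
    (x y : point d Delta) : R :=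
  lp_dist p (coords R x) (coords R y).

(* A simple graph is a set E of ordered pairs containing, for each undirected
   edge, exactly one of its two orientations (chosen arbitrarily). *)
Definition adj (V : finType) (E : {set V * V}) : rel V :=
  fun x y => ((x, y) \in E) || ((y, x) \in E).

Definition simple_graph_on (V : finType) (X : {set V}) (E : {set V * V}) :
    Prop :=
  forall x y, (x, y) \in E ->
    [/\ x \in X, y \in X, x != y & (y, x) \notin E].

Definition connected_on (V : finType) (X : {set V}) (E : {set V * V}) : Prop :=
  forall x y, x \in X -> y \in X -> connect (adj E) x y.

(* A sequence x, y traversing a single edge back and forth satisfies [ucycle],
   so only sequences of at least three vertices count as cycles. *)
Definition acyclic (V : finType) (E : {set V * V}) : Prop :=
  forall c : seq V, ucycle (adj E) c -> (size c <= 2)%N.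

Definition spanning_tree (V : finType) (X : {set V}) (E : {set V * V}) : Prop :=
  [/\ simple_graph_on X E, connected_on X E & acyclic E].

Definition tree_cost (R : realType) (p : R) (d Delta : nat)
    (E : {set point d Delta * point d Delta}) : R :=
  \sum_(e in E) point_dist p e.1 e.2.

(* The infimum is a minimum: see [MST_min]. *)
Definition MST (R : realType) (p : R) (d Delta : nat)
    (X : {set point d Delta}) : R :=
  inf [set tree_cost p E | E in [set E | spanning_tree X E]]%classic.

Lemma spanning_tree_exists (V : finType) (X : {set V}) :
  exists E, spanning_tree X E.
Proof.
have [->|[x0 x0X]] := set_0Vmem X.
  exists finset.set0; split=> [x y|x y|[|x [|y c]]] //; rewrite ?inE //.
  by rewrite /ucycle /= /adj !inE.
pose E := [set e : V * V | [&& e.1 == x0, e.2 \in X & e.2 != x0]]%SET.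
have adjE x y : adj E x y ->
    (x == x0) && (y != x0) || (y == x0) && (x != x0).
  rewrite /adj !inE /=.
  by case: (x == x0); case: (y == x0); rewrite ?andbF ?andbT.
exists E; split=> [x y|x y xX yX|c].
- rewrite !inE /= => /and3P[/eqP-> yX yx0].
  by rewrite x0X yX eq_sym (negPf yx0).
- have sym : symmetric (adj E) by move=> a b; rewrite /adj orbC.
  have H z : z \in X -> connect (adj E) x0 z.
    move=> zX; have [->|zx0] := eqVneq z x0; first exact: connect0.
    by apply: connect1; rewrite /adj !inE /= eqxx zX zx0.
  by apply: connect_trans (H y yX); rewrite (sym_connect_sym sym) H.
- case: c => [|x [|y [|z c]]] //.
  case/andP=> /= /andP[/adjE xy /andP[/adjE yz hc]].
  have {}hc : exists2 w, adj E z w & w \in x :: c.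
    case: c hc => [|w c] /=.
      by move=> /andP[zx _]; exists x; rewrite ?inE ?eqxx.
    by move=> /andP[zw _]; exists w; rewrite ?inE ?eqxx ?orbT.
  case: hc => w /adjE zw; rewrite inE => wc.
  rewrite !inE !negb_or => /andP[/and3P[nxy nxz _] /andP[/andP[nyz yc] _]].
  have nwy : w != y.
    case/orP: wc => [/eqP wx|wc]; first by rewrite wx.
    by apply: contraNneq yc => wy; rewrite -wy.
  move: xy yz zw.
  have [x0E|_] := eqVneq x x0; have [y0E|_] := eqVneq y x0 => //=.
  + by have [z0E|] := eqVneq z x0; first by move: nxz; rewrite x0E z0E eqxx.
  + have [z0E|_] := eqVneq z x0; first by move: nyz; rewrite y0E z0E eqxx.
    by rewrite orbF => _ _ /andP[/eqP w0E _]; move: nwy; rewrite y0E w0E eqxx.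
Qed.

Lemma MST_min (R : realType) (p : R) (d Delta : nat)
    (X : {set point d Delta}) :
  exists2 E, spanning_tree X E & MST p X = tree_cost p E /\
    forall E', spanning_tree X E' -> tree_cost p E <= tree_cost p E'.
Proof.
have [E0 tE0] := spanning_tree_exists X.
have P0 : `[< spanning_tree X E0 >] by apply/asboolP.
case: (@arg_minP _ _ _ E0 (fun E => `[< spanning_tree X E >])
         (fun E => tree_cost p E) P0) => E /asboolP tE minE.
have le_E E' : spanning_tree X E' -> tree_cost p E <= tree_cost p E'.
  by move=> tE'; apply: minE; apply/asboolP.
exists E => //; split=> //; apply/eqP; rewrite eq_le; apply/andP; split.
  apply: ge_inf; last by exists E.
  by exists (tree_cost p E) => _ [E' tE' <-]; apply: le_E.
by apply: lb_le_inf => [|_ [E' tE' <-]]; [exists (tree_cost p E), E|apply: le_E].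
Qed.

Variant update (d Delta : nat) :=
  | Insert of point d Delta
  | Delete of point d Delta.

Definition delta (d Delta : nat) (u : update d Delta) (x : point d Delta) :
    int :=
  match u with
  | Insert y => (x == y)%:Z
  | Delete y => - (x == y)%:Z
  end.

Definition multiplicity (d Delta : nat) (sigma : seq (update d Delta))
    (x : point d Delta) : int :=
  \sum_(u <- sigma) delta u x.

Definition stream_of (d Delta : nat) (X : {set point d Delta})
    (sigma : seq (update d Delta)) : Prop :=
  forall x, multiplicity sigma x = (x \in X)%:Z.

(* A streaming algorithm with [s] bits of memory and read access at all times,
   free of charge, to a string of [m] random bits. *)
Record streaming_algorithm (U O : Type) (s m : nat) := StreamingAlgorithm {
  init : m.-tuple bool -> s.-tuple bool;
  step : m.-tuple bool -> s.-tuple bool -> U -> s.-tuple bool;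
  output : m.-tuple bool -> s.-tuple bool -> O
}.

Definition run (U O : Type) (s m : nat) (alg : streaming_algorithm U O s m)
    (sigma : seq U) (omega : m.-tuple bool) : O :=
  output alg omega (foldl (step alg omega) (init alg omega) sigma).

(* Probability of an event over [m] independent fair bits. *)
Definition bits_prob (R : realType) (m : nat) (A : pred (m.-tuple bool)) : R :=
  #|A|%:R / 2 ^+ m.

Definition log2 (R : realType) (x : R) : R := ln x / ln 2.

(* As [ln] vanishes on nonpositive reals, the logarithms below are 0, rather
   than undefined, when their argument is 0. *)
Definition polylog (R : realType) (C : R) (k : nat) (n d Delta : nat) : R :=
  C * (1 + log2 n%:R + log2 d%:R + log2 Delta%:R) ^+ k.

(* The shift by 1 keeps the factor from vanishing at n = 2, where
   log log n = 0. *)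
Definition soft_log (R : realType) (C : R) (k : nat) (n : nat) : R :=
  C * log2 n%:R * (1 + log2 (log2 n%:R)) ^+ k.

(* Main.v *)
(** Embed l_p into Hamming distance: there are cuts [f] such that, up to a scale
    [A] and a constant factor, the number of cuts separating [x] and [y] is their
    distance (random signs and Pareto variables, then thresholds). Keeping each
    cut with probability [2 ^- e], in a nested way, yields random partitions of
    the points that coarsen with [e], hence a hierarchical clustering.

    Joining, in every cluster of level [e + 1], the clusters of level [e] by a
    star with random centre shows that the minimum spanning tree costs at most
    the sum over the levels of the average distances between sibling clusters.
    Conversely, an edge of an optimal tree leaves each cluster, and the cost of a
    cluster is charged to that edge: it is the mean distance from a point to the
    points of its cell, which exceeds [2 ^ e] only by the logarithm of a ratio of
    ball sizes. These logarithms telescope over the levels; only O(log n) levels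
    around the scale of the tree matter, so that the sum is at most
    O(log n) poly(log log n) times the cost of the tree.

    The sibling costs are estimated from linear counts: sample two siblings at
    the right rate by hashing cluster labels, test by fingerprints that the
    samples are single clusters with a common parent, and read off the mean
    distance between them from the counts of points with given parities of
    random sets of cuts. The median of O(log n) runs amplifies the success
    probability. *)
Require Import Defs.
From mathcomp Require Import all_boot all_order all_algebra.
From mathcomp Require Import boolp reals sequences exp.
From mathcomp Require Import zify ring lra.

Set Implicit Arguments.
Unset Strict Implicit.
Unset Printing Implicit Defensive.

Import Order.TTheory GRing.Theory Num.Theory.
Local Open Scope ring_scope.

(** * Expectations over finite uniform spaces *)

(** The number of levels grows with [log (n * d * Delta)] but the approximation factor must not:
    only about [log n] levels may contribute, and on each the loss may be polynomial in [J] only,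
    where [2 ^ J] is of order [log n]. This [J] makes [n ^ 2 * exp (- 2 ^ J / 4)] small, so that
    pairs much farther apart than [2 ^ J] times the scale of a common cell are negligible. The
    obstacle in the upper bound is that a tree edge pays for a cell exactly when a kept cut
    separates its ends, an event correlated with the shape of the cell; fixing that cut restores
    independence at the price of an additive 1 in the distances. The obstacle in the estimator is
    that the right sampling rate depends on the unknown number of cells. All rates are tried with a
    penalty, and a multiple [c0] of the scale is added to the distances: it pays for the penalties,
    since the numbers of cells that merge telescope. The randomness (levels of all cuts, hashes of
    all sets of points) is huge but free; all its ranges are powers of 2, so that fair bits encode
    it exactly. *)

Section Expectation.
Variable R : realType.

(** Over an empty type this is 0 by the convention for division; hence the sign condition in
    [Ex_le_const]. *)
Definition Ex (T : finType) (f : T -> R) : R := (\sum_x f x) / #|T|%:R.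

Definition Pr (T : finType) (A : pred T) : R := Ex (fun x => (A x)%:R).

Section OneSpace.
Variable T : finType.
Implicit Types (f g : T -> R) (A B : pred T).

Lemma eq_Ex f g : f =1 g -> Ex f = Ex g.
Proof. by move=> fg; rewrite /Ex (eq_bigr g). Qed.

Lemma ExD f g : Ex (fun x => f x + g x) = Ex f + Ex g.
Proof. by rewrite /Ex big_split mulrDl. Qed.

Lemma ExZl c f : Ex (fun x => c * f x) = c * Ex f.
Proof. by rewrite /Ex -mulr_sumr mulrA. Qed.

Lemma ExZr c f : Ex (fun x => f x * c) = Ex f * c.
Proof. by rewrite mulrC -ExZl; apply: eq_Ex => x; rewrite mulrC. Qed.

Lemma ExN f : Ex (fun x => - f x) = - Ex f.
Proof. by rewrite -[RHS]mulN1r -ExZl; apply: eq_Ex => x; rewrite mulN1r. Qed.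

Lemma ExB f g : Ex (fun x => f x - g x) = Ex f - Ex g.
Proof. by rewrite ExD ExN. Qed.

Lemma Ex_sum (I : Type) (r : seq I) (P : pred I) (F : I -> T -> R) :
  Ex (fun x => \sum_(i <- r | P i) F i x) = \sum_(i <- r | P i) Ex (F i).
Proof. by rewrite /Ex exchange_big /= mulr_suml. Qed.

Lemma ler_Ex f g : (forall x, f x <= g x) -> Ex f <= Ex g.
Proof. by move=> fg; rewrite /Ex ler_wpM2r ?invr_ge0 // ler_sum. Qed.

Lemma Ex_ge0 f : (forall x, 0 <= f x) -> 0 <= Ex f.
Proof. by move=> f0; rewrite /Ex mulr_ge0 ?invr_ge0 // sumr_ge0. Qed.

Lemma Ex0 : Ex (fun _ : T => 0) = 0.
Proof. by rewrite /Ex big1 ?mul0r. Qed.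

Lemma Ex_const c : (0 < #|T|)%N -> Ex (fun _ : T => c) = c.
Proof.
move=> T0; rewrite /Ex sumr_const -[c *+ _]mulr_natr mulfK //.
by rewrite pnatr_eq0 -lt0n.
Qed.

Lemma Ex_le_const f c : 0 <= c -> (forall x, f x <= c) -> Ex f <= c.
Proof.
move=> c0 fc; have [T0|] := posnP #|T|; last first.
  by move=> T0; rewrite -[leRHS](Ex_const c T0); apply: ler_Ex.
by rewrite /Ex T0 invr0 mulr0.
Qed.

Lemma Pr_ge0 A : 0 <= Pr A.
Proof. exact: Ex_ge0. Qed.

Lemma Pr_le1 A : Pr A <= 1.
Proof. by apply: Ex_le_const => // x; case: (A x). Qed.

Lemma PrE A : Pr A = #|A|%:R / #|T|%:R.
Proof. by rewrite /Pr /Ex -natr_sum -sum1_card -big_mkcond. Qed.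

Lemma le_Pr A B : (forall x, A x -> B x) -> Pr A <= Pr B.
Proof.
move=> AB; apply: ler_Ex => x; rewrite ler_nat.
by case: (boolP (A x)) => // /AB ->.
Qed.

Lemma PrC A : (0 < #|T|)%N -> Pr (fun x => ~~ A x) = 1 - Pr A.
Proof.
move=> T0; rewrite -[1](Ex_const 1 T0) -ExB; apply: eq_Ex => x.
by case: (A x); rewrite ?subrr ?subr0.
Qed.

Lemma PrU A B : Pr (fun x => A x || B x) <= Pr A + Pr B.
Proof.
rewrite -ExD; apply: ler_Ex => x.
by case: (A x); case: (B x); rewrite ?addr0 ?add0r //= lerDl ler01.
Qed.

Lemma Pr_exists (I : finType) (P : pred I) (A : I -> pred T) :
  Pr (fun x => [exists i, P i && A i x]) <= \sum_(i | P i) Pr (A i).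
Proof.
rewrite -Ex_sum; apply: ler_Ex => x.
case: existsP => [[i /andP[Pi Ai]]|_]; last exact: sumr_ge0.
by rewrite (bigD1 i) //= Ai lerDl sumr_ge0.
Qed.

Lemma markov f a : 0 < a -> (forall x, 0 <= f x) ->
  Pr (fun x => a <= f x) <= Ex f / a.
Proof.
move=> a0 f0; rewrite -ExZr; apply: ler_Ex => x.
case: (leP a (f x)) => [afx|_]; first by rewrite ler_pdivlMr // mul1r.
by rewrite divr_ge0 // ltW.
Qed.

End OneSpace.

Lemma Ex_bij (T U : finType) (h : T -> U) (f : U -> R) :
  bijective h -> Ex (fun x => f (h x)) = Ex f.
Proof.
move=> hb; rewrite /Ex (bij_eq_card hb); congr (_ / _).
by rewrite [RHS](reindex h) //; apply: onW_bij.
Qed.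

Lemma Ex_pair (T U : finType) (f : T -> U -> R) :
  Ex (fun x : T * U => f x.1 x.2) = Ex (fun x => Ex (f x)).
Proof.
rewrite /Ex -(pair_bigA _ f) /= -mulr_suml card_prod natrM invfM -mulrA.
by rewrite [X in _ * X = _]mulrC.
Qed.

Lemma Ex_fst (T U : finType) (f : T -> R) : (0 < #|U|)%N ->
  Ex (fun x : T * U => f x.1) = Ex f.
Proof.
by move=> U0; rewrite (Ex_pair (fun x _ => f x)); apply: eq_Ex => x; rewrite Ex_const.
Qed.

Lemma Ex_snd (T U : finType) (f : U -> R) : (0 < #|T|)%N ->
  Ex (fun x : T * U => f x.2) = Ex f.
Proof. by move=> T0; rewrite (Ex_pair (fun _ => f)) Ex_const. Qed.

Lemma Ex_pairM (T U : finType) (f : T -> R) (g : U -> R) :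
  Ex (fun x : T * U => f x.1 * g x.2) = Ex f * Ex g.
Proof.
rewrite (Ex_pair (fun x y => f x * g y)) -ExZr.
by apply: eq_Ex => x; rewrite ExZl.
Qed.

Lemma Ex_exchange (T U : finType) (f : T -> U -> R) :
  Ex (fun x => Ex (f x)) = Ex (fun y => Ex (fun x => f x y)).
Proof.
rewrite /Ex -!mulr_suml exchange_big /= -!mulrA; congr (_ * _).
exact: mulrC.
Qed.

Section Product.
Variables I T : finType.

Lemma Ex_ffun_prod (g : I -> T -> R) :
  Ex (fun w : {ffun I -> T} => \prod_i g i (w i)) = \prod_i Ex (g i).
Proof.
rewrite /Ex -bigA_distr_bigA big_split /=; congr (_ * _).
by rewrite prodr_const card_ffun natrX exprVn.
Qed.

Definition upd (w : {ffun I -> T}) (i : I) (t : T) : {ffun I -> T} :=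
  [ffun j => if j == i then t else w j].

(** Exchanging a coordinate with a fresh sample is an involution of [{ffun I -> T} * T], so
    resampling preserves the uniform measure. Independence of one coordinate from the rest is
    derived from this. *)
Lemma Ex_upd (i : I) (h : {ffun I -> T} -> R) :
  Ex (fun w => Ex (fun t => h (upd w i t))) = Ex h.
Proof.
case: (pickP (mem T)) => [t0 _|T0]; last first.
  have e0 w : Ex (fun t => h (upd w i t)) = 0.
    by rewrite /Ex big_pred0 ?mul0r // => t; have := T0 t; rewrite inE.
  rewrite (eq_Ex e0) Ex0 /Ex big_pred0 ?mul0r // => w.
  by have := T0 (w i); rewrite inE.
rewrite -(Ex_pair (fun w t => h (upd w i t))).
pose s (x : {ffun I -> T} * T) := (upd x.1 i x.2, x.1 i).
have sK : involutive s.
  case=> w t; rewrite /s /= /upd; congr pair; last by rewrite ffunE eqxx.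
  by apply/ffunP => j; rewrite !ffunE; case: eqP => [->|].
rewrite -(Ex_bij (fun x => h (upd x.1 i x.2)) (inv_bij sK)).
have T0 : (0 < #|T|)%N by apply/card_gt0P; exists t0.
rewrite -(Ex_fst h T0); apply: eq_Ex => -[w t]; congr h.
by apply/ffunP => j; rewrite !ffunE; case: eqP => [->|].
Qed.

Lemma Ex_indep (i : I) (g : T -> R) (h : {ffun I -> T} -> R) :
  (forall w t, h (upd w i t) = h w) ->
  Ex (fun w : {ffun I -> T} => g (w i) * h w) = Ex g * Ex h.
Proof.
move=> hi; rewrite -(Ex_upd i) mulrC -ExZr; apply: eq_Ex => w.
by rewrite mulrC -ExZr; apply: eq_Ex => t; rewrite hi /upd ffunE eqxx.
Qed.

Lemma Ex_coord (i : I) (g : T -> R) : (0 < #|T|)%N ->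
  Ex (fun w : {ffun I -> T} => g (w i)) = Ex g.
Proof.
move=> T0; have W0 : (0 < #|{ffun I -> T}|)%N by rewrite card_ffun expn_gt0 T0.
rewrite -[RHS]mulr1 -(Ex_const 1 W0) -(@Ex_indep i g (fun=> 1)) //.
by apply: eq_Ex => w; rewrite mulr1.
Qed.

End Product.

Lemma chebyshev (n : nat) (T : finType) (f : T -> R) (B a : R) :
  0 <= B -> 0 < a -> (0 < #|T|)%N -> (forall x, 0 <= f x <= B) ->
  Pr (fun w : {ffun 'I_n.+1 -> T} =>
        a <= `|(\sum_r f (w r)) / n.+1%:R - Ex f|) <= B ^+ 2 / (a ^+ 2 * n.+1%:R).
Proof.
move=> B0 a0 T0 fB; set mu := Ex f; pose g x := f x - mu.
have muB : 0 <= mu <= B.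
  rewrite Ex_ge0 => [|x]; last by case/andP: (fB x).
  by apply: Ex_le_const => // x; case/andP: (fB x).
have g0 : Ex g = 0 by rewrite ExB Ex_const // subrr.
have gB x : g x ^+ 2 <= B ^+ 2.
  rewrite -real_normK ?num_real // ler_sqr ?nnegrE //.
  by rewrite /g ler_norml; have := fB x; lra.
have n0 : 0 < n.+1%:R :> R by rewrite ltr0n.
have sE (w : {ffun 'I_n.+1 -> T}) :
    (\sum_r f (w r)) / n.+1%:R - mu = (\sum_r g (w r)) / n.+1%:R.
  rewrite sumrB sumr_const card_ord mulrBl -[mu *+ _]mulr_natr mulfK //.
  by rewrite gt_eqF.
have E2 : Ex (fun w : {ffun 'I_n.+1 -> T} => (\sum_r g (w r)) ^+ 2)
    <= n.+1%:R * B ^+ 2.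
  under eq_Ex => w do rewrite expr2 big_distrlr /=.
  rewrite Ex_sum mulr_natl -[X in _ *+ X]card_ord -sumr_const.
  (* Off-diagonal terms vanish by independence, as [g] is centred. *)
  apply: ler_sum => r _; rewrite Ex_sum (bigD1 r) //= big1 ?addr0 => [|s sr].
    by apply: Ex_le_const => [|w]; rewrite ?exprn_ge0 // -expr2.
  rewrite (@Ex_indep _ _ r g (fun w => g (w s))) ?g0 ?mul0r // => w t.
  by rewrite ffunE (negPf sr).
have -> : B ^+ 2 / (a ^+ 2 * n.+1%:R) = n.+1%:R * B ^+ 2 / (a * n.+1%:R) ^+ 2.
  by field; rewrite ?gt_eqF // -?natr1; have := n0; lra.
have an0 : 0 < (a * n.+1%:R) ^+ 2 by rewrite exprn_gt0 // mulr_gt0.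
apply: le_trans (ler_wpM2r _ E2); last by rewrite invr_ge0 ltW.
apply: le_trans (markov an0 _) => [|w]; last exact: sqr_ge0.
apply: le_Pr => w; rewrite sE normrM normfV [`|n.+1%:R|]ger0_norm // ler_pdivlMr //.
move=> le; rewrite -[leRHS]real_normK ?num_real // ler_sqr ?nnegrE //.
by rewrite mulr_ge0 // ltW.
Qed.

Lemma card_ord_lt (N m : nat) : (m <= N)%N -> #|[pred x : 'I_N | (x < m)%N]| = m.
Proof.
move=> mN; have winj : injective (widen_ord mN) by move=> x y /(congr1 val) /= /val_inj.
rewrite -[RHS]card_ord -(card_image winj).
apply: eq_card => x; rewrite !inE; apply/idP/imageP => [xm|[y _ ->]]; last exact: (ltn_ord y).
by exists (Ordinal xm) => //; apply: val_inj.
Qed.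

(** A priority in a range of size [2 ^ M] realises every rate [2 ^- e] exactly, by events that are
    nested in [e]. *)
Lemma Pr_lt_exp2 (M e : nat) : (e <= M)%N ->
  Pr (fun x : 'I_(2 ^ M) => (x < 2 ^ (M - e))%N) = 2^-1 ^+ e.
Proof.
move=> eM; rewrite PrE card_ord card_ord_lt ?leq_exp2l ?leq_subr //.
rewrite -{2}(subnK eM) expnD natrM !natrX invfM mulrA divff ?mul1r ?exprVn //.
by rewrite expf_neq0 // pnatr_eq0.
Qed.

End Expectation.

(** * Spanning trees *)

Section ConnectedGraphs.
Variable V : finType.
Implicit Types (X : {set V}) (E : {set V * V}).

Lemma adjC E : symmetric (adj E).
Proof. by move=> x y; rewrite /adj orbC. Qed.

Lemma connect_adjC E x y : connect (adj E) x y = connect (adj E) y x.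
Proof. exact: (sym_connect_sym (@adjC E)). Qed.

Lemma connect_adjS E E' x y :
  E \subset E' -> connect (adj E) x y -> connect (adj E') x y.
Proof.
move=> EE'; apply: connect_sub => a b; rewrite /adj => h; apply: connect1.
by move: h; rewrite /adj => /orP[] /(fintype.subsetP EE') ->; rewrite ?orbT.
Qed.

(** An inclusion-minimal connected subset of [E] is a tree: minimality makes every edge a bridge,
    whereas a loop, a second orientation or a cycle would offer a detour around an edge. *)
Lemma connected_on_spanning_tree X E :
  connected_on X E -> (forall x y, (x, y) \in E -> (x \in X) && (y \in X)) ->
  exists2 E', spanning_tree X E' & E' \subset E.
Proof.
move=> cE XE; pose P E := `[< connected_on X E >].
have PE : P E by apply/asboolP.
have [E' /minsetP[/asboolP cE' minE'] subE] := minset_exists PE.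
exists E' => //.
have bridge x y : (x, y) \in E' -> ~~ connect (adj (E' :\ (x, y))) x y.
  move=> xyE; apply/negP => cxy.
  suff /minE' : P (E' :\ (x, y)).
    by move=> /(_ (subsetDl _ _)) eqE; move: xyE; rewrite -eqE !inE eqxx.
  apply/asboolP => a b aX bX; move: (cE' a b aX bX).
  apply: connect_sub => {a b aX bX} a b; rewrite /adj.
  have [abE|nxy] := eqVneq (a, b) (x, y); first by case: abE => -> ->.
  have [baE|nyx] := eqVneq (b, a) (x, y).
    by case: baE => -> ->; rewrite connect_adjC.
  by move=> h; apply: connect1; rewrite /adj !inE nxy nyx.
have simpleE' : simple_graph_on X E'.
  move=> x y xyE; have /andP[xX yX] := XE _ _ (fintype.subsetP subE _ xyE).
  have nb := bridge _ _ xyE.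
  have nxy : x != y by apply: contraNneq nb => ->; exact: connect0.
  split=> //; apply: contra nb => yxE; apply: connect1.
  rewrite /adj !inE yxE andbT; apply/orP; right.
  by apply: contraNneq nxy => -[->].
split=> // -[|x [|y [|z c]]] // /andP[/= /and3P[xy yz zc]].
rewrite !inE !negb_or => /andP[/and3P[nxy nxz xc] /andP[/andP[nyz yc] _]].
(* The first edge of the cycle, in the orientation that lies in [E'], is bypassed through [z] and
   the rest of the cycle: each of those steps has an end outside [{x, y}], so it survives the
   removal of [e]. *)
suff [e [eE exy]] : exists e, e \in E' /\ (e = (x, y) \/ e = (y, x)).
  have := bridge e.1 e.2; rewrite -surjective_pairing => /(_ eE) /negP[].
  suff cyx : connect (adj (E' :\ e)) y x.
    by case: exy cyx => -> //= cyx; rewrite connect_adjC.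
  have ee : (e.1 \in [:: x; y]) && (e.2 \in [:: x; y]).
    by case: exy => ->; rewrite !inE !eqxx ?orbT.
  have adjS a b : a \notin [:: x; y] -> adj E' a b -> adj (E' :\ e) a b.
    move=> axy; rewrite /adj !inE => ab.
    have ne1 : (a, b) != e by apply: contraNneq axy => eab; case/andP: ee; rewrite -eab.
    have ne2 : (b, a) != e by apply: contraNneq axy => eab; case/andP: ee; rewrite -eab.
    by rewrite ne1 ne2.
  have nzxy : z \notin [:: x; y] by rewrite !inE negb_or eq_sym nxz eq_sym nyz.
  apply: (@connect_trans _ _ z).
    by rewrite connect_adjC; apply: connect1; apply: adjS => //; rewrite adjC.
  apply/connectP; exists (rcons c x); last by rewrite last_rcons.
  elim: c z zc xc yc nzxy {nxz nyz yz} => [|w c IHc] z /= /andP[zw wc].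
    by move=> _ _ nz; rewrite adjS.
  rewrite !inE !negb_or => /andP[nxw xc] /andP[nyw yc] nz.
  have nwxy : w \notin [:: x; y] by rewrite !inE negb_or eq_sym nxw eq_sym nyw.
  by rewrite adjS ?inE ?negb_or //= IHc.
by move: xy; rewrite /adj => /orP[]; [exists (x, y)|exists (y, x)]; split=> //; [left|right].
Qed.

End ConnectedGraphs.

Section SpanningTreeCost.
Variables (R : realType) (p : R) (d Delta : nat).
Implicit Types (X : {set point d Delta}) (E : {set point d Delta * point d Delta}).
Local Notation dist := (@point_dist R p d Delta).

Lemma point_dist_ge0 x y : 0 <= dist x y.
Proof. exact: powR_ge0. Qed.

Lemma MST_ge0 X : 0 <= MST p X.
Proof.
have [E _ [-> _]] := MST_min p X.
by apply: sumr_ge0 => e _; exact: point_dist_ge0.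
Qed.

Lemma MST_le_connected X E : connected_on X E ->
  (forall x y, (x, y) \in E -> (x \in X) && (y \in X)) ->
  MST p X <= tree_cost p E.
Proof.
move=> cE XE; have [E' tE' subE] := connected_on_spanning_tree cE XE.
have [E0 _ [-> /(_ _ tE')]] := MST_min p X.
move=> /le_trans; apply; rewrite /tree_cost [leRHS](big_setID E') /=.
rewrite (setIidPr subE) lerDl sumr_ge0 // => e _; exact: point_dist_ge0.
Qed.

Lemma MST_small X : (#|X| <= 1)%N -> MST p X = 0.
Proof.
move=> X1; apply/eqP; rewrite eq_le MST_ge0 andbT.
apply: le_trans (@MST_le_connected X finset.set0 _ _) _ => [x y xX yX|x y|].
- by have /card_le1_eqP/(_ x y xX yX) -> := X1.
- by rewrite inE.
- by rewrite /tree_cost big_set0.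
Qed.

End SpanningTreeCost.

Section SumBounds.
Variable R : realType.

Lemma ler_sum_sub (T : finType) (A B : {set T}) (f : T -> R) :
  (forall x, 0 <= f x) -> A \subset B -> \sum_(x in A) f x <= \sum_(x in B) f x.
Proof.
move=> f0 AB; rewrite [leRHS](big_setID A) /= (setIidPr AB).
by rewrite lerDl sumr_ge0.
Qed.

Lemma ler_sum_setU (T : finType) (A B : {set T}) (f : T -> R) :
  (forall x, 0 <= f x) ->
  \sum_(x in A :|: B) f x <= \sum_(x in A) f x + \sum_(x in B) f x.
Proof.
move=> f0; rewrite [leLHS](big_setID A) /= finset.setUK lerD2l.
apply: ler_sum_sub => //; rewrite setDUl finset.setDv finset.set0U.
exact: subsetDl.
Qed.

Lemma ler_sum_bigcup (I T : finType) (P : pred I) (A : I -> {set T}) (f : T -> R) :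
  (forall x, 0 <= f x) ->
  \sum_(x in \bigcup_(i | P i) A i) f x <= \sum_(i | P i) \sum_(x in A i) f x.
Proof.
move=> f0; rewrite (exchange_big_dep (fun x => x \in \bigcup_(i | P i) A i)) /=.
  apply: ler_sum => x /bigcupP[i Pi xi].
  by rewrite (bigD1 i) ?Pi //= lerDl sumr_ge0.
by move=> i x Pi xi; apply/bigcupP; exists i.
Qed.

Lemma ler_sum_imset (T U : finType) (A : {set T}) (h : T -> U) (f : U -> R) :
  (forall x, 0 <= f x) ->
  \sum_(y in [set h x | x in A]) f y <= \sum_(x in A) f (h x).
Proof.
move=> f0; rewrite [leRHS](partition_big h (fun y => y \in [set h x | x in A])) /=.
  apply: ler_sum => y /imsetP[x xA ->].
  by rewrite (bigD1 x) ?xA ?eqxx //= lerDl sumr_ge0.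
by move=> x xA; apply: imset_f.
Qed.

Lemma exists_le_mean (T : finType) (A : {set T}) (f : T -> R) : A != finset.set0 ->
  exists2 x, x \in A & f x <= (\sum_(y in A) f y) / #|A|%:R.
Proof.
case/set0Pn => x0 x0A; case: (arg_minP f x0A) => x xA minx; exists x => //.
have A0 : (0 < #|A|)%N by apply/card_gt0P; exists x0.
rewrite ler_pdivlMr ?ltr0n // mulr_natr -sumr_const.
by apply: ler_sum => y; apply: minx.
Qed.

Lemma mean_le_const (T : finType) (A : {set T}) (f : T -> R) c : 0 <= c ->
  (forall x, x \in A -> f x <= c) -> (\sum_(x in A) f x) / #|A|%:R <= c.
Proof.
move=> c0 fc; have [A0|A0] := posnP #|A|; first by rewrite A0 invr0 mulr0.
by rewrite ler_pdivrMr ?ltr0n // mulr_natr -sumr_const ler_sum.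
Qed.

Lemma const_le_mean (T : finType) (A : {set T}) (f : T -> R) c : A != finset.set0 ->
  (forall x, x \in A -> c <= f x) -> c <= (\sum_(x in A) f x) / #|A|%:R.
Proof.
move=> A0 fc; rewrite ler_pdivlMr ?ltr0n ?card_gt0 // mulr_natr -sumr_const.
exact: ler_sum.
Qed.

End SumBounds.

(** * Clusters and siblings *)

(* A clustering is a labelling [u] of the points; [pi] maps the label of a
   cluster to the label of its parent cluster. *)
Section Siblings.
Variables (R : realType) (V U W : finType) (X : {set V}) (u : V -> U) (pi : U -> W).
Implicit Types (g : V -> V -> R) (A B : {set V}).

Definition fiber (a : U) : {set V} := [set x in X | u x == a].

Definition labels : {set U} := [set u x | x in X].

Definition siblings (a : U) : {set U} := [set b in labels | pi b == pi a].

Definition mean g (A B : {set V}) : R :=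
  (\sum_(x in A) \sum_(y in B) g x y) / (#|A|%:R * #|B|%:R).

(** For the children of one parent this is the average, over the choice of the centre [a], of the
    cost of the star from the other children to [a], each edge being priced by a mean distance. *)
Definition sibling_cost g : R :=
  \sum_(a in labels)
    (\sum_(b in siblings a | b != a) mean g (fiber b) (fiber a)) / #|siblings a|%:R.

Lemma fiber_neq0 a : a \in labels -> fiber a != finset.set0.
Proof.
by case/imsetP => x xX ->; apply/set0Pn; exists x; rewrite inE xX eqxx.
Qed.

Lemma siblings_gt0 a : a \in labels -> (0 < #|siblings a|)%N.
Proof. by move=> al; apply/card_gt0P; exists a; rewrite inE al eqxx. Qed.

Lemma meanE g A B :
  mean g A B = (\sum_(y in B) ((\sum_(x in A) g x y) / #|A|%:R)) / #|B|%:R.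
Proof. by rewrite /mean exchange_big /= -mulr_suml invfM mulrA. Qed.

Lemma mean_le g g' A B : (forall x y, x \in A -> y \in B -> g x y <= g' x y) ->
  mean g A B <= mean g' A B.
Proof.
move=> gg; rewrite /mean ler_wpM2r ?invr_ge0 ?mulr_ge0 //.
by apply: ler_sum => x xA; apply: ler_sum => y yB; apply: gg.
Qed.

Lemma mean_ge0 g A B : (forall x y, 0 <= g x y) -> 0 <= mean g A B.
Proof.
move=> g0; rewrite /mean mulr_ge0 ?invr_ge0 ?mulr_ge0 //.
by apply: sumr_ge0 => x _; apply: sumr_ge0.
Qed.

Lemma meanD g g' A B : mean (fun x y => g x y + g' x y) A B = mean g A B + mean g' A B.
Proof.
rewrite /mean -mulrDl -big_split /=; congr (_ / _).
by apply: eq_bigr => x _; rewrite -big_split.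
Qed.

Lemma meanZ c g A B : mean (fun x y => c * g x y) A B = c * mean g A B.
Proof.
rewrite /mean mulrA mulr_sumr; congr (_ / _).
by apply: eq_bigr => x _; rewrite mulr_sumr.
Qed.

Lemma mean_const c A B : A != finset.set0 -> B != finset.set0 -> mean (fun _ _ => c) A B = c.
Proof.
rewrite -!card_gt0 => A0 B0; rewrite /mean sumr_const sumr_const -mulrnA.
rewrite -[c *+ _]mulr_natr mulnC natrM mulfK //.
by rewrite -natrM pnatr_eq0 -lt0n muln_gt0 A0.
Qed.

Lemma mean_le_sum g A B : (forall x y, 0 <= g x y) ->
  mean g A B <= \sum_(x in A) \sum_(y in B) g x y.
Proof.
move=> g0; have S0 : 0 <= \sum_(x in A) \sum_(y in B) g x y.
  by apply: sumr_ge0 => x _; apply: sumr_ge0.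
have [A0|A0] := posnP #|A|; first by rewrite /mean A0 mul0r invr0 mulr0.
have [B0|B0] := posnP #|B|; first by rewrite /mean B0 mulr0 invr0 mulr0.
rewrite /mean ler_pdivrMr ?mulr_gt0 ?ltr0n // ler_peMr //.
by rewrite -natrM ler1n muln_gt0 A0.
Qed.

Lemma sibling_cost_ge0 g : (forall x y, 0 <= g x y) -> 0 <= sibling_cost g.
Proof.
move=> g0; apply: sumr_ge0 => a _; rewrite mulr_ge0 ?invr_ge0 //.
by apply: sumr_ge0 => b _; apply: mean_ge0.
Qed.

Lemma sibling_costD g g' :
  sibling_cost (fun x y => g x y + g' x y) = sibling_cost g + sibling_cost g'.
Proof.
rewrite /sibling_cost -big_split /=; apply: eq_bigr => a _.
rewrite -mulrDl -big_split /=; congr (_ / _).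
by apply: eq_bigr => b _; rewrite meanD.
Qed.

Lemma sibling_costZ c g :
  sibling_cost (fun x y => c * g x y) = c * sibling_cost g.
Proof.
rewrite /sibling_cost mulr_sumr; apply: eq_bigr => a _.
rewrite mulrA mulr_sumr; congr (_ / _).
by apply: eq_bigr => b _; rewrite meanZ.
Qed.

Lemma sibling_cost_le g g' :
  (forall x y, x \in X -> y \in X -> u x != u y -> pi (u x) = pi (u y) ->
    g x y <= g' x y) ->
  sibling_cost g <= sibling_cost g'.
Proof.
move=> gg; apply: ler_sum => a _; rewrite ler_wpM2r ?invr_ge0 //.
apply: ler_sum => b; rewrite inE => /andP[/andP[bl /eqP ba] nba].
apply: mean_le => x y; rewrite !inE => /andP[xX /eqP xb] /andP[yX /eqP ya].
by apply: gg => //; rewrite ?xb ?ya.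
Qed.

End Siblings.

(** * Bounding the minimum spanning tree through a clustering *)

Section MSTofClusters.
Variables (R : realType) (p : R) (d Delta : nat).
Local Notation V := (point d Delta).
Local Notation dist := (@point_dist R p d Delta).
Variable U : finType.
Implicit Types (X : {set V}) (u : V -> U).

(** The optimal trees of the clusters and the edges from the representatives [r a] to [y] form a
    connected graph on [X]. *)
Lemma MST_star X u (y : V) (r : U -> V) : y \in X ->
  (forall a, a \in labels X u -> r a \in fiber X u a) ->
  MST p X <= \sum_(a in labels X u) MST p (fiber X u a)
             + \sum_(a in labels X u | a != u y) dist (r a) y.
Proof.
move=> yX rX.
have /choice[T tT] : forall a, exists E, spanning_tree (fiber X u a) E /\
    MST p (fiber X u a) = tree_cost p E.
  by move=> a; have [E tE [cE _]] := MST_min p (fiber X u a); exists E.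
pose S := [set (r a, y) | a in [set a in labels X u | a != u y]].
pose E := (\bigcup_(a in labels X u) T a) :|: S.
have XE x z : (x, z) \in E -> (x \in X) && (z \in X).
  rewrite inE => /orP[/bigcupP[a al xz]|/imsetP[a]].
    have [[sT _ _] _] := tT a; have [] := sT _ _ xz.
    by rewrite !inE => /andP[-> _] /andP[-> _].
  by rewrite inE => /andP[/rX + _] [-> ->]; rewrite inE yX => /andP[->].
apply: le_trans (@MST_le_connected R p d Delta X E _ XE) _.
  have toy x : x \in X -> connect (adj E) x y.
    move=> xX; have uxl : u x \in labels X u by apply: imset_f.
    have sub : T (u x) \subset E.
      by apply: fintype.subset_trans (subsetUl _ _); apply: bigcup_sup.
    have [[_ cT _] _] := tT (u x).
    have xf : x \in fiber X u (u x) by rewrite inE xX eqxx.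
    have [uxy|nuxy] := eqVneq (u x) (u y).
      by apply: (connect_adjS sub); apply: cT => //; rewrite inE yX uxy eqxx.
    apply: (@connect_trans _ _ (r (u x))).
      by apply: (connect_adjS sub); apply: cT => //; apply: rX.
    apply: connect1; apply/orP; left; rewrite inE; apply/orP; right.
    by apply/imsetP; exists (u x); rewrite // inE uxl nuxy.
  move=> x z xX zX; apply: connect_trans (toy x xX) _.
  by rewrite connect_adjC; apply: toy.
have d0 (e : V * V) : 0 <= dist e.1 e.2 by apply: point_dist_ge0.
apply: le_trans (ler_sum_setU _ _ d0) _; apply: lerD.
  apply: le_trans (ler_sum_bigcup _ _ d0) _; apply: ler_sum => a _.
  by have [_ ->] := tT a.
apply: le_trans (ler_sum_imset _ _ d0) _ => /=.
rewrite (eq_bigl (fun a => (a \in labels X u) && (a != u y))) // => a.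
by rewrite inE.
Qed.

(** Some point of each cluster is at most as far from [y] as the average one; it serves as
    representative. *)
Lemma MST_star_mean X u y : y \in X ->
  MST p X <= \sum_(a in labels X u) MST p (fiber X u a)
    + \sum_(a in labels X u | a != u y)
        (\sum_(x in fiber X u a) dist x y) / #|fiber X u a|%:R.
Proof.
move=> yX.
have /choice[r rP] : forall a, exists x, a \in labels X u ->
    x \in fiber X u a /\
    dist x y <= (\sum_(x in fiber X u a) dist x y) / #|fiber X u a|%:R.
  move=> a; case: (boolP (a \in labels X u)) => [/fiber_neq0|_]; last by exists y.
  by move=> /(@exists_le_mean R _ _ (fun x => dist x y))[x xa le]; exists x.
apply: le_trans (MST_star yX (fun a al => (rP a al).1)) _.
by rewrite lerD2l; apply: ler_sum => a /andP[al _]; case: (rP a al).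
Qed.

(* Averaging the star bound over its centre [y]: first over the points of a
   cluster, then over the clusters. *)
Lemma MST_refine X u (W : finType) (pi : U -> W) :
  \sum_(w in labels X (pi \o u)) MST p (fiber X (pi \o u) w)
  <= \sum_(a in labels X u) MST p (fiber X u a) + sibling_cost X u pi dist.
Proof.
rewrite /sibling_cost -big_split /=.
rewrite [leRHS](partition_big pi (fun w => w \in labels X (pi \o u))) /=; last first.
  by move=> a /imsetP[x xX ->]; apply/imsetP; exists x.
apply: ler_sum => w wl.
pose Y := fiber X (pi \o u) w; pose C := [set a in labels X u | pi a == w].
have lY : labels Y u = C.
  apply/setP => a; rewrite inE; apply/imsetP/andP.
    by case=> x; rewrite inE => /andP[xX /eqP <-] ->; split=> //; apply: imset_f.
  by case=> /imsetP[x xX ->] piw; exists x; rewrite // inE xX.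
have fY a : a \in C -> fiber Y u a = fiber X u a.
  rewrite inE => /andP[_ /eqP piw]; apply/setP => x; rewrite !inE /=.
  by have [->|] := eqVneq (u x) a; rewrite ?andbF // piw eqxx !andbT.
have sC a : a \in C -> siblings X u pi a = C.
  by rewrite inE => /andP[_ /eqP piw]; apply/setP => b; rewrite !inE piw.
have C0 : (0 < #|C|)%N.
  case/imsetP: (wl) => x xX wE; apply/card_gt0P; exists (u x).
  by rewrite inE imset_f //= wE.
have CE (F : U -> R) : \sum_(a in labels X u | pi a == w) F a = \sum_(a in C) F a.
  by apply: eq_bigl => a; rewrite inE.
rewrite CE big_split /= -/Y.
have -> : \sum_(a in C) (\sum_(b in siblings X u pi a | b != a)
      mean dist (fiber X u b) (fiber X u a)) / #|siblings X u pi a|%:R =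
    (\sum_(a in C) (\sum_(b in C | b != a) mean dist (fiber X u b) (fiber X u a)))
      / #|C|%:R.
  by rewrite mulr_suml; apply: eq_bigr => a aC; rewrite sC.
rewrite -lerBlDl; apply: const_le_mean; first by rewrite -card_gt0.
move=> a aC; rewrite lerBlDl.
have al : a \in labels X u by move: aC; rewrite inE => /andP[].
rewrite (eq_bigr _ (fun b _ => meanE dist (fiber X u b) (fiber X u a))).
rewrite -mulr_suml exchange_big /= -lerBlDl; apply: const_le_mean; first exact: fiber_neq0.
move=> y ya; have yY : y \in Y by rewrite -(fY a aC) inE in ya; case/andP: ya.
have uy : u y = a by move: ya; rewrite inE => /andP[_ /eqP].
rewrite lerBlDl; apply: le_trans (MST_star_mean u yY) _.
rewrite lY uy; apply: lerD; first by apply: ler_sum => b bC; rewrite fY.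
by apply: ler_sum => b /andP[bC _]; rewrite fY.
Qed.

End MSTofClusters.

(** * Linear counters and the median of independent runs *)

Lemma eq_card_bij (T U : finType) : #|T| = #|U| ->
  exists (f : T -> U) (g : U -> T), cancel f g /\ cancel g f.
Proof.
move=> TU; exists (fun x => enum_val (cast_ord TU (enum_rank x))).
exists (fun y => enum_val (cast_ord (esym TU) (enum_rank y))).
by split=> x; rewrite enum_valK ?cast_ordK ?cast_ordKV enum_rankK.
Qed.

(* The final multiplicities are 0 or 1, so that counters modulo a power of 2
   above [#|X|] hold the exact values of the numbers [#|X :&: S omega i|]. *)
Lemma counting_algorithm (R : realType) (d Delta n m w : nat) (I : finType)
    (S : m.-tuple bool -> I -> {set point d Delta})
    (out : m.-tuple bool -> {ffun I -> nat} -> R) : (n < 2 ^ w)%N ->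
  exists alg : streaming_algorithm (update d Delta) R (#|I| * w) m,
    forall (X : {set point d Delta}) sigma omega, #|X| = n -> stream_of X sigma ->
      run alg sigma omega = out omega [ffun i => #|X :&: S omega i|].
Proof.
move=> nw; pose N := (2 ^ w).-1.
have NE : N.+1 = (2 ^ w)%N by rewrite prednK // expn_gt0.
pose St := {ffun I -> 'I_N.+1}.
have cardSt : #|{: St}| = #|{: (#|I| * w).-tuple bool}|.
  by rewrite card_ffun card_ord card_tuple card_bool NE -expnM mulnC.
have [enc [dec [encK decK]]] := eq_card_bij cardSt.
pose v omega (x : point d Delta) : St :=
  [ffun i => if x \in S omega i then inZp 1 else 0].
pose upd_ omega (s : St) (a : update d Delta) : St :=
  match a with Insert y => s + v omega y | Delete y => s - v omega y end.
exists (StreamingAlgorithm (fun _ => enc 0)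
  (fun omega s a => enc (upd_ omega (dec s) a))
  (fun omega s => out omega [ffun i => val (dec s i)])).
move=> X sigma omega cX sX; rewrite /run /=; congr out.
have foldE (l : seq (update d Delta)) s :
    foldl (fun s a => enc (upd_ omega (dec s) a)) (enc s) l =
    enc (s + \sum_(a <- l) \sum_x v omega x *~ delta a x).
  elim: l s => [|a l IHl] s /=; first by rewrite big_nil addr0.
  rewrite encK IHl big_cons addrA; congr (enc (_ + _)).
  have vE y : \sum_x v omega x *~ (x == y)%:Z = v omega y.
    rewrite (bigD1 y) //= eqxx big1 ?addr0 // => x /negPf ->.
    by rewrite mulr0z.
  case: a => y; rewrite /upd_ /delta; first by rewrite vE.
  rewrite -{1}(vE y) -sumrN; congr (_ + _).
  by apply: eq_bigr => x _; rewrite mulrNz.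
rewrite foldE encK add0r exchange_big /=.
have -> : \sum_x \sum_(a <- sigma) v omega x *~ delta a x = \sum_(x in X) v omega x.
  rewrite [RHS]big_mkcond; apply: eq_bigr => x _.
  rewrite -mulrz_sumr -/(multiplicity sigma x) sX.
  by case: (x \in X); rewrite ?mulr1z ?mulr0z.
apply/ffunP => i; rewrite !ffunE sum_ffunE.
under eq_bigr => x _ do rewrite ffunE.
rewrite -big_mkcondr /= (eq_bigl (fun x => x \in X :&: S omega i)); last first.
  by move=> x; rewrite inE.
rewrite sumr_const Zp_mulrn /= NE.
have w0 : (0 < w)%N \/ w = 0%N by case: (w); [right|left].
have le : (#|X :&: S omega i| < 2 ^ w)%N.
  by apply: leq_ltn_trans nw; rewrite -cX subset_leq_card // subsetIl.
(* Modulo [2 ^ 0] the increment is 0 rather than 1, but then every count is 0 as well. *)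
case: w0 => [w0|w0]; last first.
  by move: le; rewrite w0 expn0 ltnS leqn0 => /eqP ->; rewrite muln0 mod0n.
rewrite [(1 %% _)%N]modn_small ?mul1n ?modn_small //.
by rewrite -[1%N](expn0 2) ltn_exp2l.
Qed.

Section Median.
Variables (R : realType) (T : finType) (f : T -> R) (lo hi : R) (k : nat).

(** A strict majority is required so that both bounds on the median follow once fewer than half of
    the runs are bad. *)
Definition median (w : {ffun 'I_k -> T}) : R :=
  inf (fun v => (k < 2 * #|[set r | (f (w r) <= v)%R]|)%N).

Let bad (x : T) := ~~ (lo <= f x <= hi).

Lemma median_in (w : {ffun 'I_k -> T}) : (2 * #|[set r | bad (w r)]| < k)%N ->
  lo <= median w <= hi.
Proof.
move=> badk.
have good : (k < 2 * #|[set r | ~~ bad (w r)]|)%N.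
  have -> : [set r | ~~ bad (w r)] = ~: [set r | bad (w r)].
    by apply/setP => r; rewrite !inE.
  by have := cardsC [set r | bad (w r)]; rewrite card_ord; lia.
have lbk v : (k < 2 * #|[set r | (f (w r) <= v)%R]|)%N -> lo <= v.
  move=> kv; rewrite leNgt; apply/negP => vlo.
  suff : (#|[set r | (f (w r) <= v)%R]| <= #|[set r | bad (w r)]|)%N by lia.
  apply/subset_leq_card/fintype.subsetP => r; rewrite !inE /bad negb_and -ltNge.
  by move=> /le_lt_trans -> //.
have hik : (k < 2 * #|[set r | (f (w r) <= hi)%R]|)%N.
  apply: leq_trans good _; rewrite leq_mul2l /=.
  apply/subset_leq_card/fintype.subsetP => r.
  by rewrite !inE /bad negbK => /andP[].
apply/andP; split; first by apply: lb_le_inf; [exists hi | move=> v /lbk].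
by apply: ge_inf => //; exists lo => v /lbk.
Qed.

Lemma median_fail : Pr R bad <= 1 / 32 ->
  Pr R (fun w => ~~ (lo <= median w <= hi)) <= (9 / 16) ^+ k.
Proof.
move=> bad32; have [T0|T0] := posnP #|T|.
  have [k0|k0] := posnP k; first by rewrite [X in _ ^+ X]k0 expr0; apply: Pr_le1.
  rewrite PrE card_ffun card_ord T0 exp0n // invr0 mulr0 exprn_ge0 //.
  by rewrite divr_ge0.
(* Chernoff bound: if at least half of the runs are bad, the product of these weights is at least 1;
   the mean weight is at most [1 / 16 + (16 - 1 / 16) / 32], which is below [9 / 16]. *)
pose h (x : T) : R := if bad x then 16 else 1 / 16.
have h0 x : 0 <= h x by rewrite /h; case: ifP => _; lra.
have Eh : Ex h <= 9 / 16.
  have -> : Ex h = 1 / 16 + (16 - 1 / 16) * Pr R bad.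
    rewrite /Pr -ExZl -{1}(Ex_const (1 / 16) T0) -ExD; apply: eq_Ex => x.
    by rewrite /h; case: (bad x); rewrite ?mulr1 ?mulr0 ?addr0 // addrC subrK.
  by lra.
have Eh0 : 0 <= Ex h by apply: Ex_ge0.
apply: (@le_trans _ _ (\prod_(r < k) Ex h)); last first.
  by rewrite prodr_const card_ord lerXn2r // nnegrE; lra.
rewrite -(@Ex_ffun_prod R _ _ (fun _ => h)); apply: ler_Ex => w.
case: (boolP (lo <= _ <= _)) => [_|nmed]; first by apply: prodr_ge0.
have kbad : (k <= 2 * #|[set r | bad (w r)]|)%N.
  by rewrite leqNgt; apply: contra nmed => /median_in.
rewrite (bigID (fun r => bad (w r))) /=.
rewrite [X in X * _](eq_bigr (fun=> 16)); last by move=> r; rewrite /h => ->.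
rewrite [X in _ * X](eq_bigr (fun=> 1 / 16)); last first.
  by move=> r /negPf; rewrite /h => ->.
rewrite !prodr_const; set a := #|[pred _ | _]|; set b := #|[pred _ | _]|.
have ab : (b <= a)%N.
  have -> : a = #|[set r | bad (w r)]| by apply: eq_card => r; rewrite !inE.
  have -> : b = #|~: [set r | bad (w r)]| by apply: eq_card => r; rewrite !inE.
  by have := cardsC [set r | bad (w r)]; rewrite card_ord; lia.
rewrite div1r exprVn -(subnK ab) exprD mulfK ?expf_neq0 //; last first.
  by rewrite pnatr_eq0.
by rewrite exprn_ege1 // ler1n.
Qed.

End Median.

Section Amplification.
Variables (R : realType) (d Delta n : nat).
Local Notation V := (point d Delta).

Lemma bits_prob_bij (m : nat) (T : finType) (h : m.-tuple bool -> T) (A : pred T) :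
  bijective h -> bits_prob R (fun t => A (h t)) = Pr R A.
Proof.
move=> hb; rewrite /bits_prob -[2 ^+ m]natrX.
have -> : (2 ^ m)%N = #|{: m.-tuple bool}| by rewrite card_tuple card_bool.
by rewrite -(@PrE R _ (fun t => A (h t))) /Pr (Ex_bij (fun x => (A x)%:R) hb).
Qed.

(** As the size of [Omega] is a power of 2, [k] independent draws correspond exactly to [m * k] fair
    bits. The estimator may be phrased on sets because it only depends on their counts. *)
Lemma amplified_algorithm (Omega I : finType) (m w k : nat)
    (S : Omega -> I -> {set V}) (est : Omega -> {set V} -> R) (lo hi : {set V} -> R) :
  #|Omega| = (2 ^ m)%N -> (n < 2 ^ w)%N ->
  (forall omega (X X' : {set V}), (forall i, #|X :&: S omega i| = #|X' :&: S omega i|) ->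
    est omega X = est omega X') ->
  (forall X : {set V}, #|X| = n -> Pr R (fun omega => ~~ (lo X <= est omega X <= hi X)) <= 1 / 32) ->
  exists (m' : nat) (alg : streaming_algorithm (update d Delta) R (k * #|I| * w) m'),
    forall (X : {set V}) sigma, #|X| = n -> stream_of X sigma ->
      1 - (9 / 16) ^+ k <=
        bits_prob R (fun omega => lo X <= run alg sigma omega <= hi X).
Proof.
move=> cO nw estS estP.
pose OO := {ffun 'I_k -> Omega}; pose m' := (m * k)%N.
have cOO : #|{: m'.-tuple bool}| = #|{: OO}|.
  by rewrite card_tuple card_bool card_ffun card_ord cO -expnM.
have [h [g [hK gK]]] := eq_card_bij cOO.
pose J := ('I_k * I)%type.
pose SS (t : m'.-tuple bool) (j : J) := S (h t j.1) j.2.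
(* The output routine sees counts only; it evaluates [est] on an arbitrary set with these counts,
   which [estS] makes harmless. *)
have /choice[X0 X0P] : forall c : Omega * {ffun I -> nat}, exists X' : {set V},
    forall X : {set V}, (forall i, #|X :&: S c.1 i| = c.2 i) ->
    forall i, #|X' :&: S c.1 i| = c.2 i.
  move=> c; have [[X' X'P]|nX] :=
    pselect (exists X' : {set V}, forall i, #|X' :&: S c.1 i| = c.2 i).
    by exists X'.
  by exists finset.set0 => X XP; case: nX; exists X.
pose F (t : m'.-tuple bool) (c : {ffun J -> nat}) (x : 'I_k) : R :=
  est (h t x) (X0 (h t x, [ffun i => c (x, i)])).
pose out (t : m'.-tuple bool) (c : {ffun J -> nat}) : R :=
  median (F t c) [ffun x => x].
have [alg algP] := counting_algorithm SS out nw.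
have cJ : (#|{: J}| * w = k * #|I| * w)%N by rewrite card_prod card_ord.
move: alg algP; rewrite cJ => alg algP; exists m', alg => X sigma cX sX.
pose good (o : OO) := lo X <= median (est^~ X) o <= hi X.
have -> : bits_prob R (fun t => lo X <= run alg sigma t <= hi X) =
    bits_prob R (fun t => good (h t)).
  congr (bits_prob R _); apply/funext => t; rewrite /good (algP X) // /out.
  suff -> : median (F t [ffun i => #|X :&: SS t i|]) [ffun x => x] =
            median (est^~ X) (h t) by [].
  congr inf; apply/funext => v; congr (is_true (_ < 2 * _)%N).
  apply: eq_card => x; rewrite !inE !ffunE /F; congr (_ <= v).
  apply: estS => i; rewrite (X0P (_, _) X) /= ?ffunE // => j.
  by rewrite !ffunE.
rewrite (bits_prob_bij good (Bijective hK gK)).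
have O0 : (0 < #|{: OO}|)%N by rewrite -cOO card_tuple expn_gt0 card_bool.
have := PrC R good O0.
have := @median_fail R _ (est^~ X) (lo X) (hi X) k (estP X cX).
by rewrite -/good; lra.
Qed.

End Amplification.

(** * Embedding l_p into cuts, for p between 1 and 2 *)

Section RandomSigns.
Variables (R : realType) (d : nat).
Local Notation signs := {ffun 'I_d -> bool}.

Lemma Ex_bool (f : bool -> R) : Ex f = (f true + f false) / 2.
Proof.
rewrite /Ex card_bool; congr (_ / _).
by rewrite (bigD1 true) //= (bigD1 false) //= big1 ?addr0 // => -[].
Qed.

(** Summing along a sequence allows induction on the coordinates. *)
Definition sign_sum (s : seq 'I_d) (a : 'I_d -> R) (w : signs) : R :=
  \sum_(k <- s) (-1) ^+ w k * a k.

Lemma sign_sum_upd k s a w t : k \notin s ->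
  sign_sum s a (upd w k t) = sign_sum s a w.
Proof.
move=> ks; rewrite /sign_sum !big_seq; apply: eq_bigr => j js.
by rewrite /upd ffunE; case: eqP js => // ->; rewrite (negPf ks).
Qed.

Lemma Ex_sign_cons (h : R -> R) k s a : k \notin s ->
  Ex (fun w : signs => h (sign_sum (k :: s) a w)) =
  Ex (fun w : signs => (h (a k + sign_sum s a w) + h (- a k + sign_sum s a w)) / 2).
Proof.
move=> ks; rewrite -(Ex_upd k); apply: eq_Ex => w; rewrite Ex_bool addrC.
rewrite /sign_sum !big_cons -!/(sign_sum _ _ _) !sign_sum_upd // /upd !ffunE eqxx.
by rewrite expr1 expr0 mul1r mulN1r.
Qed.

Lemma sign_sum2 s a : uniq s ->
  Ex (fun w : signs => sign_sum s a w ^+ 2) = \sum_(k <- s) a k ^+ 2.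
Proof.
elim: s => [|k s IHs] /= => [_|/andP[ks us]].
  rewrite (@eq_Ex _ _ _ (fun=> 0)) ?Ex0 ?big_nil // => w.
  by rewrite /sign_sum big_nil expr0n.
rewrite (Ex_sign_cons (fun x => x ^+ 2)) // big_cons -IHs //.
have T0 : (0 < #|{: signs}|)%N by rewrite card_ffun card_bool expn_gt0.
rewrite -(Ex_const (a k ^+ 2) T0) -ExD; apply: eq_Ex => w.
by field.
Qed.

(** A new coefficient [a] turns a partial sum [s] of second moment [t] into one whose fourth moment
    gains [6 * a ^ 2 * t + a ^ 4], and [3 * t ^ 2 + 6 * a ^ 2 * t + a ^ 4 <= 3 * (t + a ^ 2) ^
    2]. *)
Lemma sign_sum4 s a : uniq s ->
  Ex (fun w : signs => sign_sum s a w ^+ 4) <= 3 * (\sum_(k <- s) a k ^+ 2) ^+ 2.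
Proof.
elim: s => [|k s IHs] /= => [_|/andP[ks us]].
  rewrite (@eq_Ex _ _ _ (fun=> 0)) ?Ex0 ?big_nil ?expr0n ?mulr0 // => w.
  by rewrite /sign_sum big_nil expr0n.
rewrite (Ex_sign_cons (fun x => x ^+ 4)) // big_cons.
have T0 : (0 < #|{: signs}|)%N by rewrite card_ffun card_bool expn_gt0.
rewrite (@eq_Ex _ _ _ (fun w => sign_sum s a w ^+ 4 +
    (6 * a k ^+ 2 * sign_sum s a w ^+ 2 + a k ^+ 4))); last by move=> w; field.
rewrite !ExD ExZl sign_sum2 // Ex_const //.
have := IHs us; set t := \sum_(_ <- _) _; have : 0 <= a k ^+ 4 by rewrite exprn_even_ge0.
have -> : a k ^+ 4 = (a k ^+ 2) ^+ 2 by rewrite -exprM.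
by nra.
Qed.

(* [y >= y ^+ 2 - 4/27 y ^+ 4] for [y >= 0], scaled so that the second and
   fourth moments give a lower bound of the first one. *)
Lemma khintchine s a : uniq s ->
  (5 / 9) * Num.sqrt (\sum_(k <- s) a k ^+ 2) <=
    Ex (fun w : signs => `|sign_sum s a w|).
Proof.
move=> us; set t := \sum_(_ <- _) _.
have t0 : 0 <= t by apply: sumr_ge0 => k _; apply: sqr_ge0.
have [->|tn0] := eqVneq t 0.
  by rewrite sqrtr0 mulr0; apply: Ex_ge0 => w.
set r := Num.sqrt t; have r0 : 0 < r by rewrite sqrtr_gt0 lt_neqAle eq_sym tn0.
have rt : t = r ^+ 2 by rewrite sqr_sqrtr.
have le w : sign_sum s a w ^+ 2 / r - (4 / 27) * (sign_sum s a w ^+ 4 / r ^+ 3)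
    <= `|sign_sum s a w|.
  rewrite -[sign_sum s a w ^+ 2]real_normK ?num_real //.
  have -> : sign_sum s a w ^+ 4 = `|sign_sum s a w| ^+ 4.
    by rewrite !(exprM _ 2 2) real_normK ?num_real.
  set x := `|_|; have x0 : 0 <= x by rewrite /x normr_ge0.
  set y := x / r; have y0 : 0 <= y by rewrite divr_ge0 // ltW.
  have -> : x = y * r by rewrite divfK // gt_eqF.
  have -> : (y * r) ^+ 2 / r - 4 / 27 * ((y * r) ^+ 4 / r ^+ 3) =
     r * (y ^+ 2 - 4 / 27 * y ^+ 4) by field; rewrite gt_eqF.
  rewrite mulrC ler_wpM2r ?(ltW r0) //.
  rewrite -subr_ge0.
  have -> : y - (y ^+ 2 - 4 / 27 * y ^+ 4) = y * ((2 * y - 3) ^+ 2 * (y + 3)) / 27.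
    by field.
  apply: divr_ge0 => //; apply: mulr_ge0 => //.
  by apply: mulr_ge0; [apply: sqr_ge0 | lra].
apply: le_trans (ler_Ex le); rewrite ExB ExZl !ExZr sign_sum2 // -/t.
have := sign_sum4 a us; rewrite -/t => m4.
have : Ex (fun w : signs => sign_sum s a w ^+ 4) / r ^+ 3 <= 3 * r.
  rewrite ler_pdivrMr ?exprn_gt0 //; apply: le_trans m4 _.
  by rewrite rt -exprM -mulrA -exprS.
have -> : t / r = r by rewrite rt expr2 mulfK // gt_eqF.
by lra.
Qed.

(** Given the other signs, with partial sum [r], the average of [|a k + r|] and [|- a k + r|] is at
    least [|a k|]. *)
Lemma sign_sum_ge_term s a k : uniq s -> k \in s ->
  `|a k| <= Ex (fun w : signs => `|sign_sum s a w|).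
Proof.
move=> us ks; have nk : k \notin rem k s by rewrite mem_rem_uniq // inE eqxx.
have T0 : (0 < #|{: signs}|)%N by rewrite card_ffun card_bool expn_gt0.
rewrite (@eq_Ex _ _ _ (fun w => `|sign_sum (k :: rem k s) a w|)); last first.
  by move=> w; rewrite /sign_sum (perm_big _ (perm_to_rem ks)).
rewrite (Ex_sign_cons Num.norm) // -[leLHS](Ex_const _ T0); apply: ler_Ex => w.
set r := sign_sum _ _ _; rewrite -normrN.
have := ler_normD (a k + r) (- (- a k + r)).
rewrite normrN; have -> : a k + r - (- a k + r) = 2 * a k by ring.
by rewrite normrM normrN (ger0_norm (ler0n R 2)) => ?; lra.
Qed.

(* Splitting the sum at [`|a k| = 1]: the small terms are controlled by their
   second moment, the large ones by their absolute values. *)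
Lemma sign_sum_le s a : uniq s ->
  Ex (fun w : signs => `|sign_sum s a w|) <=
    1 / 2 + \sum_(k <- s) (if `|a k| <= 1 then a k ^+ 2 / 2 else `|a k|).
Proof.
move=> us; pose b k := if `|a k| <= 1 then a k else 0.
have T0 : (0 < #|{: signs}|)%N by rewrite card_ffun card_bool expn_gt0.
have le w : `|sign_sum s a w| <= 1 / 2 + sign_sum s b w ^+ 2 / 2 +
    \sum_(k <- s) (if `|a k| <= 1 then 0 else `|a k|).
  pose c k := if `|a k| <= 1 then 0 else a k.
  have -> : sign_sum s a w = sign_sum s b w + sign_sum s c w.
    rewrite /sign_sum -big_split; apply: eq_bigr => k _ /=.
    by rewrite /b /c; case: ifP => _; rewrite mulr0 ?addr0 ?add0r.
  apply: le_trans (ler_normD _ _) _; apply: lerD.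
    set x := sign_sum s b w; rewrite -[x ^+ 2]real_normK ?num_real //.
    by have := sqr_ge0 (`|x| - 1); nra.
  apply: le_trans (ler_norm_sum _ _ _) _; apply: ler_sum => k _.
  rewrite /c normrM normrX normrN1 expr1n mul1r.
  by case: ifP => _; rewrite ?normr0.
apply: le_trans (ler_Ex le) _; rewrite !ExD !Ex_const // ExZr sign_sum2 //.
rewrite -addrA lerD2l mulr_suml -big_split /=; apply: ler_sum => k _.
by rewrite /b; case: ifP => _; rewrite ?addr0 // expr0n mul0r add0r.
Qed.

End RandomSigns.

(** * Power sums for discretised Pareto variables *)

Section ParetoSums.
Variable R : realType.
Implicit Types (x y t Y : R).

Lemma powR_succ_ge x t : 0 < x -> 0 <= t ->
  x `^ t * (1 + t / (x + 1)) <= (x + 1) `^ t.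
Proof.
move=> x0 t0; have x1 : 0 < x + 1 by lra.
have q0 : 0 < (x + 1) / x by rewrite divr_gt0.
have -> : (x + 1) `^ t = x `^ t * ((x + 1) / x) `^ t.
  by rewrite -powRM ?ltW //; congr (_ `^ t); field; rewrite gt_eqF.
rewrite ler_wpM2l ?powR_ge0 // /powR gt_eqF //.
apply: le_trans (expR_ge1Dx _); rewrite lerD2l ler_wpM2l //.
have -> : (x + 1) / x = (1 + - (x + 1)^-1)^-1 by field; rewrite !gt_eqF //; lra.
have lt1 : (x + 1)^-1 < 1 by rewrite invf_lt1 //; lra.
rewrite lnV ?posrE; last by lra.
by rewrite lerNr le_ln1Dx //; lra.
Qed.

Lemma powR_le x y t : 0 <= t -> 0 <= x -> x <= y -> x `^ t <= y `^ t.
Proof.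
by move=> t0 x0 xy; apply: ge0_ler_powR; rewrite // nnegrE // (le_trans x0 xy).
Qed.

(** From [j] to [j + 1] the power [j ^- t] drops by about [t * j ^- (t + 1)], so the sum is compared
    with a telescoping one. Capping [h] at [Y ^- t] bounds the telescoped sum; [2 + t] absorbs the
    discretisation, as [j >= 1]. *)
Lemma pareto_tail_sum (N : nat) t Y : 0 < t -> 0 < Y ->
  \sum_(j < N) (if Y <= j.+1%:R then (Y / j.+1%:R) `^ (t + 1) else 0) <=
    (2 + t) / t * Y.
Proof.
move=> t0 Y0; have Yt0 : 0 < Y `^ t by apply: powR_gt0.
pose h x := Num.min (x `^ t)^-1 (Y `^ t)^-1.
have hE x : Y <= x -> h x = (x `^ t)^-1.
  move=> Yx; apply/min_idPl; rewrite lef_pV2 ?posrE ?powR_gt0 //; last by lra.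
  by apply: powR_le; lra.
have hdec x : 0 < x -> h (x + 1) <= h x.
  move=> x0; rewrite /h le_min ge_min lef_pV2 ?posrE ?powR_gt0 //; last by lra.
  by rewrite powR_le ?ge_min ?lexx ?orbT //; lra.
have term (j : nat) : (if Y <= j.+1%:R then (Y / j.+1%:R) `^ (t + 1) else 0) <=
    (2 + t) / t * Y `^ (t + 1) * (h j.+1%:R - h j.+2%:R).
  have c0 : 0 <= (2 + t) / t * Y `^ (t + 1).
    by rewrite mulr_ge0 ?powR_ge0 // divr_ge0; lra.
  have j0 : 0 < j.+1%:R :> R by rewrite ltr0n.
  have j1 : 1 <= j.+1%:R :> R by rewrite ler1n.
  have jS : j.+2%:R = j.+1%:R + 1 :> R by rewrite -natr1.
  rewrite jS; case: ifP => [Yj|_]; last by rewrite mulr_ge0 // subr_ge0 hdec.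
  rewrite !hE //; last by lra.
  set x := j.+1%:R in j0 j1 Yj *.
  rewrite powRM ?invr_ge0 ?(ltW Y0) ?(ltW j0) // [_ / t * _]mulrC -mulrA ler_wpM2l ?powR_ge0 //.
  have P0 : 0 < x `^ t by apply: powR_gt0.
  have Q0 : 0 < (x + 1) `^ t by apply: powR_gt0; lra.
  have le := powR_succ_ge j0 (ltW t0); set P := x `^ t in P0 le *.
  set Q := (x + 1) `^ t in Q0 le *.
  have -> : x^-1 `^ (t + 1) = (P * x)^-1.
    rewrite -powR_inv1 ?(ltW j0) // -powRrM mulN1r powRN powRD ?powRr1 ?(ltW j0) //.
    by rewrite (gt_eqF j0) implybT.
  have s0 : 0 < 1 + t / (x + 1) by rewrite ltr_wpDr // divr_ge0; lra.
  have : Q^-1 <= (P * (1 + t / (x + 1)))^-1 by rewrite lef_pV2 ?posrE ?mulr_gt0.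
  have -> : (P * (1 + t / (x + 1)))^-1 = P^-1 * ((x + 1) / (x + 1 + t)).
    by field; rewrite !gt_eqF //; lra.
  move=> QP; apply: (@le_trans _ _ ((2 + t) / t * (P^-1 - P^-1 * ((x + 1) / (x + 1 + t))))).
    have -> : (2 + t) / t * (P^-1 - P^-1 * ((x + 1) / (x + 1 + t))) =
        (P * x)^-1 * ((2 + t) * x / (x + 1 + t)).
      by field; rewrite !gt_eqF //; lra.
    rewrite -[leLHS]mulr1 ler_wpM2l ?invr_ge0 ?mulr_ge0 ?(ltW P0) ?(ltW j0) //.
    by rewrite ler_pdivlMr ?mul1r; nra.
  by rewrite ler_wpM2l ?divr_ge0 //; lra.
apply: le_trans (ler_sum _ (fun (j : 'I_N) _ => term j)) _; rewrite -mulr_sumr.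
rewrite -(big_mkord xpredT (fun j => h j.+1%:R - h j.+2%:R)) /=.
have -> : \sum_(0 <= j < N) (h j.+1%:R - h j.+2%:R) = h 1 - h N.+1%:R.
  rewrite -[RHS]opprB -[in RHS](@telescope_sumr _ 0 N (fun j => h j.+1%:R)) //.
  by rewrite -sumrN; apply: eq_bigr => j _; rewrite opprB.
have hN : 0 <= h N.+1%:R by rewrite /h le_min !invr_ge0 !powR_ge0.
have h1 : h 1 <= (Y `^ t)^-1 by rewrite /h ge_min lexx orbT.
rewrite -[leLHS]mulrA ler_wpM2l ?divr_ge0 //; [lra|lra|].
apply: (@le_trans _ _ (Y `^ (t + 1) * (Y `^ t)^-1)).
  by rewrite ler_wpM2l ?powR_ge0 //; lra.
rewrite powRD ?powRr1 ?(ltW Y0) //; last by rewrite (gt_eqF Y0) implybT.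
by rewrite mulrAC divff ?mul1r // gt_eqF.
Qed.

(** The same comparison, with the increments of [j ^ t] capped at [Y ^ t]. *)
Lemma pareto_head_sum (N : nat) t Y : 0 < t -> t < 1 -> 0 <= Y ->
  \sum_(j < N) (if Y <= j.+1%:R then 0 else (Y / j.+1%:R) `^ (1 - t)) <=
    2 / t * Y.
Proof.
move=> t0 t1 Y0; pose h x := Num.min (x `^ t) (Y `^ t).
have hE x : 0 <= x -> x <= Y -> h x = x `^ t.
  by move=> x0 xY; apply/min_idPl; apply: powR_le => //; lra.
have hinc x : 0 <= x -> h x <= h (x + 1).
  move=> x0; rewrite /h le_min ge_min powR_le ?ge_min ?lexx ?orbT //; lra.
have term (j : nat) : (if Y <= j.+1%:R then 0 else (Y / j.+1%:R) `^ (1 - t)) <=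
    2 / t * Y `^ (1 - t) * (h j.+1%:R - h j%:R).
  have c0 : 0 <= 2 / t * Y `^ (1 - t) by rewrite mulr_ge0 ?powR_ge0 // divr_ge0; lra.
  have j1 : 0 <= j%:R :> R by [].
  rewrite -natr1; set x := j%:R in j1 *.
  case: (leP Y (x + 1)) => [_|Yj]; first by rewrite mulr_ge0 // subr_ge0 hinc.
  rewrite !hE //; try lra.
  rewrite powRM ?invr_ge0 //; last by lra.
  rewrite [_ / t * _]mulrC -mulrA ler_wpM2l ?powR_ge0 //.
  have Q0 : 0 < (x + 1) `^ t by apply: powR_gt0; lra.
  set Q := (x + 1) `^ t in Q0 *; set P := x `^ t.
  have PQ : P * (1 + t / (x + 1)) <= Q.
    move: j1; rewrite le_eqVlt => /orP[/eqP x0|x0]; last by apply: powR_succ_ge => //; lra.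
    by rewrite /P -x0 powR0 ?gt_eqF // mul0r ltW.
  have -> : (x + 1)^-1 `^ (1 - t) = Q / (x + 1).
    rewrite -powR_inv1; last by lra.
    rewrite -powRrM mulN1r opprB powRB ?(lt_eqF t1) //.
    by rewrite powRr1 ?powR_inv1 //; lra.
  have s0 : 0 < 1 + t / (x + 1) by rewrite ltr_wpDr // divr_ge0; lra.
  have : P <= Q * ((x + 1) / (x + 1 + t)).
    have -> : Q * ((x + 1) / (x + 1 + t)) = Q / (1 + t / (x + 1)).
      by field; rewrite !gt_eqF //; lra.
    by rewrite ler_pdivlMr.
  move=> QP; apply: (@le_trans _ _ (2 / t * (Q - Q * ((x + 1) / (x + 1 + t))))).
    have -> : 2 / t * (Q - Q * ((x + 1) / (x + 1 + t))) =
        Q / (x + 1) * (2 * (x + 1) / (x + 1 + t)).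
      by field; rewrite !gt_eqF //; lra.
    rewrite -[leLHS]mulr1 ler_wpM2l ?divr_ge0 ?(ltW Q0) //; try lra.
    by rewrite ler_pdivlMr ?mul1r; lra.
  by rewrite ler_wpM2l ?divr_ge0 //; lra.
apply: le_trans (ler_sum _ (fun (j : 'I_N) _ => term j)) _; rewrite -mulr_sumr.
rewrite -(big_mkord xpredT (fun j => h j.+1%:R - h j%:R)) /=.
rewrite (@telescope_sumr _ 0 N (fun j => h j%:R)) //.
have h0 : 0 <= h 0 by rewrite /h le_min !powR_ge0.
have hN : h N%:R <= Y `^ t by rewrite /h ge_min lexx orbT.
rewrite -[leLHS]mulrA ler_wpM2l ?divr_ge0 //; [lra|].
apply: (@le_trans _ _ (Y `^ (1 - t) * Y `^ t)).
  by rewrite ler_wpM2l ?powR_ge0 //; lra.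
rewrite -powRD ?subrK ?powRr1 //.
by rewrite oner_eq0.
Qed.

End ParetoSums.

Section LinearForms.
Variable R : realType.

Definition lp_norm (p : R) (d : nat) (a : 'I_d -> R) : R :=
  (\sum_k `|a k| `^ p) `^ p^-1.

Lemma lp_norm_ge0 p d (a : 'I_d -> R) : 0 <= lp_norm p a.
Proof. exact: powR_ge0. Qed.

Lemma sum_powR_eq0 p d (a : 'I_d -> R) : p != 0 ->
  \sum_k `|a k| `^ p = 0 -> forall k, a k = 0.
Proof.
move=> p0 /eqP; rewrite psumr_eq0 => [/allP a0 k|k _]; last exact: powR_ge0.
by have := a0 k; rewrite mem_index_enum powR_eq0 p0 andbT normr_eq0 => /(_ isT)/eqP.
Qed.

(** Restricting the coordinates to those of differences of grid points lets the random variables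
    live on a finite space. *)
Definition form_family (p c1 c2 : R) (d Delta : nat) :=
  exists (Omega : finType) (phi : Omega -> 'I_d -> R), (0 < #|Omega|)%N /\
    forall a : 'I_d -> R, (forall k, a k = 0 \/ 1 <= `|a k| <= Delta%:R) ->
    c1 * lp_norm p a <= Ex (fun w => `|\sum_k a k * phi w k|) <= c2 * lp_norm p a.

(** The form reads one uniformly random coordinate; the factor [d] undoes the averaging. *)
Lemma form_family1 d Delta : (0 < d)%N -> form_family 1 1 1 d Delta.
Proof.
move=> d0; exists 'I_d, (fun i k => if k == i then d%:R else 0).
rewrite card_ord; split=> // a _; rewrite mul1r; set E := Ex _.
suff -> : E = lp_norm 1 a by rewrite lexx.
rewrite /E /lp_norm invr1 powRr1; last by apply: sumr_ge0 => k _; apply: powR_ge0.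
rewrite /Ex card_ord mulr_suml; apply: eq_bigr => i _; rewrite powRr1 //.
rewrite (bigD1 i) //= eqxx big1 => [|k /negPf ->]; last by rewrite mulr0.
by rewrite addr0 normrM normr_nat mulfK // pnatr_eq0 -lt0n.
Qed.

Lemma form_family2 d Delta : form_family 2 (5 / 9) 1 d Delta.
Proof.
exists {ffun 'I_d -> bool}, (fun (w : {ffun 'I_d -> bool}) k => (-1) ^+ w k).
have T0 : (0 < #|{ffun 'I_d -> bool}|)%N by rewrite card_ffun card_bool expn_gt0.
split=> // a _; set s := index_enum 'I_d.
have us : uniq s by apply: index_enum_uniq.
have SE (w : {ffun 'I_d -> bool}) : \sum_k a k * (-1) ^+ w k = sign_sum s a w.
  by apply: eq_bigr => k _; rewrite mulrC.
rewrite (eq_Ex (fun w => congr1 Num.norm (SE w))).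
set t := \sum_(k <- s) a k ^+ 2.
have t0 : 0 <= t by apply: sumr_ge0 => k _; apply: sqr_ge0.
have -> : lp_norm 2 a = Num.sqrt t.
  rewrite /lp_norm -powR12_sqrt // /t; congr (_ `^ _); apply: eq_bigr => k _.
  by rewrite powR_mulrn // real_normK ?num_real.
rewrite khintchine //= mul1r; set r := Num.sqrt t.
have [tE|tn0] := eqVneq t 0.
  apply: (@le_trans _ _ 0); last exact: sqrtr_ge0.
  apply: Ex_le_const => // w; rewrite normr_le0 -sqrf_eq0.
  rewrite /sign_sum big1 ?expr0n // => k _.
  have := @psumr_eq0P _ _ xpredT (fun k => a k ^+ 2) (fun k _ => sqr_ge0 (a k)) tE k isT.
  by move=> /eqP; rewrite sqrf_eq0 => /eqP ->; rewrite mulr0.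
have r0 : 0 < r by rewrite sqrtr_gt0 lt_neqAle eq_sym tn0.
(* AM-GM with weight [r], for which the second moment [r ^ 2] gives back exactly [r]. *)
have le w : `|sign_sum s a w| <= r / 2 + sign_sum s a w ^+ 2 / (2 * r).
  rewrite -[_ ^+ 2]real_normK ?num_real //; set x := `|_|.
  have -> : r / 2 + x ^+ 2 / (2 * r) = x + (x - r) ^+ 2 / (2 * r).
    by field; rewrite gt_eqF.
  by rewrite lerDl divr_ge0 ?sqr_ge0 //; lra.
apply: le_trans (ler_Ex le) _; rewrite ExD Ex_const // ExZr sign_sum2 // -/t.
have -> : t = r ^+ 2 by rewrite sqr_sqrtr.
have -> : r ^+ 2 / (2 * r) = r / 2 by field; rewrite gt_eqF.
by lra.
Qed.

Section Pareto.
Variables (p : R) (hp1 : 1 < p) (hp2 : p < 2) (d N : nat).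
(** A discretised Pareto variable: it reaches [s >= 1] with probability about [s ^- p]. With a
    random sign it replaces a [p]-stable variable. The exponents [t1] and [t2] below come from
    [2 / p = t1 + 1] and [1 / p = 1 - t2]. *)
Let X (j : 'I_N) : R := (N%:R / j.+1%:R) `^ p^-1.
Let phi (w : {ffun 'I_d -> bool} * {ffun 'I_d -> 'I_N}) (k : 'I_d) : R :=
  (-1) ^+ w.1 k * X (w.2 k).
Let t1 := 2 / p - 1.
Let t2 := 1 - p^-1.

Definition pareto_const : R := 1 / 2 + (2 + t1) / t1 / 2 + 2 / t2.

(** Below: the probabilities of [1 <= |b k * X|] add up to at least [1 / 2], so one of these
    independent events occurs with probability at least [1 - exp (- 1 / 2)], and a single term
    bounds the signed sum from below. Above: [sign_sum_le] leaves a truncated second moment and the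
    first moment of the large values, which are the two Pareto sums. *)
Lemma pareto_forms (b : 'I_d -> R) : (0 < N)%N -> \sum_k `|b k| `^ p = 1 ->
  (forall k, b k = 0 \/ 1 <= `|b k| `^ p * N%:R) ->
  1 / 3 <= Ex (fun w => `|\sum_k b k * phi w k|) <= pareto_const.
Proof.
move=> N0 b1 bN; have [p1 p2] := (hp1, hp2); have p0 : 0 < p by lra.
have N0R : 0 < N%:R :> R by rewrite ltr0n.
have ip0 : 0 < p^-1 by rewrite invr_gt0.
have t10 : 0 < t1 by rewrite /t1 subr_gt0 ltr_pdivlMr //; lra.
have t20 : 0 < t2 by rewrite /t2 subr_gt0 invf_lt1.
have t21 : t2 < 1 by rewrite /t2; lra.
set s := index_enum 'I_d; have us : uniq s by apply: index_enum_uniq.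
pose c (J : {ffun 'I_d -> 'I_N}) k := b k * X (J k).
have -> : Ex (fun w => `|\sum_k b k * phi w k|) =
    Ex (fun J => Ex (fun w : {ffun 'I_d -> bool} => `|sign_sum s (c J) w|)).
  rewrite Ex_exchange -(Ex_pair (fun w J => `|sign_sum s (c J) w|)).
  apply: eq_Ex => -[w J]; congr `|_|; apply: eq_bigr => k _.
  by rewrite /phi /c /= mulrCA.
pose Y k := `|b k| `^ p * N%:R.
have onep : 1 `^ p^-1 = 1 :> R by rewrite powR1.
have bX : forall k (j : 'I_N), `|b k * X j| = (Y k / j.+1%:R) `^ p^-1.
  move=> k j; rewrite normrM (ger0_norm (powR_ge0 _ _)) /Y -mulrA powRM ?powR_ge0 ?divr_ge0 //.
  by rewrite -powRrM mulfV ?gt_eqF // powRr1.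
have bX1 : forall k (j : 'I_N), (`|b k * X j| <= 1) = (Y k <= j.+1%:R).
  move=> k j; rewrite bX.
  have Y0 : 0 <= Y k / j.+1%:R by rewrite divr_ge0 // mulr_ge0 // powR_ge0.
  have -> : (Y k <= j.+1%:R) = (Y k / j.+1%:R <= 1).
    by rewrite ler_pdivrMr ?mul1r ?ltr0n.
  set y := Y k / _ in Y0 *; case: (leP y 1) => y1.
    by rewrite -[X in _ <= X]onep powR_le // ltW.
  apply/negbTE; rewrite -ltNge -[X in X < _]onep.
  by apply: gt0_ltr_powR; rewrite // nnegrE.
have Yb k : b k = 0 \/ 1 <= Y k by apply: bN.
have Y0E k : b k = 0 -> Y k = 0 by move=> bk; rewrite /Y bk normr0 powR0 ?mul0r // gt_eqF.
have sumY : \sum_k Y k = N%:R by rewrite -mulr_suml b1 mul1r.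
have Yge0 k : 0 <= Y k by rewrite mulr_ge0 // powR_ge0.
have J0 : (0 < #|{: {ffun 'I_d -> 'I_N}}|)%N by rewrite card_ffun card_ord expn_gt0 N0.
have I0 : (0 < #|'I_N|)%N by rewrite card_ord.
apply/andP; split.
  have YN k : Y k <= N%:R.
    by rewrite -sumY (bigD1 k) //= lerDl sumr_ge0.
  have P_ge k : Y k / N%:R / 2 <= Pr R (fun j : 'I_N => 1 <= `|b k * X j|).
    have [/Y0E ->|Y1] := Yb k; first by rewrite !mul0r Pr_ge0.
    (* As [Y k >= 1], rounding down loses at most a factor 2. *)
    set m := Num.truncn (Y k).
    have /andP[mY Ym] : m%:R <= Y k < m.+1%:R by apply: truncn_itv.
    have mN : (m <= N)%N by rewrite -(ler_nat R) (le_trans mY).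
    apply: (@le_trans _ _ (m%:R / N%:R)).
      rewrite mulrAC ler_wpM2r ?invr_ge0 //.
      have : 1 <= m%:R :> R by rewrite ler1n truncn_gt0.
      by move: Ym; rewrite -natr1; lra.
    rewrite -{1}(card_ord_lt mN) -[N in _ / N%:R]card_ord -PrE; apply: le_Pr => j /= jm.
    rewrite bX -[X in X <= _]onep powR_le ?(ltW ip0) //.
    rewrite ler_pdivlMr ?ltr0n // mul1r; apply: le_trans mY.
    by rewrite ler_nat.
  apply: (@le_trans _ _ (1 - \prod_k (1 - Pr R (fun j : 'I_N => 1 <= `|b k * X j|)))).
    have prodle : \prod_k (1 - Pr R (fun j : 'I_N => 1 <= `|b k * X j|)) <=
        expR (- (1 / 2)).
      have -> : - (1 / 2) = \sum_k - (Y k / N%:R / 2).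
        by rewrite sumrN -mulr_suml -mulr_suml sumY divff ?gt_eqF.
      rewrite expR_sum; apply: ler_prod => k _; rewrite subr_ge0 Pr_le1 /=.
      by apply: le_trans (expR_ge1Dx _); have := P_ge k; lra.
    have e12 : expR (- (1 / 2)) <= 2 / 3 :> R.
      rewrite expRN -[leRHS]invrK lef_pV2 ?posrE ?expR_gt0 //; try lra.
      by apply: le_trans (expR_ge1Dx _); lra.
    by lra.
  have -> : \prod_k (1 - Pr R (fun j : 'I_N => 1 <= `|b k * X j|)) =
      Ex (fun J : {ffun 'I_d -> 'I_N} => \prod_k (~~ (1 <= `|b k * X (J k)|))%:R).
    rewrite (Ex_ffun_prod (fun k j => (~~ (1 <= `|b k * X j|))%:R)).
    by apply: eq_bigr => k _; rewrite -PrC.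
  rewrite -[X in X - _](Ex_const 1 J0) -ExB.
  apply: ler_Ex => J; case: (boolP [exists k, 1 <= `|b k * X (J k)|]).
    case/existsP => k kJ; apply: (@le_trans _ _ `|c J k|).
      rewrite (bigD1 k) //= kJ mul0r subr0; exact: kJ.
    by apply: sign_sum_ge_term; rewrite // mem_index_enum.
  move=> /existsPn nJ; rewrite big1 => [|k _]; last by rewrite nJ.
  by rewrite subrr; apply: Ex_ge0.
have leJ J := sign_sum_le (c J) us.
apply: le_trans (ler_Ex leJ) _; rewrite ExD Ex_const // Ex_sum.
rewrite /pareto_const -addrA lerD2l.
have term k : Ex (fun J : {ffun 'I_d -> 'I_N} =>
    if `|c J k| <= 1 then c J k ^+ 2 / 2 else `|c J k|) <=
    ((2 + t1) / t1 / 2 + 2 / t2) * (Y k / N%:R).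
  rewrite (Ex_coord k (fun j => if `|b k * X j| <= 1 then (b k * X j) ^+ 2 / 2
    else `|b k * X j|)) //.
  rewrite /Ex card_ord mulrA ler_wpM2r ?invr_ge0 //.
  have [bk0|Y1] := Yb k.
    rewrite Y0E // mulr0 big1 // => j _.
    by rewrite bk0 mul0r normr0 ler01 expr0n /= mul0r.
  have YR : 0 < Y k by lra.
  rewrite (eq_bigr (fun j : 'I_N =>
     (if Y k <= j.+1%:R then (Y k / j.+1%:R) `^ (t1 + 1) else 0) / 2 +
     (if Y k <= j.+1%:R then 0 else (Y k / j.+1%:R) `^ (1 - t2)))); last first.
    move=> j _; rewrite bX1; case: ifP => _; last first.
      by rewrite mul0r add0r bX /t2 subKr.
    rewrite addr0 -real_normK ?num_real // bX /t1 subrK; congr (_ / 2).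
    by rewrite -powR_mulrn ?powR_ge0 // -powRrM [p^-1 * _]mulrC.
  rewrite big_split /= -mulr_suml.
  have := pareto_tail_sum N t10 YR; have := pareto_head_sum N t20 t21 (ltW YR).
  set A := \sum_(j < N) _; set B := \sum_(j < N) _; set C := (2 + t1) / t1.
  by move=> AY BY; rewrite mulrDl; lra.
apply: le_trans (ler_sum _ (fun k _ => term k)) _.
by rewrite -mulr_sumr -mulr_suml sumY divff ?gt_eqF // mulr1.
Qed.

End Pareto.

Lemma form_family_mid p : 1 < p -> p < 2 ->
  exists c2 : R, 0 < c2 /\ forall d Delta, (0 < d)%N -> (0 < Delta)%N ->
    form_family p (1 / 3) c2 d Delta.
Proof.
move=> p1 p2; exists (pareto_const p); have p0 : 0 < p by lra.
have ip0 : 0 < p^-1 by rewrite invr_gt0.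
split.
  have t10 : 0 < 2 / p - 1 by rewrite subr_gt0 ltr_pdivlMr //; lra.
  have t20 : 0 < 1 - p^-1 by rewrite subr_gt0 invf_lt1.
  rewrite /pareto_const !addr_gt0 ?divr_gt0 //; lra.
(* As [p <= 2], this bounds the sum of the [|a k| ^ p]; a nonzero normalised coordinate thus
   satisfies [1 <= |b k| ^ p * N]. *)
move=> d Delta d0 D0; pose N := (d * Delta ^ 2)%N.
have N0 : (0 < N)%N by rewrite muln_gt0 d0 expn_gt0 D0.
exists ({ffun 'I_d -> bool} * {ffun 'I_d -> 'I_N})%type,
  (fun (w : {ffun 'I_d -> bool} * {ffun 'I_d -> 'I_N}) k => (-1) ^+ w.1 k * (N%:R / (w.2 k).+1%:R) `^ p^-1); split.
  by rewrite card_prod !card_ffun card_bool (card_ord N) muln_gt0 !expn_gt0 N0.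
move=> a aD; set r := lp_norm p a.
have r0 : 0 <= r by apply: lp_norm_ge0.
set T := \sum_k `|a k| `^ p; have T0 : 0 <= T by apply: sumr_ge0 => k _; apply: powR_ge0.
have rp : r `^ p = T by rewrite /r /lp_norm -powRrM mulVf ?gt_eqF // powRr1.
have [T00|Tn0] := eqVneq T 0.
  have a0 := sum_powR_eq0 (lt0r_neq0 p0) T00.
  have -> : r = 0 by rewrite /r /lp_norm -/T T00 powR0 // gt_eqF.
  rewrite !mulr0 (@eq_Ex _ _ _ (fun=> 0)) ?Ex0 ?lexx // => w.
  by rewrite big1 ?normr0 // => k _; rewrite a0 mul0r.
have Tp : 0 < T by rewrite lt_neqAle eq_sym Tn0.
have rp0 : 0 < r by apply: powR_gt0.
pose b k := a k / r.
have bE k : `|b k| `^ p = `|a k| `^ p / T.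
  rewrite /b normrM normfV (ger0_norm r0) powRM ?invr_ge0 //; congr (_ * _).
  by rewrite -[r^-1]powR_inv1 // -powRrM mulN1r powRN rp.
have b1 : \sum_k `|b k| `^ p = 1.
  by rewrite (eq_bigr _ (fun k _ => bE k)) -mulr_suml divff.
have bN k : b k = 0 \/ 1 <= `|b k| `^ p * N%:R.
  have [a0|/andP[a1 _]] := aD k; first by left; rewrite /b a0 mul0r.
  right; rewrite bE mulrAC ler_pdivlMr // mul1r.
  apply: (@le_trans _ _ N%:R); last first.
    have onep : 1 `^ p = 1 :> R by rewrite powR1.
    by rewrite ler_peMl // -[X in X <= _]onep powR_le // ltW.
  rewrite /T /N natrM natrX -[X in X%:R * _]card_ord mulr_natl -sumr_const.
  apply: ler_sum => i _; have [->|/andP[a1' aDi]] := aD i.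
    by rewrite normr0 powR0 ?gt_eqF // exprn_ge0.
  apply: (@le_trans _ _ (`|a i| `^ 2)); first by apply: ler_powR => //; exact: ltW.
  by rewrite powR_mulrn // lerXn2r // nnegrE.
have /andP[lo hi] := pareto_forms p1 p2 N0 b1 bN.
have E : Ex (fun w : {ffun 'I_d -> bool} * {ffun 'I_d -> 'I_N} =>
    `|\sum_k a k * ((-1) ^+ w.1 k * (N%:R / (w.2 k).+1%:R) `^ p^-1)|) =
  r * Ex (fun w : {ffun 'I_d -> bool} * {ffun 'I_d -> 'I_N} =>
    `|\sum_k b k * ((-1) ^+ w.1 k * (N%:R / (w.2 k).+1%:R) `^ p^-1)|).
  rewrite -ExZl; apply: eq_Ex => w.
  rewrite -[X in X * `|_|](ger0_norm r0) -normrM mulr_sumr; congr `|_|.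
  by apply: eq_bigr => k _; rewrite [RHS]mulrA /b [r * _]mulrC divfK // gt_eqF.
by rewrite E [1 / 3 * r]mulrC [_ * r]mulrC !ler_wpM2l.
Qed.

End LinearForms.

Definition ham (F V : finType) (cut : F -> V -> bool) (x y : V) : nat :=
  #|[set f | cut f x != cut f y]|.

(** * From linear forms to cuts *)

Section CutEmbedding.
Variable R : realType.

Lemma card_thresholds (T a b : nat) : (a <= T)%N -> (b <= T)%N ->
  #|[pred t : 'I_T | (t < a)%N != (t < b)%N]|%:R = `|a%:R - b%:R| :> R.
Proof.
wlog ab : a b / (a <= b)%N => [wlg aT bT|aT bT].
  case: (leqP a b) => [/wlg|/ltnW/wlg]; first exact.
  move=> /(_ bT aT); rewrite distrC => <-; congr _%:R.
  by apply: eq_card => t; rewrite !inE eq_sym.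
have -> : #|[pred t : 'I_T | (t < a)%N != (t < b)%N]| = (b - a)%N.
  apply: (@addnI a); rewrite subnKC // -{1}(card_ord_lt aT) -[RHS](card_ord_lt bT).
  rewrite -!sum1_card big_mkcond [X in (_ + X)%N]big_mkcond [RHS]big_mkcond.
  rewrite -big_split /=.
  apply: eq_bigr => t _; rewrite !inE; case: (ltnP t a) => ta /=.
    by rewrite (leq_trans ta ab).
  by case: (ltnP t b).
by rewrite natrB // distrC ger0_norm // subr_ge0 ler_nat.
Qed.

Lemma point_dist_ge1 (p : R) d Delta (x y : point d Delta) : 0 < p -> x != y ->
  1 <= point_dist p x y.
Proof.
move=> p0 xy; have [k kxy] : exists k, x k != y k.
  apply/existsP; rewrite -negb_forall; apply: contra xy => /forallP xy.
  by apply/eqP/ffunP => k; apply/eqP.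
have ip0 : 0 < p^-1 by rewrite invr_gt0.
rewrite /point_dist /lp_dist -[X in X <= _](_ : 1 `^ p^-1 = 1); last by rewrite powR1.
apply: powR_le => //; first exact: ltW.
rewrite (bigD1 k) //=; apply: (@le_trans _ _ (1 `^ p)).
  by rewrite powR1.
apply: (@le_trans _ _ (`|coords R x 0 k - coords R y 0 k| `^ p)); last first.
  by rewrite lerDl sumr_ge0 // => i _; apply: powR_ge0.
apply: powR_le => //; first exact: ltW.
rewrite !mxE; case: (ltngtP (x k) (y k)) => [lt|lt|/val_inj eq].
- by rewrite distrC -natrB ?ltnS ?(ltnW lt) // normr_nat ler1n subn_gt0.
- by rewrite -natrB ?ltnS ?(ltnW lt) // normr_nat ler1n subn_gt0.
- by rewrite eq eqxx in kxy.
Qed.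

(** Each form is scaled by [M], rounded down and replaced by its threshold cuts. Rounding costs at
    most 1 per form, [N] in all; as distinct points are at distance at least 1 and [M * c1 >= 2],
    this is at most half of the main term. Hence the scale [N * (M * c1 / 2)] and the constant
    [2 * c2 / c1 + 1]; the term [|A0|] in [M] makes the scale as large as desired. *)
Lemma cuts_of_forms (p c1 c2 : R) d Delta (A0 : R) : 0 < p -> 0 < c1 -> 0 < c2 ->
  form_family p c1 c2 d Delta ->
  exists (F : finType) (cut : F -> point d Delta -> bool) (A : R),
    [/\ 0 < A, A0 <= A & forall x y,
      A * point_dist p x y <= (ham cut x y)%:R <=
        (2 * c2 / c1 + 1) * (A * point_dist p x y)].
Proof.
move=> p0 c10 c20 [Omega [phi [O0 phiP]]].
have [N NE] : exists N : R, N = #|Omega|%:R by exists #|Omega|%:R.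
have N1 : 1 <= N by rewrite NE ler1n.
have [M [M0 Mc1]] : exists M, 0 < M /\ M * c1 = 2 + 2 * `|A0|.
  exists ((2 + 2 * `|A0|) / c1); rewrite divfK ?gt_eqF // divr_gt0 //.
  by have := normr_ge0 A0; lra.
pose L w (x : point d Delta) := \sum_k coords R x 0 k * phi w k.
(* The shift by [B] makes all values nonnegative, so that [truncn] is the integer part. *)
pose B := \sum_w \sum_x `|L w x|.
have LB w x : 0 <= L w x + B.
  have : `|L w x| <= B.
    rewrite /B (bigD1 w) //= (bigD1 x) //= -addrA lerDl addr_ge0 // ?sumr_ge0 //.
    by move=> i _; apply: sumr_ge0.
  by have := ler_norm (- L w x); rewrite normrN; lra.
pose r w x := Num.truncn (M * (L w x + B)).
pose T := (\sum_w \sum_x r w x)%N.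
have rT w x : (r w x <= T)%N.
  by rewrite /T (bigD1 w) //= (bigD1 x) //= -addnA leq_addr.
pose cut (f : Omega * 'I_T) x := (f.2 < r f.1 x)%N.
exists (Omega * 'I_T)%type, cut, (N * (M * c1 / 2)).
have hamE x y : (ham cut x y)%:R = \sum_w `|(r w x)%:R - (r w y)%:R| :> R.
  transitivity (\sum_w #|[pred t : 'I_T | (t < r w x)%N != (t < r w y)%N]|%:R : R).
    rewrite /ham -sum1_card big_mkcond /=.
    pose g w (t : 'I_T) : nat := if (t < r w x)%N != (t < r w y)%N then 1 else 0.
    rewrite (eq_bigr (fun f => g f.1 f.2)) => [|f _]; last by rewrite inE.
    rewrite -(pair_bigA _ g) /= natr_sum; apply: eq_bigr => w _; congr _%:R.
    by rewrite -sum1_card [RHS]big_mkcond /=; apply: eq_bigr => t _; rewrite inE.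
  by apply: eq_bigr => w _; rewrite card_thresholds.
have near_r w x y : `| `|(r w x)%:R - (r w y)%:R| - M * `|L w x - L w y| | <= 1.
  have rP z : (r w z)%:R <= M * (L w z + B) < (r w z).+1%:R.
    by apply: truncn_itv; rewrite mulr_ge0 // ltW.
  have -> : M * `|L w x - L w y| = `|M * (L w x + B) - M * (L w y + B)|.
    by rewrite -mulrBr normrM gtr0_norm //; congr (_ * `|_|); ring.
  apply: le_trans (ler_dist_dist _ _) _; rewrite ler_norml.
  have := rP x; have := rP y; rewrite -!natr1.
  move: (M * (L w x + B)) (M * (L w y + B)) => u v /andP[? ?] /andP[? ?].
  by apply/andP; split; lra.
have A0n := normr_ge0 A0.
split; first by rewrite Mc1 mulr_gt0 ?divr_gt0 //; lra.
  by rewrite Mc1; have := ler_norm A0; nra.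
move=> x y; have [->|xy] := eqVneq x y.
  have d0 : point_dist p y y = 0.
    rewrite /point_dist /lp_dist big1 => [|k _]; first by rewrite powR0 // invr_eq0 gt_eqF.
    by rewrite subrr normr0 powR0 // gt_eqF.
  by rewrite d0 !mulr0 hamE big1 ?lexx // => w _; rewrite subrr normr0.
have D1 := point_dist_ge1 p0 xy; set D := point_dist p x y in D1 *.
pose a k := coords R x 0 k - coords R y 0 k.
have aD k : a k = 0 \/ 1 <= `|a k| <= Delta%:R.
  rewrite /a !mxE; have [->|nk] := eqVneq (x k) (y k); [left|right]; first by rewrite subrr.
  have le1 z : ((z : 'I_Delta) <= Delta)%N by apply: ltnW.
  case: (ltngtP (x k) (y k)) => [lt|lt|/val_inj eq].
  - rewrite distrC -natrB ?ltnS ?(ltnW lt) // normr_nat ler1n subn_gt0 ltnS lt ler_nat subSS.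
    by rewrite (leq_trans (leq_subr _ _)).
  - rewrite -natrB ?ltnS ?(ltnW lt) // normr_nat ler1n subn_gt0 ltnS lt ler_nat subSS.
    by rewrite (leq_trans (leq_subr _ _)).
  - by rewrite eq eqxx in nk.
have LL w : L w x - L w y = \sum_k a k * phi w k.
  by rewrite /L -sumrB; apply: eq_bigr => k _; rewrite /a mulrBl.
have /andP[lo hi] := phiP a aD.
have normE : lp_norm p a = D by [].
rewrite normE in lo hi.
pose E := \sum_w `|L w x - L w y|.
have EE : E = N * Ex (fun w => `|\sum_k a k * phi w k|).
  rewrite /Ex NE mulrC divfK; last by rewrite pnatr_eq0 -lt0n.
  by apply: eq_bigr => w _; rewrite LL.
have hamN : `|(ham cut x y)%:R - M * E| <= N.
  rewrite hamE /E mulr_sumr -sumrB; apply: le_trans (ler_norm_sum _ _ _) _.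
  by rewrite NE -sum1_card natr_sum; apply: ler_sum => w _; apply: near_r.
have loE : N * (c1 * D) <= E by rewrite EE ler_wpM2l //; lra.
have hiE : E <= N * (c2 * D) by rewrite EE ler_wpM2l //; lra.
have MN : M * c1 * D / 2 >= 1.
  by rewrite Mc1; nra.
move: hamN; rewrite ler_norml => /andP[h1 h2].
have ME1 : M * (N * (c1 * D)) <= M * E by rewrite ler_wpM2l // ltW.
have ME2 : M * E <= M * (N * (c2 * D)) by rewrite ler_wpM2l // ltW.
have N0 : 0 <= N by lra.
have NN : N <= N * (M * c1 * D / 2) by rewrite ler_peMr.
apply/andP; split.
  apply: (@le_trans _ _ (M * (N * (c1 * D)) - N * (M * c1 * D / 2))); last by lra.
  by rewrite le_eqVlt; apply/orP; left; apply/eqP; field.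
apply: (@le_trans _ _ (M * (N * (c2 * D)) + N * (M * c1 * D / 2))); first by lra.
by rewrite le_eqVlt; apply/orP; left; apply/eqP; field; rewrite gt_eqF.
Qed.

Lemma lp_cut_embedding (p : R) : 1 <= p <= 2 ->
  exists C : R, 1 <= C /\ forall d Delta (A0 : R), (0 < d)%N -> (0 < Delta)%N ->
  exists (F : finType) (cut : F -> point d Delta -> bool) (A : R),
    [/\ 0 < A, A0 <= A & forall x y,
      A * point_dist p x y <= (ham cut x y)%:R <= C * (A * point_dist p x y)].
Proof.
case/andP => p1 p2; have p0 : 0 < p by lra.
suff [c1 [c2 [c10 c20 fam]]] : exists c1 c2 : R, [/\ 0 < c1, 0 < c2 &
    forall d Delta, (0 < d)%N -> (0 < Delta)%N -> form_family p c1 c2 d Delta].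
  exists (2 * c2 / c1 + 1); split; first by rewrite lerDr !mulr_ge0 ?invr_ge0 // ltW.
  by move=> d Delta A0 d0 D0; apply: cuts_of_forms => //; apply: fam.
move: p1; rewrite le_eqVlt => /orP[/eqP <-|p1].
  by exists 1, 1; split=> // d Delta d0 _; apply: form_family1.
move: p2; rewrite le_eqVlt => /orP[/eqP ->|p2].
  by exists (5 / 9), 1; split=> [||d Delta _ _] //; [lra|apply: form_family2].
have [c2 [c20 fam]] := form_family_mid p1 p2.
by exists (1 / 3), c2; split=> //; lra.
Qed.

End CutEmbedding.

(** * Sampling pairs of sibling clusters *)

Section GeometricSum.
Variable R : realType.

Lemma exprS_sub_ge (r s : R) m : 0 <= s -> s <= r ->
  m.+1%:R * (r - s) * s ^+ m <= r ^+ m.+1 - s ^+ m.+1.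
Proof.
move=> s0 sr; elim: m => [|m IHm]; first by rewrite !expr1 expr0 mul1r mulr1.
have rs : s ^+ m.+1 <= r ^+ m.+1 by rewrite lerXn2r // nnegrE // (le_trans s0).
have -> : r ^+ m.+2 - s ^+ m.+2 = (r - s) * r ^+ m.+1 + s * (r ^+ m.+1 - s ^+ m.+1).
  by rewrite !(exprS _ m.+1); ring.
have -> : m.+2%:R * (r - s) * s ^+ m.+1 =
    (r - s) * s ^+ m.+1 + s * (m.+1%:R * (r - s) * s ^+ m).
  by rewrite -natr1 exprS; ring.
by apply: lerD; rewrite ler_wpM2l // subr_ge0.
Qed.

(** With [x = 2 ^- a], the summand is compared with the increment of [(1 - x) ^ (m + 1)] when [x] is
    halved; these increments add up to at most 1. *)
Lemma sum_isolation n m :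
  \sum_(a < n) (2^-1 : R) ^+ a * (1 - 2^-1 ^+ a) ^+ m <= 2 / m.+1%:R.
Proof.
pose y a : R := (1 - 2^-1 ^+ a) ^+ m.+1.
have x01 a : 0 <= (2^-1 : R) ^+ a <= 1.
  by rewrite exprn_ge0 ?exprn_ile1 ?invr_ge0 // invf_le1 ?ler1n.
have m0 : 0 < m.+1%:R :> R by rewrite ltr0n.
have term (a : nat) : (2^-1 : R) ^+ a * (1 - 2^-1 ^+ a) ^+ m <=
    2 / m.+1%:R * (y a.+1 - y a).
  have sa : 0 <= 1 - (2^-1 : R) ^+ a by rewrite subr_ge0; case/andP: (x01 a).
  have sr : 1 - (2^-1 : R) ^+ a <= 1 - 2^-1 ^+ a.+1.
    by rewrite lerD2l lerN2 exprS ler_piMl; case/andP: (x01 a) => // *; lra.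
  have := exprS_sub_ge m sa sr; rewrite -/(y a.+1) -/(y a) => le.
  rewrite mulrAC ler_pdivlMr //.
  apply: le_trans (ler_wpM2l (ler0n R 2) le); rewrite exprS le_eqVlt.
  by apply/orP; left; apply/eqP; field.
apply: le_trans (ler_sum _ (fun (a : 'I_n) _ => term a)) _; rewrite -mulr_sumr.
rewrite -(big_mkord xpredT (fun a => y a.+1 - y a)) /= (@telescope_sumr _ 0 n y) //.
rewrite ler_piMr ?divr_ge0 // lerBlDr; apply: (@le_trans _ _ 1).
  by rewrite exprn_ile1 // ?subr_ge0 ?lerBlDr ?lerDl; case/andP: (x01 n).
by rewrite lerDl exprn_ge0 // expr0 subrr.
Qed.

End GeometricSum.

Section Isolation.
Variables (R : realType) (V U W : finType) (X : {set V}) (u : V -> U) (pi : U -> W).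
Variable (M : nat).
Local Notation half := (2^-1 : R).
Local Notation C := (labels X u).
Local Notation sib := (siblings X u pi).

Definition keep (e : nat) (v : 'I_(2 ^ M)) : bool := (v < 2 ^ (M - e))%N.

(* The labels of the clusters carry a priority and a colour, those of the
   parents a priority; [a] and [b] are the respective sampling rates. *)
Local Notation HU := {ffun U -> 'I_(2 ^ M) * bool}.
Local Notation HW := {ffun W -> 'I_(2 ^ M)}.

Definition kept (a b : nat) (h : HU * HW) (c : U) : bool :=
  keep a (h.1 c).1 && keep b (h.2 (pi c)).

(** The colours tell the two clusters apart in the counts and fix their order, so that at most one
    ordered pair is isolated. *)
Definition isolated (a b : nat) (h : HU * HW) (c1 c2 : U) : bool :=
  [&& kept a b h c1, kept a b h c2, ~~ (h.1 c1).2, (h.1 c2).2 &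
    [forall c in C, kept a b h c ==> (c == c1) || (c == c2)]].

Let keep_colored a (z : bool) (v : 'I_(2 ^ M) * bool) : R :=
  (keep a v.1 && (v.2 == z))%:R.

Let T0 : (0 < #|{: 'I_(2 ^ M) * bool}|)%N.
Proof. by rewrite card_prod card_ord card_bool muln_gt0 expn_gt0. Qed.

Let M0 : (0 < #|'I_(2 ^ M)|)%N.
Proof. by rewrite card_ord expn_gt0. Qed.

Lemma Ex_keep_colored a z : (a <= M)%N -> Ex (keep_colored a z) = half ^+ a / 2.
Proof.
move=> aM; rewrite /keep_colored.
rewrite (@eq_Ex _ _ _ (fun v : 'I_(2 ^ M) * bool => (keep a v.1)%:R * (v.2 == z)%:R)); last first.
  by move=> v; case: keep; rewrite ?mul1r ?mul0r.
rewrite (Ex_pairM (fun v => (keep a v)%:R) (fun w => (w == z)%:R)).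
rewrite -/(Pr R (keep a)) Pr_lt_exp2 //; congr (_ * _).
by rewrite Ex_bool; case: z; rewrite /= ?addr0 ?add0r mul1r.
Qed.

Lemma Ex_keep a : (a <= M)%N ->
  Ex (fun v : 'I_(2 ^ M) * bool => (keep a v.1)%:R : R) = half ^+ a.
Proof.
move=> aM; rewrite (Ex_fst (fun v => (keep a v)%:R)) ?card_bool //.
by rewrite -/(Pr R (keep a)) Pr_lt_exp2.
Qed.

Lemma Ex_pair_kept a c1 c2 : (a <= M)%N -> c1 != c2 ->
  Ex (fun h : HU => keep_colored a false (h c1) * keep_colored a true (h c2))
    = (half ^+ a / 2) ^+ 2.
Proof.
move=> aM c12.
rewrite (@Ex_indep _ _ _ c1 (keep_colored a false) (fun h => keep_colored a true (h c2))).
  by rewrite Ex_coord // !Ex_keep_colored // -expr2.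
by move=> h t; rewrite ffunE eq_sym (negPf c12).
Qed.

Lemma Ex_triple_kept a c1 c2 c3 : (a <= M)%N -> c1 != c2 -> c3 != c1 -> c3 != c2 ->
  Ex (fun h : HU => (keep a (h c3).1)%:R *
    (keep_colored a false (h c1) * keep_colored a true (h c2)))
    = half ^+ a * (half ^+ a / 2) ^+ 2.
Proof.
move=> aM c12 c31 c32.
rewrite (@Ex_indep _ _ _ c3 (fun v => (keep a v.1)%:R)
  (fun h => keep_colored a false (h c1) * keep_colored a true (h c2))).
  by rewrite Ex_pair_kept // Ex_keep.
by move=> h t; rewrite !ffunE ![_ == c3]eq_sym (negPf c31) (negPf c32).
Qed.

(** Once the common parent is kept, every other sibling has to be dropped, and these draws are
    independent; clusters under other parents are bounded trivially. *)
Lemma isolated_le a b c1 c2 : (a <= M)%N -> (b <= M)%N ->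
  c1 \in C -> c2 \in sib c1 -> c2 != c1 ->
  Pr R (fun h => isolated a b h c1 c2) <=
    half ^+ b * (half ^+ a / 2) ^+ 2 * (1 - half ^+ a) ^+ (#|sib c1| - 2).
Proof.
move=> aM bM c1C c2s c21.
pose g (c : U) (v : 'I_(2 ^ M) * bool) : R :=
  if c == c1 then keep_colored a false v else
  if c == c2 then keep_colored a true v else
  if c \in sib c1 then (~~ keep a v.1)%:R else 1.
have g0 c v : 0 <= g c v by rewrite /g; do 3?case: ifP.
apply: (@le_trans _ _ (Ex (fun h : HU * HW =>
    (\prod_c g c (h.1 c)) * (keep b (h.2 (pi c1)))%:R))).
  apply: ler_Ex => -[hu hw]; rewrite /isolated /kept /=.
  case: (boolP [&& _, _, _, _ & _]) => [|_]; last first.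
    by rewrite mulr_ge0 // prodr_ge0.
  case/and5P => /andP[k1 kw] /andP[k2 _] nz1 z2 /forall_inP others.
  rewrite kw mulr1 big1 // => c _; rewrite /g /keep_colored.
  case: eqP => [->|/eqP nc1]; first by rewrite k1 (negPf nz1).
  case: eqP => [->|/eqP nc2]; first by rewrite k2 z2.
  case: ifP => // cs; move: cs; rewrite inE => /andP[cC /eqP pic].
  have := others c cC; rewrite (negPf nc1) (negPf nc2) implybF pic kw andbT.
  by move=> ->.
rewrite (Ex_pairM (fun hu : HU => \prod_c g c (hu c))
  (fun hw : HW => (keep b (hw (pi c1)))%:R)) Ex_ffun_prod.
rewrite (Ex_coord (pi c1) (fun v => (keep b v)%:R)) // -/(Pr R (keep b)) Pr_lt_exp2 //.
have g1 : Ex (g c1) = half ^+ a / 2.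
  by rewrite -(Ex_keep_colored false aM); apply: eq_Ex => v; rewrite /g eqxx.
have g2 : Ex (g c2) = half ^+ a / 2.
  rewrite -(Ex_keep_colored true aM); apply: eq_Ex => v.
  by rewrite /g (negPf c21) eqxx.
rewrite (bigD1 c1) //= (bigD1 c2) //= g1 g2.
have gE c : c != c1 -> c != c2 ->
    Ex (g c) = if c \in sib c1 then 1 - half ^+ a else 1.
  move=> nc1 nc2; case: ifP => cs.
    rewrite -(Ex_keep aM) -[X in _ = X - _](Ex_const 1 T0) -ExB; apply: eq_Ex => v.
    by rewrite /g (negPf nc1) (negPf nc2) cs; case: keep; rewrite /= ?subrr ?subr0.
  rewrite -[RHS](Ex_const 1 T0).
  by apply: eq_Ex => v; rewrite /g (negPf nc1) (negPf nc2) cs.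
have -> : \prod_(c | (c != c1) && (c != c2)) Ex (g c) = (1 - half ^+ a) ^+ (#|sib c1| - 2).
  rewrite (eq_bigr _ (fun c nc => gE c (andP nc).1 (andP nc).2)) -big_mkcondr /=.
  rewrite prodr_const; congr (_ ^+ _).
  have c1s : c1 \in sib c1 by rewrite inE c1C eqxx.
  have := cardsD1 c1 (sib c1); rewrite c1s => ->.
  have := cardsD1 c2 (sib c1 :\ c1); rewrite in_setD1 c21 c2s => ->.
  rewrite addnA addKn; apply: eq_card => c.
  rewrite !in_setD1 -[LHS]/((c != c1) && (c != c2) && (c \in sib c1)).
  by case: (c != c1); case: (c != c2).
by rewrite le_eqVlt; apply/orP; left; apply/eqP; rewrite expr2; ring.
Qed.

(** Union bound over a third kept cluster: under the same parent, already kept, it survives with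
    probability [2 ^- a], elsewhere with probability [2 ^- a * 2 ^- b]. *)
Lemma isolated_ge a b c1 c2 : (a <= M)%N -> (b <= M)%N ->
  c1 \in C -> c2 \in sib c1 -> c2 != c1 ->
  half ^+ b * (half ^+ a / 2) ^+ 2 *
    (1 - #|sib c1|%:R * half ^+ a - #|C|%:R * (half ^+ a * half ^+ b)) <=
  Pr R (fun h => isolated a b h c1 c2).
Proof.
move=> aM bM c1C c2s c21.
have pi2 : pi c2 = pi c1 by move: c2s; rewrite inE => /andP[_ /eqP].
pose e0 (hu : HU) := keep_colored a false (hu c1) * keep_colored a true (hu c2).
pose f0 (hw : HW) : R := (keep b (hw (pi c1)))%:R.
pose P (c : U) := [&& c \in C, c != c1 & c != c2].
have W0 : (0 < #|{: HW}|)%N by rewrite card_ffun expn_gt0 M0.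
have Ef0 : Ex f0 = half ^+ b.
  by rewrite (Ex_coord (pi c1) (fun v => (keep b v)%:R)) // -/(Pr R (keep b)) Pr_lt_exp2.
apply: (@le_trans _ _ (Ex (fun h : HU * HW => e0 h.1 * f0 h.2) -
    \sum_(c | P c) Ex (fun h : HU * HW =>
      ((keep a (h.1 c).1)%:R * e0 h.1) * (f0 h.2 * (keep b (h.2 (pi c)))%:R)))).
  rewrite (Ex_pairM e0 f0) Ex_pair_kept 1?eq_sym // Ef0.
  set t := (half ^+ a / 2) ^+ 2.
  have le c : P c -> Ex (fun h : HU * HW =>
      ((keep a (h.1 c).1)%:R * e0 h.1) * (f0 h.2 * (keep b (h.2 (pi c)))%:R)) <=
      (if c \in sib c1 then half ^+ b * t * half ^+ a else 0) +
      half ^+ b * t * (half ^+ a * half ^+ b).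
    case/and3P => cC nc1 nc2.
    rewrite (Ex_pairM (fun hu : HU => (keep a (hu c).1)%:R * e0 hu)
      (fun hw : HW => f0 hw * (keep b (hw (pi c)))%:R)).
    rewrite Ex_triple_kept // 1?eq_sym // -/t.
    have t0 : 0 <= t by apply: sqr_ge0.
    have x0 n : 0 <= half ^+ n by rewrite exprn_ge0 ?invr_ge0.
    have [pic|npic] := eqVneq (pi c) (pi c1).
      rewrite inE cC pic eqxx /= (@eq_Ex _ _ _ f0) => [|hw]; last first.
        by rewrite /f0; case: keep; rewrite ?mul1r ?mul0r.
      rewrite Ef0 [leLHS](_ : _ = half ^+ b * t * half ^+ a); last by ring.
      by rewrite lerDl !mulr_ge0 ?x0 ?invr_ge0.
    rewrite inE cC (negPf npic) /= add0r.
    rewrite (@eq_Ex _ _ _ (fun hw : HW => (keep b (hw (pi c)))%:R * f0 hw)) => [|hw]; last first.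
      by rewrite mulrC.
    rewrite (@Ex_indep _ _ _ (pi c) (fun v => (keep b v)%:R) f0).
      rewrite -/(Pr R (keep b)) Pr_lt_exp2 // Ef0 le_eqVlt.
      by apply/orP; left; apply/eqP; ring.
    by move=> hw v; rewrite /f0 ffunE eq_sym (negPf npic).
  have x0 n : 0 <= half ^+ n by rewrite exprn_ge0 ?invr_ge0.
  have t0 : 0 <= t by apply: sqr_ge0.
  have := ler_sum (index_enum U) le; rewrite big_split /= -big_mkcondr /= !sumr_const.
  rewrite -[X in _ <= X + _]mulr_natl -[X in _ <= _ + X]mulr_natl.
  set k' := #|_|; set N' := #|_|; set Q := \sum_(_ | _) _ => leQ.
  have k'k : k'%:R <= #|sib c1|%:R :> R.
    by rewrite ler_nat subset_leq_card //; apply/fintype.subsetP => c /andP[].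
  have N'N : N'%:R <= #|C|%:R :> R.
    by rewrite ler_nat subset_leq_card //; apply/fintype.subsetP => c /and3P[].
  rewrite !mulrBr mulr1 -addrA -opprD lerB //.
    by rewrite mulrC.
  apply: le_trans leQ _; apply: lerD.
    rewrite [leRHS](_ : _ = #|sib c1|%:R * (half ^+ b * t * half ^+ a)); last by ring.
    by rewrite ler_wpM2r ?k'k ?N'N ?mulr_ge0 ?x0 ?invr_ge0.
  rewrite [leRHS](_ : _ = #|C|%:R * (half ^+ b * t * (half ^+ a * half ^+ b))); last by ring.
  by rewrite ler_wpM2r ?k'k ?N'N ?mulr_ge0 ?x0 ?invr_ge0.
rewrite -Ex_sum -ExB; apply: ler_Ex => -[hu hw] /=.
rewrite /e0 /keep_colored /f0 /isolated /kept /=.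
case kw: (keep b (hw (pi c1))); last first.
  apply: (@le_trans _ _ 0) => //; rewrite !(mulr0, mul0r) add0r oppr_le0.
  by apply: sumr_ge0 => c _; rewrite !(mulr0, mul0r).
case k1: (keep a (hu c1).1); last first.
  apply: (@le_trans _ _ 0) => //; rewrite !(mulr0, mul0r) add0r oppr_le0.
  by apply: sumr_ge0 => c _; rewrite !(mulr0, mul0r).
case k2: (keep a (hu c2).1); last first.
  apply: (@le_trans _ _ 0) => //; rewrite !(mulr0, mul0r) add0r oppr_le0.
  by apply: sumr_ge0 => c _; rewrite !(mulr0, mul0r).
case z1: (hu c1).2 => /=.
  apply: (@le_trans _ _ 0) => //; rewrite !(mulr0, mul0r) add0r oppr_le0.
  by apply: sumr_ge0 => c _; rewrite !(mulr0, mul0r).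
case z2: (hu c2).2 => /=; last first.
  apply: (@le_trans _ _ 0) => //; rewrite !(mulr0, mul0r) add0r oppr_le0.
  by apply: sumr_ge0 => c _; rewrite !(mulr0, mul0r).
rewrite pi2 kw /= !mulr1.
case: (boolP [forall _ in _, _]) => [_|]; first by rewrite gerBl sumr_ge0 // => c _; rewrite !mulr_ge0.
rewrite negb_forall => /existsP[c]; rewrite !negb_imply negb_or.
case/and3P => cC /andP[kc kwc] /andP[nc1 nc2].
rewrite (bigD1 c) /=; last by rewrite /P cC nc1.
rewrite kc kwc !mulr1 subr_le0 lerDl sumr_ge0 // => i _.
by rewrite !mulr_ge0.
Qed.

End Isolation.

Section PairRates.
Variables (R : realType) (V U W : finType) (X : {set V}) (u : V -> U) (pi : U -> W).
Variables (M j : nat) (jM : (j <= M)%N).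
Local Notation half := (2^-1 : R).
Local Notation C := (labels X u).
Local Notation sib := (siblings X u pi).
Local Notation rate c1 c2 := (2 ^+ j * \sum_(a < j.+1)
  Pr R (fun h => isolated X u pi (M := M) a (j - a) h c1 c2)).

Lemma siblings_gt1 c1 c2 : c1 \in C -> c2 \in sib c1 -> c2 != c1 -> (1 < #|sib c1|)%N.
Proof.
move=> c1C c2s c21; have c1s : c1 \in sib c1 by rewrite inE c1C eqxx.
by rewrite (cardsD1 c1) c1s (cardsD1 c2) in_setD1 c21 c2s.
Qed.

Let rateE a : (a <= j)%N ->
  2 ^+ j * (half ^+ (j - a) * (half ^+ a / 2) ^+ 2) = half ^+ a / 4.
Proof.
move=> aj; rewrite -[X in 2 ^+ X * _](subnK aj) exprD !exprVn.
by field; rewrite !expf_neq0 ?pnatr_eq0.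
Qed.

(** At rates [a] and [j - a] the pair itself survives with probability [2 ^- j * 2 ^- a / 4], so
    [sum_isolation] gives at most [2 / (4 * (k - 1)) <= 1 / k] for [k] siblings. Up to constants
    this is the weight in [sibling_cost], obtained without knowing [k]. *)
Lemma pair_rate_le c1 c2 : c1 \in C -> c2 \in sib c1 -> c2 != c1 ->
  rate c1 c2 <= #|sib c1|%:R^-1.
Proof.
move=> c1C c2s c21; have k1 := siblings_gt1 c1C c2s c21.
set k := #|sib c1| in k1 *.
have term (a : 'I_j.+1) : 2 ^+ j * Pr R (fun h => isolated X u pi (M := M) a (j - a) h c1 c2)
    <= half ^+ a * (1 - half ^+ a) ^+ (k - 2) / 4.
  have aj : (a <= j)%N by rewrite -ltnS.
  have := isolated_le R (leq_trans aj jM) (leq_trans (leq_subr a j) jM) c1C c2s c21.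
  move=> /(ler_wpM2l (exprn_ge0 j (ler0n R 2))) /le_trans; apply.
  by rewrite mulrA rateE // -/k mulrAC.
rewrite mulr_sumr; apply: le_trans (ler_sum _ (fun a _ => term a)) _.
rewrite -mulr_suml; have := sum_isolation R j.+1 (k - 2).
have -> : (k - 2).+1 = k.-1 by lia.
have k2 : 2 <= k%:R :> R by rewrite ler_nat.
have kE : k.-1%:R = k%:R - 1 :> R by rewrite -subn1 natrB // ltnW.
set t := \sum_(_ < _) _ => tk; apply: (@le_trans _ _ (2 / k.-1%:R / 4)); first lra.
rewrite kE -[leRHS]div1r ler_pdivlMr; last by lra.
have -> : 2 / (k%:R - 1) / 4 * k%:R = k%:R / (2 * (k%:R - 1)) :> R.
  by field; apply/eqP; lra.
by rewrite ler_pdivrMr; lra.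
Qed.

Lemma pair_rate_ge c1 c2 : c1 \in C -> c2 \in sib c1 -> c2 != c1 ->
  (8 * #|C| <= 2 ^ j)%N -> #|sib c1|%:R^-1 / 64 <= rate c1 c2.
Proof.
move=> c1C c2s c21 Cj; have k1 := siblings_gt1 c1C c2s c21.
have kC : (#|sib c1| <= #|C|)%N.
  by apply/subset_leq_card/fintype.subsetP => c; rewrite inE => /andP[].
set k := #|sib c1| in k1 kC *.
(* One rate, with [4 * k < 2 ^ a <= 8 * k], suffices: stray siblings cost at most [1 / 4], stray
   clusters elsewhere at most [1 / 8], and [2 ^- a / 4 >= 1 / (32 * k)]. *)
pose a := (trunc_log 2 (4 * k)).+1.
have [ka ak] : (4 * k < 2 ^ a)%N /\ (2 ^ a <= 8 * k)%N.
  split; first by apply: trunc_log_ltn.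
  have : (2 ^ trunc_log 2 (4 * k) <= 4 * k)%N by apply: trunc_logP => //; lia.
  by rewrite /a expnS; lia.
have aj : (a <= j)%N.
  rewrite -(@leq_exp2l 2) //; apply: leq_trans ak _; apply: leq_trans Cj.
  by rewrite leq_mul2l.
have aj' : (a < j.+1)%N by rewrite ltnS.
have := isolated_ge R (leq_trans aj jM) (leq_trans (leq_subr a j) jM) c1C c2s c21.
rewrite -/k => /(ler_wpM2l (exprn_ge0 j (ler0n R 2))).
rewrite [X in X <= _]mulrA rateE // -exprD subnKC //.
set P := Pr R _ => leP.
apply: (@le_trans _ _ (2 ^+ j * P)); last first.
  rewrite ler_wpM2l ?exprn_ge0 // (bigD1 (Ordinal aj')) //= lerDl sumr_ge0 // => i _.
  exact: Pr_ge0.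
apply: le_trans leP.
have k0 : 0 < k%:R :> R by rewrite ltr0n ltnW.
have x0 : 0 < (2 : R) ^+ a by rewrite exprn_gt0.
have y0 : 0 < (2 : R) ^+ j by rewrite exprn_gt0.
have h1 : 4 * k%:R <= (2 : R) ^+ a by rewrite -natrX -natrM ler_nat ltnW.
have h2 : (2 : R) ^+ a <= 8 * k%:R by rewrite -natrX -natrM ler_nat.
have h3 : 8 * #|C|%:R <= (2 : R) ^+ j by rewrite -natrX -natrM ler_nat.
rewrite !exprVn; set A := (2 : R) ^+ a in x0 h1 h2 *; set J := (2 : R) ^+ j in y0 h3 *.
have kA : k%:R / A <= 1 / 4 by rewrite ler_pdivrMr //; lra.
have CJ : #|C|%:R / J <= 1 / 8 by rewrite ler_pdivrMr //; lra.
have Ak : (8 * k%:R)^-1 <= A^-1 by rewrite lef_pV2 ?posrE // mulr_gt0.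
apply: (@le_trans _ _ ((8 * k%:R)^-1 / 4 * (1 / 2))).
  by rewrite le_eqVlt; apply/orP; left; apply/eqP; field; rewrite gt_eqF.
apply: ler_pM; rewrite ?divr_ge0 ?invr_ge0 ?mulr_ge0 ?(ltW k0) //; lra.
Qed.

End PairRates.

(** * The sampled estimator of the sibling cost *)

Section PairEstimator.
Variables (R : realType) (V U W S : finType) (u : V -> U) (pi : U -> W).
Variables (M Q : nat) (rho : S -> V -> V -> R) (B : R).
Hypotheses (B0 : 0 <= B) (rho0 : forall s x y, 0 <= rho s x y).
Hypotheses (rhoB : forall s x y, rho s x y <= B).

Local Notation HU := {ffun U -> 'I_(2 ^ M) * bool}.
Local Notation HW := {ffun W -> 'I_(2 ^ M)}.
Local Notation LL := ({ffun U -> 'I_Q.+1} * {ffun W -> 'I_Q.+1})%type.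

Definition sample (a b : nat) (h : HU * HW) (z : bool) (X : {set V}) : {set V} :=
  [set x in X | kept pi a b h (u x) && ((h.1 (u x)).2 == z)].

(* The fingerprints [l] test that each colour holds a single cluster, and that
   the two clusters have the same parent. *)
Definition passes (a b : nat) (h : HU * HW) (l : LL) (X : {set V}) : bool :=
  [&& sample a b h false X != finset.set0, sample a b h true X != finset.set0,
    [forall z, forall x in sample a b h z X, forall y in sample a b h z X,
       l.1 (u x) == l.1 (u y)] &
    [forall x in sample a b h false X, forall y in sample a b h true X,
       l.2 (pi (u x)) == l.2 (pi (u y))]].

Definition pair_value (a b : nat) (h : HU * HW) (l : LL) (s : S) (X : {set V}) : R :=
  (passes a b h l X)%:R * mean (rho s) (sample a b h true X) (sample a b h false X).

(** Every split of the overall rate [2 ^- j] between children and parents is tried, since the right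
    one depends on the number of siblings; the factor [2 ^ j] undoes the sampling. *)
Definition estimate (j : nat) (X : {set V}) (w : (HU * HW) * (LL * S)) : R :=
  2 ^+ j * \sum_(a < j.+1) pair_value a (j - a) w.1 w.2.1 w.2.2 X.

Lemma mean_rho s A A' : 0 <= mean (rho s) A A' <= B.
Proof.
rewrite mean_ge0 //= meanE; apply: mean_le_const => // y _.
exact: mean_le_const.
Qed.

Lemma pair_value_bounds a b h l s X : 0 <= pair_value a b h l s X <= B.
Proof.
rewrite /pair_value; case: passes; rewrite ?mul1r ?mul0r ?lexx //=.
exact: mean_rho.
Qed.

Lemma estimate_bounds j X w : 0 <= estimate j X w <= 2 ^+ j * (j.+1%:R * B).
Proof.
rewrite /estimate mulr_ge0 ?exprn_ge0 ?sumr_ge0 //= => [|a _]; last first.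
  by case/andP: (pair_value_bounds a (j - a) w.1 w.2.1 w.2.2 X).
rewrite ler_wpM2l ?exprn_ge0 // mulr_natl -[X in _ *+ X]card_ord -sumr_const.
by apply: ler_sum => a _; case/andP: (pair_value_bounds a (j - a) w.1 w.2.1 w.2.2 X).
Qed.

Section Moments.
Variable X : {set V}.
Local Notation C := (labels X u).
Local Notation sib := (siblings X u pi).
Local Notation iso := (isolated X u pi (M := M)).

Lemma sample_isolated a b h c1 c2 : c1 \in C -> c2 \in sib c1 -> c2 != c1 ->
  iso a b h c1 c2 ->
  sample a b h false X = fiber X u c1 /\ sample a b h true X = fiber X u c2.
Proof.
move=> c1C c2s c21 /and5P[k1 k2 z1 z2 /forall_inP others].
have cases x : x \in X -> kept pi a b h (u x) -> u x = c1 \/ u x = c2.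
  move=> xX kx; have := others (u x) (imset_f u xX).
  by rewrite kx => /orP[] /eqP ->; [left|right].
split; apply/setP => x; rewrite !inE; case xX: (x \in X) => //=.
  apply/andP/eqP => [[kx zx]|->]; last by rewrite k1 (negPf z1).
  by have [//|e] := cases x xX kx; move: zx; rewrite e z2.
apply/andP/eqP => [[kx zx]|->]; last by rewrite k2 z2.
by have [e|//] := cases x xX kx; move: zx; rewrite e (negPf z1).
Qed.

Lemma passes_isolated a b h l c1 c2 : c1 \in C -> c2 \in sib c1 -> c2 != c1 ->
  iso a b h c1 c2 -> passes a b h l X.
Proof.
move=> c1C c2s c21 iso12; have [E1 E2] := sample_isolated c1C c2s c21 iso12.
have c2C : c2 \in C by move: c2s; rewrite inE => /andP[].
have pi2 : pi c2 = pi c1 by move: c2s; rewrite inE => /andP[_ /eqP].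
rewrite /passes E1 E2 !fiber_neq0 //=; apply/andP; split.
  apply/forallP => z; have -> : sample a b h z X = fiber X u (if z then c2 else c1).
    by case: z.
  apply/forall_inP => x; rewrite inE => /andP[_ /eqP ->].
  by apply/forall_inP => y; rewrite inE => /andP[_ /eqP ->].
apply/forall_inP => x; rewrite inE => /andP[_ /eqP ->].
by apply/forall_inP => y; rewrite inE => /andP[_ /eqP ->]; rewrite pi2.
Qed.

Lemma isolated_uniq a b h c1 c2 c1' c2' :
  c1 \in C -> c2 \in sib c1 -> c2 != c1 -> iso a b h c1 c2 ->
  c1' \in C -> c2' \in sib c1' -> c2' != c1' -> iso a b h c1' c2' ->
  c1 = c1' /\ c2 = c2'.
Proof.
move=> c1C c2s c21 /and5P[k1 k2 z1 z2 /forall_inP others] c1C' c2s' c21'.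
have c2C' : c2' \in C by move: c2s'; rewrite inE => /andP[].
case/and5P => k1' k2' z1' z2' _; split.
  have := others c1' c1C'; rewrite k1' => /orP[/eqP//|/eqP e].
  by move: z1'; rewrite e z2.
have := others c2' c2C'; rewrite k2' => /orP[/eqP e|/eqP//].
by move: z2'; rewrite e (negPf z1).
Qed.

Let isolated_sum a b h s : R :=
  \sum_(c1 in C) \sum_(c2 in sib c1 | c2 != c1)
    (iso a b h c1 c2)%:R * mean (rho s) (fiber X u c2) (fiber X u c1).

Let no_pair a b h : bool :=
  ~~ [exists c1 in C, exists c2 in sib c1, (c2 != c1) && iso a b h c1 c2].

(** Either exactly one ordered pair of siblings is isolated and the samples are its two clusters, or
    there is none and the value is a false positive. *)
Lemma pair_valueE a b h l s : pair_value a b h l s X =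
  isolated_sum a b h s +
  (no_pair a b h && passes a b h l X)%:R *
     mean (rho s) (sample a b h true X) (sample a b h false X).
Proof.
rewrite /no_pair; case: (boolP [exists _ in _, _]) => [/exists_inP[c1 c1C]|nex] /=.
  case/exists_inP => c2 c2s /andP[c21 iso12].
  have [E1 E2] := sample_isolated c1C c2s c21 iso12.
  rewrite mul0r addr0 /pair_value (passes_isolated _ c1C c2s c21 iso12) mul1r E1 E2.
  rewrite /isolated_sum (bigD1 c1) //= [X in _ = _ + X]big1 ?addr0.
    rewrite (bigD1 c2) ?c2s //= iso12 mul1r [X in _ = _ + X]big1 ?addr0 //.
    move=> c2' /andP[/andP[c2s' c21'] nc2]; case iso': (iso a b h c1 c2'); last by rewrite mul0r.
    have [_ e] := isolated_uniq c1C c2s c21 iso12 c1C c2s' c21' iso'.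
    by rewrite e eqxx in nc2.
  move=> c1' /andP[c1C' nc1]; apply: big1 => c2' /andP[c2s' c21'].
  case iso': (iso a b h c1' c2'); last by rewrite mul0r.
  have [e _] := isolated_uniq c1C c2s c21 iso12 c1C' c2s' c21' iso'.
  by rewrite e eqxx in nc1.
rewrite /isolated_sum [X in _ = X + _]big1 ?add0r // => c1 c1C.
apply: big1 => c2 /andP[c2s c21]; case iso12: (iso a b h c1 c2); last by rewrite mul0r.
case/negP: nex; apply/exists_inP; exists c1 => //; apply/exists_inP; exists c2 => //.
by rewrite c21.
Qed.

Lemma Pr_collision (I : finType) (i k : I) : i != k ->
  Pr R (fun l : {ffun I -> 'I_Q.+1} => l i == l k) = Q.+1%:R^-1.
Proof.
move=> ik; rewrite /Pr -(Ex_upd i).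
rewrite (@eq_Ex _ _ _ (fun=> Q.+1%:R^-1)) ?Ex_const ?card_ffun ?card_ord ?expn_gt0 // => l.
rewrite (@eq_Ex _ _ _ (fun t => (t == l k)%:R)) => [|t]; last first.
  by rewrite !ffunE eqxx eq_sym [k == i]eq_sym (negPf ik) eq_sym.
by rewrite -/(Pr R (fun t => t == l k)) PrE card1 card_ord div1r.
Qed.

(** Without an isolated pair, two nonempty samples contain two labels of one colour or two labels
    with distinct parents. These are determined by the sampling hash [h] alone, so independent
    fingerprints identify them with probability [1 / (Q + 1)]. *)
Lemma Pr_false_positive a b h :
  Pr R (fun l => no_pair a b h && passes a b h l X) <= Q.+1%:R^-1.
Proof.
have Q0 : 0 <= Q.+1%:R^-1 :> R by rewrite invr_ge0.
have LU0 : (0 < #|{: {ffun U -> 'I_Q.+1}}|)%N by rewrite card_ffun card_ord expn_gt0.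
have LW0 : (0 < #|{: {ffun W -> 'I_Q.+1}}|)%N by rewrite card_ffun card_ord expn_gt0.
have viaU c c' : c != c' -> (forall l, no_pair a b h && passes a b h l X -> l.1 c == l.1 c') ->
    Pr R (fun l => no_pair a b h && passes a b h l X) <= Q.+1%:R^-1.
  move=> cc' le; apply: le_trans (le_Pr _ le) _.
  rewrite /Pr (Ex_fst (fun l : {ffun U -> 'I_Q.+1} => (l c == l c')%:R)) //.
  by rewrite -/(Pr R (fun l : {ffun U -> 'I_Q.+1} => l c == l c')) Pr_collision.
have viaW c c' : c != c' -> (forall l, no_pair a b h && passes a b h l X -> l.2 c == l.2 c') ->
    Pr R (fun l => no_pair a b h && passes a b h l X) <= Q.+1%:R^-1.
  move=> cc' le; apply: le_trans (le_Pr _ le) _.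
  rewrite /Pr (Ex_snd (fun l : {ffun W -> 'I_Q.+1} => (l c == l c')%:R)) //.
  by rewrite -/(Pr R (fun l : {ffun W -> 'I_Q.+1} => l c == l c')) Pr_collision.
have trivial : (forall l, ~~ (no_pair a b h && passes a b h l X)) ->
    Pr R (fun l => no_pair a b h && passes a b h l X) <= Q.+1%:R^-1.
  move=> nl; rewrite /Pr (@eq_Ex _ _ _ (fun=> 0)) ?Ex0 // => l.
  by rewrite (negPf (nl l)).
have [E1|/set0Pn[x xS]] := eqVneq (sample a b h false X) finset.set0.
  by apply: trivial => l; rewrite /passes E1 eqxx andbF.
have [E2|/set0Pn[y yS]] := eqVneq (sample a b h true X) finset.set0.
  by apply: trivial => l; rewrite /passes E2 eqxx andbF andbF.
have [xX kx zx] : [/\ x \in X, kept pi a b h (u x) & ~~ (h.1 (u x)).2].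
  by move: xS; rewrite inE => /and3P[-> -> /eqP ->].
have [yX ky zy] : [/\ y \in X, kept pi a b h (u y) & (h.1 (u y)).2].
  by move: yS; rewrite inE => /and3P[-> -> /eqP ->].
have [pixy|npi] := eqVneq (pi (u x)) (pi (u y)); last first.
  apply: viaW npi _ => l /andP[_ /and4P[_ _ _ /forall_inP/(_ x xS)/forall_inP]].
  exact.
have /orP[np|nnp] := orbN (no_pair a b h); last by apply: trivial => l; rewrite (negPf nnp).
have uxy : u y != u x by apply: contraNneq zx => <-.
have uxC : u x \in C by apply: imset_f.
have uyC : u y \in sib (u x) by rewrite inE imset_f //= pixy.
have : ~~ iso a b h (u x) (u y).
  apply: contra np => iso12; apply/exists_inP; exists (u x) => //.
  by apply/exists_inP; exists (u y) => //; rewrite uxy.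
rewrite /isolated kx ky zx zy /= => /forall_inPn[c /imsetP[v vX ->]].
rewrite negb_imply negb_or => /andP[kv /andP[vx vy]].
have vS : v \in sample a b h (h.1 (u v)).2 X by rewrite inE vX kv eqxx.
case: (boolP (h.1 (u v)).2) => zv; rewrite ?zv ?(negPf zv) in vS.
  apply: viaU vy _ => l /andP[_ /and4P[_ _ /forallP/(_ true) + _]].
  by move=> /forall_inP/(_ v vS)/forall_inP/(_ y yS).
apply: viaU vx _ => l /andP[_ /and4P[_ _ /forallP/(_ false) + _]].
by move=> /forall_inP/(_ v vS)/forall_inP/(_ x xS).
Qed.

Let rhobar x y : R := Ex (fun s => rho s x y).

Lemma Ex_mean A A' : Ex (fun s => mean (rho s) A A') = mean rhobar A A'.
Proof.
rewrite /mean ExZr Ex_sum; congr (_ / _); apply: eq_bigr => x _.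
by rewrite Ex_sum.
Qed.

Variable j : nat.
Hypothesis jM : (j <= M)%N.

Let LL0 : (0 < #|{: LL}|)%N.
Proof. by rewrite card_prod !card_ffun card_ord muln_gt0 !expn_gt0. Qed.

Let pairs : R := 2 ^+ j * \sum_(a < j.+1)
  \sum_(c1 in C) \sum_(c2 in sib c1 | c2 != c1)
    Pr R (fun h => iso a (j - a) h c1 c2) * mean rhobar (fiber X u c2) (fiber X u c1).

Let Ex_isolated_sum a b :
  Ex (fun w : (HU * HW) * (LL * S) => isolated_sum a b w.1 w.2.2) =
  \sum_(c1 in C) \sum_(c2 in sib c1 | c2 != c1)
    Pr R (fun h => iso a b h c1 c2) * mean rhobar (fiber X u c2) (fiber X u c1).
Proof.
rewrite Ex_sum; apply: eq_bigr => c1 _; rewrite Ex_sum; apply: eq_bigr => c2 _.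
rewrite (Ex_pairM (fun h => (iso a b h c1 c2)%:R)
  (fun ls : LL * S => mean (rho ls.2) (fiber X u c2) (fiber X u c1))).
by rewrite (Ex_snd (fun s => mean (rho s) _ _)) // Ex_mean.
Qed.

Let Ex_estimate_ge : pairs <= Ex (estimate j X).
Proof.
rewrite /estimate ExZl Ex_sum ler_wpM2l ?exprn_ge0 //; apply: ler_sum => a _.
rewrite -Ex_isolated_sum; apply: ler_Ex => -[h [l s]] /=.
rewrite pair_valueE lerDl mulr_ge0 //.
by case/andP: (mean_rho s (sample a (j - a) h true X) (sample a (j - a) h false X)).
Qed.

Let Ex_estimate_le : Ex (estimate j X) <= pairs + 2 ^+ j * (j.+1%:R * (B / Q.+1%:R)).
Proof.
rewrite /estimate ExZl Ex_sum -mulrDr ler_wpM2l ?exprn_ge0 //.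
rewrite mulr_natl -[X in _ *+ X]card_ord -sumr_const -big_split /=.
apply: ler_sum => a _; rewrite -Ex_isolated_sum.
apply: (@le_trans _ _ (Ex (fun w : (HU * HW) * (LL * S) =>
    isolated_sum a (j - a) w.1 w.2.2 +
    (no_pair a (j - a) w.1 && passes a (j - a) w.1 w.2.1 X)%:R * B))).
  apply: ler_Ex => -[h [l s]] /=; rewrite pair_valueE lerD2l ler_wpM2l //.
  by case/andP: (mean_rho s (sample a (j - a) h true X) (sample a (j - a) h false X)).
rewrite ExD lerD2l ExZr mulrC ler_wpM2l //.
rewrite (Ex_pair (fun h (ls : LL * S) => (no_pair a (j - a) h && passes a (j - a) h ls.1 X)%:R)).
apply: Ex_le_const => [|h]; first by rewrite invr_ge0.
have [S0|S0] := posnP #|S|.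
  by rewrite /Ex card_prod S0 muln0 invr0 mulr0 invr_ge0.
rewrite (Ex_fst (fun l => (no_pair a (j - a) h && passes a (j - a) h l X)%:R)) //.
exact: Pr_false_positive.
Qed.

Let rhobar0 x y : 0 <= rhobar x y.
Proof. exact: Ex_ge0. Qed.

Let pairsE : pairs = \sum_(c1 in C) \sum_(c2 in sib c1 | c2 != c1)
    (2 ^+ j * \sum_(a < j.+1) Pr R (fun h => iso a (j - a) h c1 c2)) *
    mean rhobar (fiber X u c2) (fiber X u c1).
Proof.
rewrite /pairs exchange_big /= mulr_sumr; apply: eq_bigr => c1 _.
rewrite exchange_big /= mulr_sumr; apply: eq_bigr => c2 _.
by rewrite -mulr_suml mulrA.
Qed.

Lemma estimate_upper : Ex (estimate j X) <=
  sibling_cost X u pi rhobar + 2 ^+ j * (j.+1%:R * (B / Q.+1%:R)).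
Proof.
apply: le_trans Ex_estimate_le _; rewrite lerD2r pairsE /sibling_cost.
apply: ler_sum => c1 c1C; rewrite mulr_suml; apply: ler_sum => c2 /andP[c2s c21].
by rewrite mulrC ler_wpM2l ?mean_ge0 // pair_rate_le.
Qed.

Lemma estimate_lower : (8 * #|C| <= 2 ^ j)%N ->
  sibling_cost X u pi rhobar / 64 <= Ex (estimate j X).
Proof.
move=> Cj; apply: le_trans Ex_estimate_ge; rewrite pairsE /sibling_cost mulr_suml.
apply: ler_sum => c1 c1C; rewrite -mulrA mulr_suml.
apply: ler_sum => c2 /andP[c2s c21].
by rewrite mulrC ler_wpM2r ?mean_ge0 // pair_rate_ge.
Qed.

End Moments.
End PairEstimator.

(** * Random hierarchical partitions *)

Section Cells.
Variables (R : realType) (V F : finType) (cut : F -> V -> bool) (M : nat).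
Local Notation half := (2^-1 : R).
Local Notation Omega := {ffun F -> 'I_(2 ^ M)}.
Implicit Types (A : {set F}) (w : Omega) (x y z : V) (e : nat) (S : {set V}).

(* Restricting the cuts to [A] serves to condition on the level of one cut. *)
Definition same A e w x y : bool :=
  [forall f in A, keep e (w f) ==> (cut f x == cut f y)].

Definition hamA A x y : nat := #|[set f in A | cut f x != cut f y]|.

Definition cell e w x : {set V} := [set y | same [set: F] e w x y].

Lemma hamAT x y : hamA [set: F] x y = ham cut x y.
Proof. by apply: eq_card => f; rewrite !inE. Qed.

Lemma same_refl A e w x : same A e w x x.
Proof. by apply/forall_inP => f _; rewrite eqxx implybT. Qed.

Lemma same_sym A e w x y : same A e w x y = same A e w y x.
Proof. by apply: eq_forallb => f; rewrite eq_sym. Qed.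

Lemma same_trans A e w x y z : same A e w x y -> same A e w y z -> same A e w x z.
Proof.
move=> /forall_inP xy /forall_inP yz; apply/forall_inP => f fA; apply/implyP => k.
by have := xy f fA; have := yz f fA; rewrite k => /eqP <- /eqP ->.
Qed.

Lemma keep_mono e e' (v : 'I_(2 ^ M)) : (e <= e')%N -> keep e' v -> keep e v.
Proof.
by move=> ee /leq_trans; apply; rewrite leq_exp2l // leq_sub2l.
Qed.

Lemma same_mono A e e' w x y : (e <= e')%N -> same A e w x y -> same A e' w x y.
Proof.
move=> ee /forall_inP xy; apply/forall_inP => f fA; apply/implyP => k.
by have := xy f fA; rewrite (keep_mono ee k).
Qed.

Lemma cell_eq e w x y : (cell e w x == cell e w y) = same [set: F] e w x y.
Proof.
apply/eqP/idP => [E|xy].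
  have : y \in cell e w y by rewrite inE same_refl.
  by rewrite -E inE.
apply/setP => z; rewrite !inE; apply/idP/idP; last exact: same_trans.
by apply: same_trans; rewrite same_sym.
Qed.

(** A map on labels, as siblings require; on an actual cell the union is a single coarser cell
    because the partitions are nested. *)
Definition parent e w (c : {set V}) : {set V} := \bigcup_(x in c) cell e w x.

Lemma parent_cell e w x : parent e.+1 w (cell e w x) = cell e.+1 w x.
Proof.
apply/setP => y; apply/bigcupP/idP => [[z]|yx]; last by exists x => //; rewrite inE same_refl.
by rewrite !inE => /(same_mono (leqnSn e)); exact: same_trans.
Qed.

Lemma hamAC A x y : hamA A x y = hamA A y x.
Proof. by apply: eq_card => f; rewrite !inE eq_sym. Qed.

Lemma hamA_triangle A x y z : (hamA A x z <= hamA A x y + hamA A y z)%N.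
Proof.
apply: leq_trans (leq_card_setU _ _); apply/subset_leq_card/fintype.subsetP => f.
by rewrite !inE; case: (f \in A) => //=; do 3!case: (cut f _).
Qed.

Let half01 e : 0 <= half ^+ e <= 1.
Proof. by rewrite exprn_ge0 ?exprn_ile1 ?invr_ge0 // invf_le1 ?ler1n. Qed.

Let M0 : (0 < #|'I_(2 ^ M)|)%N.
Proof. by rewrite card_ord expn_gt0. Qed.

Let Omega0 : (0 < #|{: Omega}|)%N.
Proof. by rewrite card_ffun card_ord !expn_gt0. Qed.

Lemma Pr_same A e x y : (e <= M)%N ->
  Pr R (fun w => same A e w x y) = (1 - half ^+ e) ^+ hamA A x y.
Proof.
move=> eM.
pose g f (v : 'I_(2 ^ M)) : R :=
  if f \in [set f in A | cut f x != cut f y] then (~~ keep e v)%:R else 1.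
rewrite /Pr (@eq_Ex _ _ _ (fun w : Omega => \prod_f g f (w f))) => [|w].
  rewrite Ex_ffun_prod (eq_bigr (fun f => if f \in [set f in A | cut f x != cut f y]
      then 1 - half ^+ e else 1)) => [|f _].
    by rewrite -big_mkcond /= prodr_const.
  rewrite /g; case: ifP => _; last by rewrite Ex_const.
  by rewrite -/(Pr R (fun v => ~~ keep e v)) PrC // Pr_lt_exp2.
case: (boolP (same A e w x y)) => [/forall_inP s|].
  rewrite big1 // => f _; rewrite /g inE; case: (boolP (f \in A)) => //= fA.
  by have := s f fA; case: (cut f x == cut f y); rewrite ?implybT ?implybF => // ->.
move=> /forall_inPn[f fA]; rewrite negb_imply => /andP[k n].
by rewrite (bigD1 f) //= /g inE fA n k mul0r.
Qed.

Lemma Pr_same_le A e x y : (e <= M)%N ->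
  Pr R (fun w => same A e w x y) <= expR (- ((hamA A x y)%:R / 2 ^+ e)).
Proof.
move=> eM; rewrite Pr_same // -mulrN expRM_natl.
have /andP[h0 h1] := half01 e; rewrite lerXn2r ?nnegrE ?expR_ge0 ?subr_ge0 //.
by apply: le_trans (expR_ge1Dx _); rewrite exprVn.
Qed.

Lemma Pr_not_same_le A e x y : (e <= M)%N ->
  Pr R (fun w => ~~ same A e w x y) <= (hamA A x y)%:R / 2 ^+ e.
Proof.
move=> eM; rewrite PrC // Pr_same //.
have /andP[h0 h1] := half01 e.
have bern n : 1 - n%:R * half ^+ e <= (1 - half ^+ e) ^+ n.
  elim: n => [|n IHn]; first by rewrite mul0r subr0 expr0.
  rewrite exprS; have : 0 <= 1 - half ^+ e by rewrite subr_ge0.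
  move=> /ler_wpM2l/(_ _ _ IHn); apply: le_trans; rewrite -natr1.
  have : 0 <= n%:R :> R by []. 
  by nra.
by have := bern (hamA A x y); rewrite exprVn; lra.
Qed.

Definition near A e w S z : {set V} := [set y in S | same A e w z y].

Definition mean_dist A e w S z : R :=
  (\sum_(y in near A e w S z) (hamA A z y)%:R) / #|near A e w S z|%:R.

Lemma near_gt0 A e w S z : z \in S -> (0 < #|near A e w S z|)%N.
Proof. by move=> zS; apply/card_gt0P; exists z; rewrite inE zS same_refl. Qed.

Lemma mean_dist_ge0 A e w S z : 0 <= mean_dist A e w S z.
Proof. by rewrite /mean_dist divr_ge0 // sumr_ge0. Qed.

Definition ball A S z (i : nat) : nat := #|[set y in S | (hamA A z y <= 2 ^ i)%N]|.

Lemma ball_gt0 A S z i : z \in S -> (0 < ball A S z i)%N.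
Proof.
move=> zS; apply/card_gt0P; exists z; rewrite inE zS /hamA.
by rewrite (_ : [set f in A | _] = finset.set0) ?cards0 //; apply/setP => f; rewrite !inE eqxx andbF.
Qed.

Lemma ball_mono A S z i i' : (i <= i')%N -> (ball A S z i <= ball A S z i')%N.
Proof.
move=> ii; apply/subset_leq_card/fintype.subsetP => y; rewrite !inE => /andP[-> /=].
by move=> /leq_trans; apply; rewrite leq_exp2l.
Qed.

Definition log_ball A S z i : R := ln (ball A S z i)%:R.

(** * Mean distance inside a random cell, in terms of the growth of balls *)

Section Growth.
Variables (A : {set F}) (S : {set V}) (z : V) (e J : nat).
Hypotheses (zS : z \in S) (eM : (e <= M)%N) (Je : (J <= e)%N).
Hypothesis smallS : #|S|%:R * expR (- (2 ^+ J / 2)) <= 1 :> R.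
Local Notation t := (2 ^+ e : R).
Local Notation K := (2 ^+ J : R).
Local Notation m := (ball A S z (e - J)).

Let shell j y : bool := (2 ^ (e + j) < hamA A z y)%N && (hamA A z y <= 2 ^ (e + j.+1))%N.

Let frac j w : R := #|[set y in near A e w S z | shell j y]|%:R / #|near A e w S z|%:R.

Let close w : nat := #|[set y in near A e w S z | (hamA A z y <= 2 ^ (e - J))%N]|.

Let close_le w : (close w <= m)%N.
Proof.
apply/subset_leq_card/fintype.subsetP => y; rewrite !inE => /andP[/andP[-> _] ->] //.
Qed.

Let m0 : 0 < m%:R :> R.
Proof. by rewrite ltr0n ball_gt0. Qed.

Let t0 : 0 < t. Proof. by rewrite exprn_gt0. Qed.

Let frac_le1 j w : frac j w <= 1.
Proof.
rewrite ler_pdivrMr ?ltr0n ?near_gt0 // mul1r ler_nat; apply: subset_leq_card.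
by apply/fintype.subsetP => y; rewrite inE => /andP[].
Qed.

(* Unless half of the ball of radius [t / K] has been separated from [z], the
   cell of [z] contains at least [m / 2] points. *)
Let frac_le j w : frac j w <=
  2 * (m%:R - (close w)%:R) / m%:R +
  2 * #|[set y in near A e w S z | shell j y]|%:R / m%:R.
Proof.
set far := #|[set y in near A e w S z | shell j y]|.
have cm : (close w)%:R <= m%:R :> R by rewrite ler_nat.
have far0 : 0 <= far%:R :> R by [].
case: (leP m%:R (2 * (close w)%:R : R)) => half_close.
  apply: (@le_trans _ _ (2 * far%:R / m%:R)); last first.
    by rewrite lerDr divr_ge0 ?(ltW m0) //; lra.
  have cn : (close w)%:R <= #|near A e w S z|%:R :> R.
    by rewrite ler_nat subset_leq_card //; apply/fintype.subsetP => y; rewrite inE => /andP[].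
  have n0 : 0 < #|near A e w S z|%:R :> R by rewrite ltr0n near_gt0.
  rewrite /frac -/far ler_pdivrMr // mulrAC ler_pdivlMr //.
  have : m%:R <= 2 * #|near A e w S z|%:R :> R by lra.
  by nra.
apply: le_trans (frac_le1 j w) _; rewrite -mulrDl ler_pdivlMr // mul1r.
by lra.
Qed.

Let Ex_close : Ex (fun w => (m%:R - (close w)%:R : R)) <= m%:R / K.
Proof.
pose B := [set y in S | (hamA A z y <= 2 ^ (e - J))%N].
have E w : m%:R - (close w)%:R = \sum_(y in B) (~~ same A e w z y)%:R :> R.
  rewrite -natrB ?close_le // -natr_sum; congr _%:R.
  have -> : m = #|B| by [].
  have -> : close w = #|[set y in B | same A e w z y]|.
    by apply: eq_card => y; rewrite !inE; case: (y \in S); rewrite //= andbC.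
  have := cardsID [set y | same A e w z y] B.
  have -> : B :&: [set y | same A e w z y] = [set y in B | same A e w z y].
    by apply/setP => y; rewrite !inE.
  move=> <-; rewrite addKn -sum1_card big_mkcond [RHS]big_mkcond /=.
  by apply: eq_bigr => y _; rewrite !inE; case: same; rewrite /= ?andbF //; case: (_ && _).
rewrite (eq_Ex E) Ex_sum; apply: (@le_trans _ _ (\sum_(y in B) K^-1)).
  apply: ler_sum => y; rewrite inE => /andP[_ hy].
  apply: le_trans (Pr_not_same_le A z y eM) _.
  have -> : t = 2 ^+ (e - J) * K by rewrite -exprD subnK.
  have K0 : 0 < K by rewrite exprn_gt0.
  rewrite ler_pdivrMr ?mulr_gt0 ?exprn_gt0 // mulrCA mulVf ?gt_eqF // mulr1.
  by rewrite -natrX ler_nat.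
by rewrite sumr_const -[_ *+ _]mulr_natl.
Qed.

Let Ex_shell j : Ex (fun w => #|[set y in near A e w S z | shell j y]|%:R : R) <=
  (ball A S z (e + j.+1))%:R * expR (- 2 ^+ j).
Proof.
pose B := [set y in S | shell j y].
have E w : #|[set y in near A e w S z | shell j y]|%:R =
    \sum_(y in B) (same A e w z y)%:R :> R.
  rewrite -natr_sum -sum1_card big_mkcond [X in _ = X%:R]big_mkcond /=; congr _%:R.
  apply: eq_bigr => y _; rewrite !inE; case: (y \in S) => //=.
  by case: same; case: shell.
rewrite (eq_Ex E) Ex_sum; apply: (@le_trans _ _ (\sum_(y in B) expR (- 2 ^+ j))).
  apply: ler_sum => y; rewrite inE => /andP[_ /andP[hy _]].
  apply: le_trans (Pr_same_le A z y eM) _; rewrite ler_expR lerN2 ler_pdivlMr //.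
  by rewrite -exprD addnC -natrX ler_nat ltnW.
rewrite sumr_const -[_ *+ _]mulr_natl ler_wpM2r ?expR_ge0 // ler_nat.
by apply/subset_leq_card/fintype.subsetP => y; rewrite !inE => /andP[-> /andP[_ ->]].
Qed.

Let growth j : R := log_ball A S z (e + j.+1) - log_ball A S z (e - J).

Let growth_ge0 j : 0 <= growth j.
Proof.
rewrite subr_ge0 /log_ball ler_ln ?posrE ?ltr0n ?ball_gt0 // ler_nat.
by apply: ball_mono; lia.
Qed.

(** If [growth j >= 2 ^ j / 2], the trivial bound 1 is enough. Otherwise the larger ball exceeds the
    inner one by a factor of at most [exp (2 ^ j / 2)], while the points of the shell stay in the
    cell with probability at most [exp (- 2 ^ j)]; what remains, [2 * exp (- 2 ^ j / 2)], is at most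
    [4 / 2 ^ j]. *)
Let Ex_frac j : Ex (frac j) <= 2 / K + (2 * growth j + 4) / 2 ^+ j.
Proof.
have K0 : 0 < K by rewrite exprn_gt0.
have s0 : 0 < 2 ^+ j :> R by rewrite exprn_gt0.
have g0 := growth_ge0 j.
case: (leP (2 ^+ j) (2 * growth j)) => sg.
  apply: (@le_trans _ _ 1); first exact: Ex_le_const.
  apply: (@le_trans _ _ ((2 * growth j + 4) / 2 ^+ j)); last by rewrite lerDr divr_ge0 // ltW.
  by rewrite ler_pdivlMr // mul1r; lra.
apply: le_trans (ler_Ex (frac_le j)) _; rewrite ExD !ExZr !ExZl; apply: lerD.
  by rewrite ler_pdivrMr // mulrAC -mulrA ler_wpM2l // mulrC.
set beta := (ball A S z (e + j.+1))%:R : R.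
have beta0 : 0 < beta by rewrite ltr0n ball_gt0.
have betaE : beta / m%:R = expR (growth j).
  by rewrite expRB !lnK // posrE.
apply: (@le_trans _ _ (2 * (beta / m%:R * expR (- 2 ^+ j)))).
  rewrite -[leLHS]mulrA ler_wpM2l // [leRHS]mulrAC ler_wpM2r ?invr_ge0 ?(ltW m0) //.
rewrite betaE -expRD; apply: (@le_trans _ _ (2 * expR (- (2 ^+ j / 2)))).
  by rewrite ler_wpM2l // ler_expR; lra.
apply: (@le_trans _ _ (4 / 2 ^+ j)); last first.
  by rewrite ler_wpM2r ?invr_ge0 ?(ltW s0) //; lra.
rewrite expRN; apply: (@le_trans _ _ (2 * (2 ^+ j / 2)^-1)).
  rewrite ler_wpM2l // lef_pV2 ?posrE ?expR_gt0 ?divr_gt0 //.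
  by apply: le_trans (expR_ge1Dx _); rewrite lerDr.
by rewrite le_eqVlt; apply/orP; left; apply/eqP; field; rewrite gt_eqF.
Qed.

(** The weight [2 * 2 ^ j * t] of shell [j] cancels the [2 ^ j] in [Ex_frac], so a shell pays only
    for its logarithmic growth. The terms [2 / K] sum geometrically to [4 * t]; with [t] for the
    inner points and [2 * t] for those beyond [2 ^ (e + J)] this makes the 7. *)
Lemma mean_dist_growth :
  Ex (fun w => mean_dist A e w S z) <=
    t * (7 + \sum_(j < J) (4 * (log_ball A S z (e + j.+1) - log_ball A S z (e - J)) + 8)).
Proof.
pose tail w : R := \sum_(y in S | (2 ^ (e + J) < hamA A z y)%N)
  (hamA A z y)%:R * (same A e w z y)%:R.
have K0 : 0 < K by rewrite exprn_gt0.
have hamE y : (hamA A z y)%:R <= t + \sum_(j < J) 2 * 2 ^+ j * t * (shell j y)%:R +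
    (2 ^ (e + J) < hamA A z y)%N%:R * (hamA A z y)%:R.
  set h := hamA A z y; elim: J => [|n IHn].
    rewrite big_ord0 addr0 addn0; case: (ltnP (2 ^ e)%N h) => eh.
      by rewrite mul1r lerDr ltW.
    by rewrite mul0r addr0 -natrX ler_nat.
  rewrite big_ord_recr /=; apply: le_trans IHn _; rewrite -!addrA !lerD2l.
  case: (ltnP (2 ^ (e + n))%N h) => h1; last first.
    by rewrite mul0r addr_ge0 ?mulr_ge0 ?exprn_ge0.
  rewrite mul1r /shell -/h h1 /=; case: (leqP h (2 ^ (e + n.+1))%N) => h2.
    rewrite mulr1 -lerBlDr.
    apply: (@le_trans _ _ h%:R); first by rewrite lerBlDr lerDl mulr_ge0.
    have -> : 2 * 2 ^+ n * t = (2 ^ (e + n.+1))%:R by rewrite natrX exprD exprS mulrC.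
    by rewrite ler_nat.
  by rewrite mulr0 add0r mul1r.
have point w : mean_dist A e w S z <= t + \sum_(j < J) 2 * 2 ^+ j * t * frac j w + tail w.
  have n0 : 0 < #|near A e w S z|%:R :> R by rewrite ltr0n near_gt0.
  apply: (@le_trans _ _ ((\sum_(y in near A e w S z) (t + \sum_(j < J) 2 * 2 ^+ j * t * (shell j y)%:R)) /
     #|near A e w S z|%:R + tail w)).
    rewrite -lerBlDr -[tail w](@mulfK _ #|near A e w S z|%:R) ?gt_eqF // -mulrBl.
    rewrite ler_wpM2r ?invr_ge0 ?(ltW n0) // lerBlDr.
    apply: (@le_trans _ _ (\sum_(y in near A e w S z) (t + \sum_(j < J) 2 * 2 ^+ j * t * (shell j y)%:R) +
       \sum_(y in near A e w S z) (2 ^ (e + J) < hamA A z y)%N%:R * (hamA A z y)%:R)).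
      by rewrite -big_split /=; apply: ler_sum => y _; apply: hamE.
    rewrite lerD2l; apply: (@le_trans _ _ (tail w)).
      rewrite /tail [leLHS]big_mkcond [leRHS]big_mkcond /=; apply: ler_sum => y _.
      rewrite !inE; case: (y \in S) => //=; case: same; case: ifP => _ //=;
        by rewrite ?mul1r ?mulr1 ?mul0r ?mulr0.
    rewrite ler_peMr ?ler1n ?near_gt0 // /tail sumr_ge0 // => y _.
    by rewrite mulr_ge0.
  rewrite lerD2r big_split /= sumr_const mulrDl -[_ *+ _]mulr_natr mulfK ?gt_eqF //.
  rewrite lerD2l exchange_big /= mulr_suml; apply: ler_sum => j _.
  rewrite -mulr_sumr -mulrA ler_wpM2l ?mulr_ge0 ?exprn_ge0 ?(ltW t0) //.
  rewrite /frac ler_wpM2r ?invr_ge0 // -natr_sum ler_nat -sum1_card.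
  rewrite [leqLHS]big_mkcond [leqRHS]big_mkcond /=.
  by apply: leq_sum => y _; rewrite !inE; case: (_ && _); case: shell.
have Etail : Ex tail <= 2 * t.
  rewrite Ex_sum; apply: (@le_trans _ _ (\sum_(y in S | (2 ^ (e + J) < hamA A z y)%N)
      2 * t * expR (- (K / 2)))).
    apply: ler_sum => y /andP[_ hy]; rewrite ExZl.
    apply: le_trans (ler_wpM2l _ (Pr_same_le A z y eM)) _ => //.
    set x := (hamA A z y)%:R / t.
    have xK : K <= x.
      by rewrite ler_pdivlMr // -exprD addnC -natrX ler_nat ltnW.
    have -> : (hamA A z y)%:R = t * x by rewrite /x mulrC divfK // gt_eqF.
    rewrite [leLHS](_ : _ = t * (x * expR (- x))); last by ring.
    rewrite [leRHS](_ : _ = t * (2 * expR (- (K / 2)))); last by ring.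
    rewrite ler_wpM2l ?(ltW t0) //.
    (* One half of the exponent absorbs the factor [x], the other beats the number of points. *)
    have -> : - x = - (x / 2) + - (x / 2) by field.
    have x0 : 0 <= x := le_trans (ltW K0) xK.
    rewrite expRD mulrA; apply: ler_pM; [exact: mulr_ge0 x0 (expR_ge0 _) |
      exact: expR_ge0 | |].
    - rewrite expRN ler_pdivrMr ?expR_gt0 // mulrC -ler_pdivrMr //.
      by apply: le_trans (expR_ge1Dx _); rewrite lerDr.
    - by rewrite ler_expR; lra.
  rewrite sumr_const -[_ *+ _]mulr_natr -mulrA ler_piMr ?mulr_ge0 ?(ltW t0) //.
  rewrite mulrC; apply: le_trans smallS; rewrite ler_wpM2r ?expR_ge0 // ler_nat.
  by apply/subset_leq_card/fintype.subsetP => y /andP[].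
apply: le_trans (ler_Ex point) _; rewrite !ExD Ex_const // Ex_sum.
under eq_bigr => j _ do rewrite ExZl.
apply: (@le_trans _ _ (t + \sum_(j < J) (2 * 2 ^+ j * t * (2 / K) +
    2 * t * (2 * growth j + 4)) + 2 * t)).
  rewrite lerD // lerD2l; apply: ler_sum => j _.
  apply: le_trans (ler_wpM2l _ (Ex_frac j)) _; first by rewrite !mulr_ge0 ?exprn_ge0 ?(ltW t0).
  rewrite mulrDr lerD2l le_eqVlt; apply/orP; left; apply/eqP; field.
  by rewrite expf_neq0 ?pnatr_eq0.
have geo : \sum_(j < J) 2 * 2 ^+ j * t * (2 / K) <= 4 * t.
  have -> : \sum_(j < J) 2 * 2 ^+ j * t * (2 / K) = (4 * t / K) * \sum_(j < J) (2 : R) ^+ j.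
    by rewrite mulr_sumr; apply: eq_bigr => j _; field; rewrite expf_neq0 ?pnatr_eq0.
  have -> : \sum_(j < J) (2 : R) ^+ j = K - 1.
    by have := subrX1 (2 : R) J; rewrite (_ : 2 - 1 = 1 :> R) ?mul1r //; ring.
  rewrite mulrAC ler_pdivrMr // ler_wpM2l ?mulr_ge0 ?(ltW t0) //; lra.
rewrite big_split /= mulrDr mulr_sumr.
have -> : \sum_(j < J) t * (4 * growth j + 8) = \sum_(j < J) 2 * t * (2 * growth j + 4).
  by apply: eq_bigr => j _; ring.
by set s := \sum_(j < J) 2 * t * _; lra.
Qed.

End Growth.
End Cells.

(** * Telescoping the logarithms of ball sizes over the levels *)

Section LevelSums.
Variable R : realType.

Lemma half_exp_le1 (e : nat) : (2^-1 : R) ^+ e <= 1.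
Proof. by rewrite exprn_ile1 ?invr_ge0 // invf_le1 ?ler1n. Qed.

(** An increment over [s] steps splits into [s] single steps, each telescoping to at most the range
    [L], whatever the number [n] of levels. This avoids a second factor [log n]. *)
Lemma sum_shift_le (psi : nat -> R) (L : R) (s a n : nat) :
  (forall i, psi i <= psi i.+1) -> (forall i, 0 <= psi i <= L) ->
  \sum_(k < n) (psi (a + k + s)%N - psi (a + k)%N) <= s%:R * L.
Proof.
move=> psi1 psiL; elim: s => [|s IHs].
  by rewrite mul0r big1 // => k _; rewrite addn0 subrr.
have -> : \sum_(k < n) (psi (a + k + s.+1)%N - psi (a + k)%N) =
    \sum_(k < n) (psi (a + k + s)%N - psi (a + k)%N) +
    \sum_(k < n) (psi (a + k.+1 + s)%N - psi (a + k + s)%N).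
  rewrite -big_split /=; apply: eq_bigr => k _.
  have -> : (a + k.+1 + s = a + k + s.+1)%N by lia.
  by ring.
rewrite -natr1 mulrDl mul1r; apply: lerD => //.
rewrite -(big_mkord xpredT (fun k => psi (a + k.+1 + s)%N - psi (a + k + s)%N)) /=.
rewrite (@telescope_sumr _ 0 n (fun k => psi (a + k + s)%N)) //.
by have := psiL (a + n + s)%N; have := psiL (a + 0 + s)%N; lra.
Qed.

Variables (V F : finType) (cut : F -> V -> bool) (M : nat).
Local Notation half := (2^-1 : R).
Local Notation Omega := {ffun F -> 'I_(2 ^ M)}.
Local Notation mean_dist := (@mean_dist R V F cut M).

(** [ln N] is not multiplied by the number [n] of levels: it comes from [J] shells, each a
    telescoping sum with a shift of at most [2 * J]. *)
Definition level_bound (n J N : nat) : R :=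
  n%:R * (7 + 8 * J%:R) + 8 * J%:R ^+ 2 * ln N%:R.

Lemma mean_dist_level_sum (A : {set F}) (S : {set V}) z (a n J N : nat) :
  z \in S -> (#|S| <= N)%N -> (J <= a)%N -> (a + n <= M.+1)%N ->
  N%:R * expR (- (2 ^+ J / 2)) <= 1 :> R ->
  \sum_(k < n) half ^+ (a + k) * Ex (fun w => mean_dist A (a + k) w S z) <=
    level_bound n J N.
Proof.
move=> zS SN Ja anM smallN.
have S0 : (0 < #|S|)%N by apply/card_gt0P; exists z.
have N0 : (0 < N)%N by apply: leq_trans SN.
have lnN : 0 <= ln N%:R :> R by rewrite ln_ge0 // ler1n.
have smallS : #|S|%:R * expR (- (2 ^+ J / 2)) <= 1 :> R.
  by apply: le_trans smallN; rewrite ler_wpM2r ?expR_ge0 // ler_nat.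
pose psi i := log_ball R cut A S z i.
have term (k : 'I_n) : half ^+ (a + k) * Ex (fun w => mean_dist A (a + k) w S z) <=
    7 + \sum_(j < J) (4 * (psi (a - J + k + (J + j.+1))%N - psi (a - J + k)%N) + 8).
  have aM : (a + k <= M)%N by have := ltn_ord k; lia.
  have Jak : (J <= a + k)%N by lia.
  have le := mean_dist_growth cut A zS aM Jak smallS.
  have x0 : 0 < (2 : R) ^+ (a + k) by rewrite exprn_gt0.
  rewrite mulrC exprVn ler_pdivrMr //; apply: le_trans le _; rewrite [leRHS]mulrC.
  rewrite ler_wpM2l ?(ltW x0) // lerD2l; apply: ler_sum => j _.
  have -> : (a - J + k + (J + j.+1) = a + k + j.+1)%N by lia.
  by have -> : (a - J + k = a + k - J)%N by lia.
apply: le_trans (ler_sum _ (fun k _ => term k)) _.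
rewrite big_split /= sumr_const card_ord exchange_big /= /level_bound mulrDr.
rewrite -[7 *+ n]mulr_natl -addrA lerD2l.
have psi1 i : psi i <= psi i.+1.
  by rewrite /psi /log_ball ler_ln ?posrE ?ltr0n ?ball_gt0 // ler_nat ball_mono.
have psiL i : 0 <= psi i <= ln N%:R.
  rewrite /psi /log_ball ln_ge0 ?ler1n ?ball_gt0 //= ler_ln ?posrE ?ltr0n ?ball_gt0 //.
  rewrite ler_nat; apply: leq_trans SN; apply/subset_leq_card/fintype.subsetP => y.
  by rewrite inE => /andP[].
apply: (@le_trans _ _ (\sum_(j < J) (4 * (2 * J%:R * ln N%:R) + n%:R * 8))).
  apply: ler_sum => j _; rewrite big_split /= sumr_const card_ord -[8 *+ n]mulr_natl.
  rewrite lerD2r -mulr_sumr ler_wpM2l //; apply: le_trans (sum_shift_le _ _ n psi1 psiL) _.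
  by rewrite ler_wpM2r // -natrM ler_nat; have := ltn_ord j; lia.
rewrite sumr_const card_ord -[_ *+ J]mulr_natl le_eqVlt; apply/orP; left; apply/eqP.
by ring.
Qed.

Section CutEdge.
Variables (X : {set V}) (z : V).
Hypothesis zX : z \in X.

Let rest (f0 : F) : {set F} := ~: [set f0].
Let side (f0 : F) : {set V} := [set y in X | cut f0 y == cut f0 z].

(** If [f0] is kept, the cell lies on the side of [z] and [f0] separates none of its points from
    [z]; otherwise [f0] does not shape the cell and adds at most 1 to each distance. Adding both
    cases gives a bound that does not involve the level of [f0]. *)
Lemma mean_dist_restrict f0 e (w : Omega) :
  mean_dist [set: F] e w X z <=
    mean_dist (rest f0) e w (side f0) z + mean_dist (rest f0) e w X z + 1.
Proof.
have restE y : hamA cut [set: F] z y = (hamA cut (rest f0) z y + (cut f0 z != cut f0 y))%N.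
  rewrite /hamA (cardsD1 f0) addnC !inE /=; congr (_ + _)%N.
  by apply: eq_card => f; rewrite !inE; case: (f == f0).
case kw: (keep e (w f0)).
  have nearE : near cut [set: F] e w X z = near cut (rest f0) e w (side f0) z.
    apply/setP => y; rewrite !inE; case: (y \in X) => //=.
    apply/forall_inP/andP => [s|[/eqP sy /forall_inP s] f _]; last first.
      have [->|nf] := eqVneq f f0; first by rewrite sy eqxx implybT.
      by apply: s; rewrite !inE.
    split; last by apply/forall_inP => f _; apply: s; rewrite inE.
    by have := s f0; rewrite inE kw /= eq_sym => ->.
  have := mean_dist_ge0 R cut (rest f0) e w X z.
  suff -> : mean_dist [set: F] e w X z = mean_dist (rest f0) e w (side f0) z by lra.
  rewrite /mean_dist nearE; congr (_ / _); apply: eq_bigr => y.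
  by rewrite !inE => /andP[/andP[_ /eqP sy] _]; rewrite restE sy eqxx addn0.
have nearE : near cut [set: F] e w X z = near cut (rest f0) e w X z.
  apply/setP => y; rewrite !inE; case: (y \in X) => //=; apply: eq_forallb => f.
  by rewrite !inE; have [->|//] := eqVneq f f0; rewrite kw.
have := mean_dist_ge0 R cut (rest f0) e w (side f0) z.
suff : mean_dist [set: F] e w X z <= mean_dist (rest f0) e w X z + 1 by lra.
rewrite /mean_dist nearE; set B := near _ _ _ _ _ _.
have B0 : 0 < #|B|%:R :> R by rewrite ltr0n near_gt0.
rewrite ler_pdivrMr // mulrDl divfK ?gt_eqF // mul1r -sum1_card natr_sum -big_split /=.
apply: ler_sum => y _; rewrite restE natrD lerD2l ler_nat.
exact: leq_b1.
Qed.

Lemma mean_dist_upd f0 e (w : Omega) t S :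
  mean_dist (rest f0) e (upd w f0 t) S z = mean_dist (rest f0) e w S z.
Proof.
have nE : near cut (rest f0) e (upd w f0 t) S z = near cut (rest f0) e w S z.
  apply/setP => y; rewrite !inE; congr (_ && _); apply: eq_forallb => f.
  by rewrite !inE ffunE; case: (f == f0).
by rewrite /mean_dist nE.
Qed.

(* Conditionally on the level of a cut [f0] that separates [z] from [z'], the
   other cuts are independent, and the set [side f0] does not depend on the
   scale: this is what makes the sum over the levels telescope. *)
Lemma cut_edge_level_sum z' (a n J N : nat) :
  (#|X| <= N)%N -> (J <= a)%N -> (a + n <= M)%N ->
  N%:R * expR (- (2 ^+ J / 2)) <= 1 :> R ->
  \sum_(k < n) Ex (fun w => (~~ same cut [set: F] (a + k) w z z')%:R *
      (mean_dist [set: F] (a + k) w X z + mean_dist [set: F] (a + k).+1 w X z)) <=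
    (ham cut z z')%:R * (6 * level_bound n J N + 2 * n%:R).
Proof.
move=> XN Ja anM smallN; set D := [set f | cut f z != cut f z'].
have M0 : (0 < #|'I_(2 ^ M)|)%N by rewrite card_ord expn_gt0.
have W0 : (0 < #|{: Omega}|)%N by rewrite card_ffun expn_gt0 M0.
have md0 A e w S : 0 <= mean_dist A e w S z by apply: mean_dist_ge0.
pose T f k e := half ^+ (a + k) * (Ex (fun w => mean_dist (rest f) e w (side f) z) +
  Ex (fun w => mean_dist (rest f) e w X z) + 1).
have one f (k : 'I_n) e : Ex (fun w : Omega => (keep (a + k) (w f))%:R *
    mean_dist [set: F] e w X z) <= T f k e.
  have kM : (a + k <= M)%N by have := ltn_ord k; lia.
  apply: (@le_trans _ _ (Ex (fun w : Omega => (keep (a + k) (w f))%:R *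
     (mean_dist (rest f) e w (side f) z + mean_dist (rest f) e w X z + 1)))).
    by apply: ler_Ex => w; rewrite ler_wpM2l // mean_dist_restrict.
  rewrite (@Ex_indep _ _ _ f (fun v => (keep (a + k) v)%:R) (fun w =>
    mean_dist (rest f) e w (side f) z + mean_dist (rest f) e w X z + 1)).
    by rewrite -/(Pr R (keep (a + k))) Pr_lt_exp2 // !ExD Ex_const.
  by move=> w t; rewrite !mean_dist_upd.
(* Separated points are separated by some kept cut of [D]: a union bound over that cut. *)
apply: (@le_trans _ _ (\sum_(f in D) \sum_(k < n) (T f k (a + k)%N + T f k (a + k).+1))).
  rewrite exchange_big /=; apply: ler_sum => k _.
  apply: (@le_trans _ _ (\sum_(f in D) Ex (fun w : Omega => (keep (a + k) (w f))%:R *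
     (mean_dist [set: F] (a + k) w X z + mean_dist [set: F] (a + k).+1 w X z)))); last first.
    apply: ler_sum => f _; under eq_Ex => w do rewrite mulrDr.
    by rewrite ExD lerD.
  rewrite -Ex_sum; apply: ler_Ex => w; rewrite -mulr_suml.
  rewrite ler_wpM2r ?addr_ge0 //.
  case: (boolP (same _ _ _ _ _ _)) => [_|/forall_inPn[f _]]; first exact: sumr_ge0.
  rewrite negb_imply => /andP[kf cf].
  by rewrite (bigD1 f) ?inE //= kf lerDl sumr_ge0.
rewrite [X in _ <= X%:R * _](_ : _ = #|D|) // mulr_natl -sumr_const.
apply: ler_sum => f _; have zS : z \in side f by rewrite inE zX eqxx.
have SN : (#|side f| <= N)%N.
  by apply: leq_trans XN; apply/subset_leq_card/fintype.subsetP => y; rewrite inE => /andP[].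
have h1 : \sum_(k < n) T f k (a + k)%N <= 2 * level_bound n J N + n%:R.
  have B1 := mean_dist_level_sum (rest f) zS SN Ja (leqW anM) smallN.
  have B2 := mean_dist_level_sum (rest f) zX XN Ja (leqW anM) smallN.
  rewrite /T; under eq_bigr => k _ do rewrite !mulrDr.
  rewrite !big_split /= mulr2n mulrDl !mul1r !lerD //.
  rewrite -[X in X%:R]card_ord -sum1_card natr_sum; apply: ler_sum => k _.
  by rewrite mulr1 half_exp_le1.
(* One level up, the weights [2 ^- (a + k)] are twice those that match the scale, which turns the 2
   of [h1] into 4. *)
have h2 : \sum_(k < n) T f k (a + k).+1 <= 4 * level_bound n J N + n%:R.
  have aSM : (a.+1 + n <= M.+1)%N by rewrite addSn.
  have B1 := mean_dist_level_sum (rest f) zS SN (leqW Ja) aSM smallN.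
  have B2 := mean_dist_level_sum (rest f) zX XN (leqW Ja) aSM smallN.
  have E (S : {set V}) : \sum_(k < n) half ^+ (a + k) *
      Ex (fun w => mean_dist (rest f) (a + k).+1 w S z) =
      2 * \sum_(k < n) half ^+ (a.+1 + k) * Ex (fun w => mean_dist (rest f) (a.+1 + k) w S z).
    rewrite mulr_sumr; apply: eq_bigr => k _; rewrite addSn exprS.
    by rewrite [RHS]mulrA mulrA divff ?mul1r ?pnatr_eq0.
  rewrite /T; under eq_bigr => k _ do rewrite !mulrDr.
  rewrite !big_split /= !E.
  have : \sum_(k < n) half ^+ (a + k) * 1 <= n%:R.
    rewrite -[X in _ <= X%:R]card_ord -sum1_card natr_sum; apply: ler_sum => k _.
    by rewrite mulr1 half_exp_le1.
  by lra.
by rewrite big_split /=; lra.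
Qed.

End CutEdge.
End LevelSums.

(** * Charging sibling costs to the edges of a connected graph *)

Section SiblingCostUpper.
Variables (R : realType) (V U W : finType) (X : {set V}) (u : V -> U) (pi : U -> W).
Variable g : V -> V -> R.
Hypotheses (g0 : forall x y, 0 <= g x y) (gC : forall x y, g x y = g y x).
Hypothesis g_triangle : forall x y z, g x z <= g x y + g y z.
Local Notation C := (labels X u).
Local Notation sib := (siblings X u pi).

Lemma mean_left (A B : {set V}) (f : V -> R) : B != finset.set0 ->
  mean (fun x _ => f x) A B = (\sum_(x in A) f x) / #|A|%:R.
Proof.
rewrite -card_gt0 => B0; rewrite /mean.
under eq_bigr => x _ do rewrite sumr_const -mulr_natr.
by rewrite -mulr_suml invfM mulrACA divff ?mulr1 // pnatr_eq0 -lt0n.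
Qed.

Lemma mean_right (A B : {set V}) (f : V -> R) : A != finset.set0 ->
  mean (fun _ y => f y) A B = (\sum_(y in B) f y) / #|B|%:R.
Proof.
rewrite -card_gt0 => A0; rewrite /mean sumr_const -[_ *+ _]mulr_natl.
by rewrite invfM mulrACA divff ?mul1r // pnatr_eq0 -lt0n.
Qed.

Lemma mean_through (A B : {set V}) z : A != finset.set0 -> B != finset.set0 ->
  mean g A B <= (\sum_(x in A) g x z) / #|A|%:R + (\sum_(y in B) g z y) / #|B|%:R.
Proof.
move=> A0 B0; rewrite -(mean_left A (fun x => g x z) B0).
rewrite -(mean_right B (g z) A0) -meanD.
by apply: mean_le => x y _ _; apply: g_triangle.
Qed.

Lemma mean_via (A B Y : {set V}) : A != finset.set0 -> B != finset.set0 ->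
  Y != finset.set0 -> mean g A B <= mean g A Y + mean g B Y.
Proof.
move=> A0 B0 Y0; rewrite [X in _ <= X + _]meanE [X in _ <= _ + X]meanE.
rewrite -mulrDl -big_split /=.
apply: const_le_mean => // y yY; apply: le_trans (mean_through y A0 B0) _.
by rewrite lerD2l; under eq_bigr => x _ do rewrite gC.
Qed.

Let to_parent a : R := mean g (fiber X u a) (fiber X (pi \o u) (pi a)).

Let parent_neq0 a : a \in C -> fiber X (pi \o u) (pi a) != finset.set0.
Proof.
by case/imsetP => x xX ->; apply/set0Pn; exists x; rewrite inE xX /= eqxx.
Qed.

(** The distance between siblings is routed through a random point of the parent; after division by
    the number of siblings each child is charged once in each of the two roles. *)
Lemma sibling_cost_to_parent :
  sibling_cost X u pi g <=
    2 * \sum_(a in C) mean g (fiber X u a) (fiber X (pi \o u) (pi a)).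
Proof.
rewrite -/(to_parent _).
apply: (@le_trans _ _ (\sum_(a in C) \sum_(b in sib a)
    ((to_parent b) / #|sib a|%:R + (to_parent a) / #|sib a|%:R))).
  apply: ler_sum => a aC; rewrite mulr_suml; apply: (@le_trans _ _
     (\sum_(b in sib a | b != a) (to_parent b / #|sib a|%:R + to_parent a / #|sib a|%:R))).
    apply: ler_sum => b; rewrite inE => /andP[/andP[bC /eqP pb] _].
    rewrite -mulrDl ler_wpM2r ?invr_ge0 // /to_parent pb.
    by apply: mean_via; [exact: fiber_neq0 | exact: fiber_neq0 | exact: parent_neq0].
  rewrite [leRHS](bigID (fun b => b != a)) /= lerDl sumr_ge0 // => b _.
  by apply: addr_ge0; apply: divr_ge0 => //; apply: mean_ge0.
rewrite mulr2n mulrDl mul1r.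
rewrite (eq_bigr (fun a => \sum_(b in sib a) to_parent b / #|sib a|%:R + to_parent a)).
  rewrite big_split /= lerD2r.
  rewrite (exchange_big_dep (fun b => b \in C)) /=; last by move=> a b _; rewrite inE => /andP[].
  apply: ler_sum => b bC.
  have sE a : (a \in C) && (b \in sib a) = (a \in sib b).
    by rewrite !inE bC eq_sym.
  rewrite (eq_bigl _ _ sE) (eq_bigr (fun=> to_parent b / #|sib b|%:R)) => [|a]; last first.
    rewrite inE => /andP[_ /eqP ab]; congr (_ / _%:R); apply: eq_card => c.
    by rewrite !inE ab.
  by rewrite sumr_const -[_ *+ _]mulr_natr divfK // pnatr_eq0 -lt0n siblings_gt0.
move=> a aC; rewrite big_split /= sumr_const -[X in _ + X]mulr_natr divfK //.
by rewrite pnatr_eq0 -lt0n siblings_gt0.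
Qed.

Let spread (T : finType) (v : V -> T) z : R :=
  (\sum_(y in fiber X v (v z)) g z y) / #|fiber X v (v z)|%:R.

(* As soon as there are two clusters, an edge of a connected graph leaves each
   of them; the distance from a cluster to its parent is charged to that edge. *)
Lemma sibling_cost_le_edges (E : {set V * V}) :
  connected_on X E -> (forall x y, (x, y) \in E -> (x \in X) && (y \in X)) ->
  sibling_cost X u pi g <= 2 * \sum_(e in E)
    ((u e.1 != u e.2)%:R * (spread u e.1 + spread (pi \o u) e.1) +
     (u e.2 != u e.1)%:R * (spread u e.2 + spread (pi \o u) e.2)).
Proof.
move=> cE XE.
have sp0 (T : finType) (v : V -> T) z : 0 <= spread v z.
  by rewrite /spread divr_ge0 // sumr_ge0.
have t0 e : 0 <= (u e.1 != u e.2)%:R * (spread u e.1 + spread (pi \o u) e.1) +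
     (u e.2 != u e.1)%:R * (spread u e.2 + spread (pi \o u) e.2).
  by rewrite addr_ge0 // mulr_ge0 // addr_ge0.
have [C1|C1] := leqP #|C| 1.
  rewrite /sibling_cost big1 ?mulr_ge0 ?sumr_ge0 // => a aC.
  rewrite big1 ?mul0r // => b /andP[]; rewrite inE => /andP[bC _].
  by have /card_le1_eqP/(_ b a bC aC) -> := C1; rewrite eqxx.
apply: le_trans sibling_cost_to_parent _; rewrite ler_wpM2l //.
pose h z := spread u z + spread (pi \o u) z.
have toz a z : a \in C -> z \in fiber X u a -> to_parent a <= h z.
  move=> aC; rewrite inE => /andP[zX /eqP zu]; rewrite /to_parent /h /spread /= zu.
  apply: le_trans (mean_through z (fiber_neq0 aC) (parent_neq0 aC)) _.
  by rewrite lerD2r; under eq_bigr => x _ do rewrite gC.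
have cst a x y : ~~ [exists e in E, (u e.1 != u e.2) && ((u e.1 == a) || (u e.2 == a))] ->
    connect (adj E) x y -> (u x == a) = (u y == a).
  move=> /exists_inPn nE /connectP[l + ->]; elim: l x => //= v l IHl x /andP[xv /IHl <-].
  have edge e : e \in E -> (u e.1 == a) = (u e.2 == a).
    move=> /nE; rewrite negb_and negbK negb_or => /orP[/eqP -> //|].
    by case/andP => /negPf -> /negPf ->.
  by case/orP: xv => [/edge|/edge ->].
have leave a : a \in C -> [exists e in E, (u e.1 != u e.2) && ((u e.1 == a) || (u e.2 == a))].
  move=> aC; apply: contraLR C1 => nE; rewrite -leqNgt; apply/card_le1_eqP.
  case/imsetP: aC => x xX aE.
  have all_a y : y \in X -> u y = a.
    by move=> yX; apply/eqP; rewrite -(cst a x y nE (cE x y xX yX)) aE.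
  by move=> b c /imsetP[y yX ->] /imsetP[v vX ->]; rewrite !all_a.
apply: (@le_trans _ _ (\sum_(a in C) \sum_(e in E)
    ((u e.1 != u e.2)%:R * (u e.1 == a)%:R * h e.1 +
     (u e.2 != u e.1)%:R * (u e.2 == a)%:R * h e.2))).
  apply: ler_sum => a aC; have /exists_inP[e eE /andP[ne ea]] := leave a aC.
  have /andP[X1 X2] : (e.1 \in X) && (e.2 \in X) by apply: XE; rewrite -surjective_pairing.
  have h0 z : 0 <= h z by rewrite addr_ge0.
  rewrite (bigD1 e) //= [u e.2 == u e.1]eq_sym ne !mul1r.
  apply: (@le_trans _ _ ((u e.1 == a)%:R * h e.1 + (u e.2 == a)%:R * h e.2)).
    case/orP: ea => ea.
      by rewrite ea mul1r ler_wpDr ?mulr_ge0 // toz // inE X1.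
    by rewrite ea mul1r ler_wpDl ?mulr_ge0 // toz // inE X2.
  by rewrite lerDl sumr_ge0 // => i _; rewrite addr_ge0 // !mulr_ge0.
rewrite exchange_big /=; apply: ler_sum => e eE.
have /andP[X1 X2] : (e.1 \in X) && (e.2 \in X) by apply: XE; rewrite -surjective_pairing.
have pick z : z \in X -> \sum_(a in C) (u z == a)%:R = 1 :> R.
  move=> zX; rewrite (bigD1 (u z)) /= ?imset_f // eqxx big1 ?addr0 // => a /andP[_].
  by rewrite eq_sym => /negPf ->.
rewrite big_split /= -!mulr_suml -!mulr_sumr !pick // !mulr1.
exact: lexx.
Qed.

End SiblingCostUpper.

(** * Parity sketches of the distance *)

Section Parity.
Variables (R : realType) (V F : finType) (cut : F -> V -> bool) (M : nat).
Local Notation half := (2^-1 : R).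
Local Notation Sketch := {ffun F -> 'I_(2 ^ M)}.
Implicit Types (s : Sketch) (x y : V) (e J : nat).

Definition par e s x : bool := odd (\sum_f (keep e (s f) && cut f x)).

(** At rate [2 ^- (e + g)] the parities differ with probability of the order of the smaller of 1 and
    the rate times the Hamming distance. After rescaling, each [g] contributes at most the distance
    on average, and the scale nearest to it a constant fraction. *)
Definition rho e J s x y : R :=
  \sum_(g < J.+1) 2 ^+ (e + g) * (par (e + g) s x != par (e + g) s y)%:R.

Definition rho_bar e J x y : R := Ex (fun s => rho e J s x y).

Let M0 : (0 < #|'I_(2 ^ M)|)%N.
Proof. by rewrite card_ord expn_gt0. Qed.

(** The product of the signs of the two parities is a product of independent signs over the
    separating cuts, each of mean [1 - 2 * 2 ^- e]. *)
Lemma Pr_par_neq e x y : (e <= M)%N ->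
  Pr R (fun s : Sketch => par e s x != par e s y) =
    (1 - (1 - 2 * half ^+ e) ^+ ham cut x y) / 2.
Proof.
move=> eM; pose D := [set f | cut f x != cut f y].
pose g f (v : 'I_(2 ^ M)) : R := if f \in D then (-1) ^+ keep e v else 1.
have W0 : (0 < #|{: Sketch}|)%N by rewrite card_ffun expn_gt0 M0.
have E s : (par e s x != par e s y)%:R = (1 - \prod_f g f (s f)) / 2 :> R.
  have -> : \prod_f g f (s f) = (-1) ^+ par e s x * (-1) ^+ par e s y.
    rewrite !signr_odd !expr_sum -big_split; apply: eq_bigr => f _ /=.
    rewrite /g inE; case: (keep e (s f)) (cut f x) (cut f y) => [] [] [];
      by rewrite /= ?expr1 ?expr0 ?mulr1 ?mul1r ?mulrNN ?mulr1.
  by case: (par e s x); case: (par e s y); rewrite /= ?expr1 ?expr0; field.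
rewrite /Pr (eq_Ex E) ExZr ExB Ex_const // Ex_ffun_prod; congr ((1 - _) / 2).
rewrite (eq_bigr (fun f => if f \in D then 1 - 2 * half ^+ e else 1)) => [|f _].
  by rewrite -big_mkcond /= prodr_const.
rewrite /g; case: ifP => _; last by rewrite Ex_const.
rewrite (@eq_Ex _ _ _ (fun v => 1 - 2 * (keep e v)%:R)) => [|v].
  by rewrite ExB Ex_const // ExZl -/(Pr R (keep e)) Pr_lt_exp2.
by case: keep; rewrite /= ?expr1 ?expr0; ring.
Qed.

Let bernoulli (q : R) n : 0 <= q <= 1 -> 1 - n%:R * q <= (1 - q) ^+ n.
Proof.
case/andP => q0 q1; elim: n => [|n IHn]; first by rewrite mul0r subr0 expr0.
have q1' : 0 <= 1 - q by rewrite subr_ge0.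
rewrite exprS; apply: le_trans (ler_wpM2l q1' IHn); rewrite -natr1.
by have := ler0n R n; nra.
Qed.

Let bernoulli_inv (q : R) n : 0 <= q <= 1 -> (1 - q) ^+ n <= (1 + n%:R * q)^-1.
Proof.
case/andP => q0 q1; have n0 := ler0n R n.
have nq : 0 <= n%:R * q by apply: mulr_ge0.
rewrite -[leRHS]mul1r ler_pdivlMr; last by lra.
elim: n {n0 nq} => [|n IHn]; first by rewrite mul0r addr0 expr0 mul1r.
have q1' : 0 <= 1 - q by rewrite subr_ge0.
have x0 : 0 <= (1 - q) ^+ n by rewrite exprn_ge0.
apply: le_trans IHn; rewrite exprSr -mulrA ler_wpM2l // -natr1.
have := ler0n R n; move: (n%:R : R) => m m0.
have mq : 0 <= m * q ^+ 2 by apply: mulr_ge0 => //; apply: sqr_ge0.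
by have := sqr_ge0 q; nra.
Qed.

Let rate01 e : (0 < e)%N -> 0 <= 2 * half ^+ e <= 1.
Proof.
case: e => // e _; rewrite exprS mulrA divff ?mul1r ?pnatr_eq0 //.
by rewrite exprn_ge0 ?invr_ge0 //= half_exp_le1.
Qed.

Lemma rho_ge0 e J s x y : 0 <= rho e J s x y.
Proof. by apply: sumr_ge0 => g _; rewrite mulr_ge0 ?exprn_ge0. Qed.

Lemma rho_le e J s x y : rho e J s x y <= 2 * 2 ^+ J * 2 ^+ e.
Proof.
apply: (@le_trans _ _ (2 ^+ e * \sum_(g < J.+1) 2 ^+ g)).
  rewrite mulr_sumr; apply: ler_sum => g _; rewrite exprD ler_piMr ?mulr_ge0 ?exprn_ge0 //.
  by case: (_ != _).
rewrite mulrC ler_wpM2r ?exprn_ge0 //.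
have := subrX1 (2 : R) J.+1; rewrite (_ : 2 - 1 = 1 :> R) ?mul1r; last by ring.
by move=> <-; rewrite exprS lerBlDr lerDl.
Qed.

Lemma rho_bar_ge0 e J x y : 0 <= rho_bar e J x y.
Proof. by apply: Ex_ge0 => s; apply: rho_ge0. Qed.

Let rho_barE e J x y : (e + J <= M)%N -> rho_bar e J x y =
  \sum_(g < J.+1) 2 ^+ (e + g) * ((1 - (1 - 2 * half ^+ (e + g)) ^+ ham cut x y) / 2).
Proof.
move=> eM; rewrite /rho_bar Ex_sum; apply: eq_bigr => g _.
by rewrite ExZl -/(Pr R _) Pr_par_neq //; have := ltn_ord g; lia.
Qed.

Lemma rho_bar_le e J x y : (0 < e)%N -> (e + J <= M)%N ->
  rho_bar e J x y <= J.+1%:R * (ham cut x y)%:R.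
Proof.
move=> e0 eM; rewrite rho_barE // [leRHS]mulr_natl -[X in _ <= _ *+ X]card_ord -sumr_const.
apply: ler_sum => g _; have eg0 : (0 < e + g)%N by lia.
have := bernoulli (ham cut x y) (rate01 eg0).
have x0 : 0 < (2 : R) ^+ (e + g) by rewrite exprn_gt0.
rewrite exprVn; set t := 2 ^+ (e + g) in x0 *; set h := (ham cut x y)%:R.
set p := (_ ^+ _) => le; apply: (@le_trans _ _ (t * (h * (2 / t) / 2))).
  by rewrite ler_wpM2l ?(ltW x0) // ler_wpM2r ?invr_ge0 //; lra.
by rewrite le_eqVlt; apply/orP; left; apply/eqP; field; rewrite gt_eqF.
Qed.

Definition excess e J x y : R :=
  if (2 ^ (e + J) < ham cut x y)%N then (ham cut x y)%:R else 0.

(** For distance [h], the least [g] with [h <= 2 ^ (e + g)] satisfies [t < 2 * h] for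
    [t = 2 ^ (e + g)]; then [(1 - 2 / t) ^ h <= 1 / 2], and this scale alone contributes at least
    [t / 4 >= h / 4]. The two extra terms cover distances below and above the range of scales. *)
Lemma ham_le_rho_bar e J x y : (0 < e)%N -> (e + J <= M)%N ->
  (ham cut x y)%:R <= 4 * rho_bar e J x y + 2 ^+ e + excess e J x y.
Proof.
move=> e0 eM; have rb0 := rho_bar_ge0 e J x y; rewrite /excess.
have t0 : 0 <= (2 : R) ^+ e by rewrite exprn_ge0.
case: ltnP => [_|hJ]; first by rewrite lerDr; lra.
rewrite addr0; case: (leqP (ham cut x y) (2 ^ e)) => he.
  have : (ham cut x y)%:R <= (2 : R) ^+ e by rewrite -natrX ler_nat.
  by lra.
suff : (ham cut x y)%:R <= 4 * rho_bar e J x y by have := exprn_ge0 e (ler0n R 2); lra.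
have ex : exists g, (ham cut x y <= 2 ^ (e + g))%N by exists J.
have [g hg ming] := ex_minnP ex.
have gJ : (g < J.+1)%N by rewrite ltnS ming.
have g0 : (0 < g)%N by case: g hg {ming gJ} => //; rewrite addn0 leqNgt he.
have hg1 : (2 ^ (e + g) < 2 * ham cut x y)%N.
  have : ~~ (ham cut x y <= 2 ^ (e + g.-1))%N.
    by apply/negP => /ming; rewrite leqNgt prednK // leqnn.
  by rewrite -ltnNge -(prednK g0) addnS expnS ltn_pmul2l.
have eg0 : (0 < e + g)%N by lia.
have pinv := bernoulli_inv (ham cut x y) (rate01 eg0).
rewrite rho_barE // (bigD1 (Ordinal gJ)) //=.
have x0 : 0 < (2 : R) ^+ (e + g) by rewrite exprn_gt0.
move: pinv; rewrite exprVn; set t := 2 ^+ (e + g) in x0 *; set h := (ham cut x y)%:R.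
set p := ((1 - 2 / t) ^+ _); set s := \sum_(_ < _ | _) _ => pinv.
have s0 : 0 <= s.
  apply: sumr_ge0 => i _; rewrite mulr_ge0 ?exprn_ge0 ?divr_ge0 //.
  have eg0' : (0 < e + i)%N by lia.
  have /andP[r0 r1] := rate01 eg0'.
  by rewrite subr_ge0 exprn_ile1 ?subr_ge0 // lerBlDr lerDl.
have ht : h <= t by rewrite /t -natrX ler_nat.
have th : t <= 2 * h by rewrite /t -natrX -natrM ler_nat ltnW.
have h2 : 1 <= h * (2 / t) by rewrite mulrA ler_pdivlMr //; lra.
have p2 : p <= 1 / 2.
  by apply: le_trans pinv _; rewrite -[leLHS]div1r ler_pdivrMr; lra.
have : t * (1 / 4) <= t * ((1 - p) / 2) by rewrite ler_wpM2l ?(ltW x0) //; lra.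
by lra.
Qed.

End Parity.

(** * Summing over the levels *)

Section SiblingCostBounds.
Variables (R : realType) (V U W : finType) (X : {set V}) (u : V -> U) (pi : U -> W).
Implicit Types (g : V -> V -> R).
Local Notation C := (labels X u).
Local Notation sib := (siblings X u pi).

Let sib_natE a : a \in C -> #|sib a|%:R != 0 :> R.
Proof. by move=> aC; rewrite pnatr_eq0 -lt0n siblings_gt0. Qed.

(** A family of [k] siblings contributes [c * (k - 1)], that is, [c] for each cluster lost in the
    merge. This later pays for the penalties of the estimator. *)
Lemma sibling_cost_const (c : R) : sibling_cost X u pi (fun _ _ => c) =
  c * (#|C|%:R - #|labels X (pi \o u)|%:R).
Proof.
have term a : a \in C -> (\sum_(b in sib a | b != a)
    mean (fun _ _ => c) (fiber X u b) (fiber X u a)) / #|sib a|%:R = c - c / #|sib a|%:R.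
  move=> aC; rewrite (eq_bigr (fun=> c)) => [|b /andP[]]; last first.
    by rewrite inE => /andP[bC _] _; rewrite mean_const ?fiber_neq0.
  have as_ : a \in sib a by rewrite inE aC eqxx.
  have : \sum_(b in sib a) c = c + \sum_(b in sib a | b != a) c by rewrite (bigD1 a).
  rewrite sumr_const -[_ *+ _]mulr_natr => E.
  have -> : \sum_(b in sib a | b != a) c = c * #|sib a|%:R - c by rewrite E addrC addKr.
  by rewrite mulrBl mulfK // sib_natE.
rewrite /sibling_cost (eq_bigr _ term) sumrB sumr_const -[_ *+ _]mulr_natr mulrBr.
congr (_ - _); rewrite -mulr_sumr; congr (_ * _).
rewrite (partition_big pi (fun w => w \in labels X (pi \o u))) /=; last first.
  by move=> a /imsetP[x xX ->]; apply/imsetP; exists x.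
rewrite -sum1_card natr_sum; apply: eq_bigr => w /imsetP[x xX wE].
have uxC : u x \in C by apply: imset_f.
rewrite (eq_bigl (fun a => a \in sib (u x))) => [|a]; last by rewrite inE wE.
rewrite (eq_bigr (fun=> #|sib (u x)|%:R^-1)) => [|a]; last first.
  rewrite inE => /andP[_ /eqP e]; congr (_%:R^-1); apply: eq_card => b.
  by rewrite !inE e.
by rewrite sumr_const -[_ *+ _]mulr_natl divff // sib_natE.
Qed.

Lemma sibling_cost_le_card g (B : R) : 0 <= B ->
  (forall x y, 0 <= g x y <= B) -> sibling_cost X u pi g <= #|C|%:R * B.
Proof.
move=> B0 gB; rewrite mulr_natl -sumr_const; apply: ler_sum => a aC.
have k0 : 0 < #|sib a|%:R :> R by rewrite ltr0n siblings_gt0.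
rewrite ler_pdivrMr // mulr_natr -sumr_const.
apply: (@le_trans _ _ (\sum_(b in sib a | b != a) B)).
  apply: ler_sum => b _; rewrite meanE; apply: mean_le_const => // y _.
  by apply: mean_le_const => // x _; case/andP: (gB x y).
by rewrite [leRHS](bigID (fun b => b != a)) /= lerDl sumr_ge0.
Qed.

Lemma sibling_cost_le_sum g : (forall x y, 0 <= g x y) ->
  sibling_cost X u pi g <=
    \sum_(x in X) \sum_(y in X) (pi (u x) == pi (u y))%:R * g x y.
Proof.
move=> g0.
have split_X (H : V -> R) : \sum_(x in X) H x = \sum_(a in C) \sum_(x in fiber X u a) H x.
  rewrite (partition_big u (fun a => a \in C)) => [|x xX]; last exact: imset_f.
  by apply: eq_bigr => a _; apply: eq_bigl => x; rewrite inE.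
rewrite exchange_big split_X; apply: ler_sum => a aC.
have k1 : 1 <= #|sib a|%:R :> R by rewrite ler1n siblings_gt0.
have k0 : 0 < #|sib a|%:R :> R by rewrite ltr0n siblings_gt0.
apply: (@le_trans _ _ (\sum_(b in sib a | b != a) mean g (fiber X u b) (fiber X u a))).
  rewrite ler_pdivrMr // ler_peMr // sumr_ge0 // => b _; exact: mean_ge0.
apply: (@le_trans _ _ (\sum_(b in sib a) \sum_(y in fiber X u a) \sum_(x in fiber X u b) g x y)).
  rewrite [leRHS](bigID (fun b => b != a)) /= -[leLHS]addr0; apply: lerD.
    by apply: ler_sum => b _; rewrite [leRHS]exchange_big; apply: mean_le_sum.
  by apply: sumr_ge0 => b _; apply: sumr_ge0 => y _; apply: sumr_ge0.
rewrite exchange_big; apply: ler_sum => y; rewrite inE => /andP[_ /eqP uy].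
rewrite split_X [leRHS](bigID (fun b => pi b == pi a)) /= -[leLHS]addr0; apply: lerD; last first.
  by apply: sumr_ge0 => b _; apply: sumr_ge0 => x _; rewrite mulr_ge0.
rewrite (eq_bigl (fun b => (b \in C) && (pi b == pi a))) => [|b]; last by rewrite inE.
apply: ler_sum => b /andP[_ pib]; apply: ler_sum => x; rewrite inE => /andP[_ /eqP ub].
by rewrite ub uy pib mul1r.
Qed.

End SiblingCostBounds.

Section LevelWeights.
Variable R : realType.

(** Summation by parts with doubling weights; it converts numbers of cells into numbers of merged
    cells. *)
Lemma sum_level_abel (x : nat -> R) (e L : nat) : 0 <= x 0%N -> x L = 0 ->
  \sum_(i < L) 2 ^+ (e + i) * x i <= 2 * \sum_(i < L) 2 ^+ (e + i) * (x i - x i.+1).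
Proof.
move=> x0 xL.
suff : \sum_(i < L) 2 ^+ (e + i) * x i - 2 ^+ (e + L) * x L <=
    2 * \sum_(i < L) 2 ^+ (e + i) * (x i - x i.+1) by rewrite xL mulr0 subr0.
elim: (L) => [|n IHn].
  by rewrite !big_ord0 mulr0 sub0r oppr_le0 mulr_ge0 ?exprn_ge0.
rewrite !big_ord_recr /= addnS exprS; set t := 2 ^+ (e + n) in IHn *.
by set s := \sum_(_ < n) _ in IHn *; set s' := \sum_(_ < n) _ in IHn *; lra.
Qed.

Lemma sum_level_below (h e J L : nat) :
  \sum_(i < L) (if (2 ^ (e + i + J) < h)%N then 2 ^+ (e + i) else 0) * 2 ^+ J <= 2 * h%:R :> R.
Proof.
elim: L => [|n IHn]; first by rewrite big_ord0 mulr_ge0.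
rewrite big_ord_recr /=; case: ltnP => [lt|_]; last by rewrite mul0r addr0.
have le : \sum_(i < n) (if (2 ^ (e + i + J) < h)%N then 2 ^+ (e + i) else 0) * 2 ^+ J <=
    2 ^+ (e + n + J) :> R.
  elim: n {IHn lt} => [|n IHn]; first by rewrite big_ord0 exprn_ge0.
  rewrite big_ord_recr /= addnS addSn exprS mulrDl mul1r; apply: lerD => //.
  by case: ifP => _; rewrite -?exprD // mul0r exprn_ge0.
have : 2 ^+ (e + n + J) <= h%:R :> R by rewrite -natrX ler_nat ltnW.
by rewrite -exprD; set s := \sum_(_ < _) _ in le *; lra.
Qed.

Variables (V F : finType) (cut : F -> V -> bool) (M : nat).

Lemma excess_ge0 e J x y : 0 <= excess R cut e J x y.
Proof. by rewrite /excess; case: ifP. Qed.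

(** With [t = 2 ^ (e + i)], points at distance [h] share a cell of the next level with probability
    at most [exp (- h / (2 * t))]. Where [h > 2 ^ J * t], half of this exponent absorbs the factor
    [h / t], the other half is at least [2 ^ J / 4], and the scales [t] that are left sum
    geometrically. *)
Lemma Ex_excess (e J L : nat) x y : (e + L <= M)%N ->
  Ex (fun w : {ffun F -> 'I_(2 ^ M)} => \sum_(i < L)
     (same cut [set: F] (e + i).+1 w x y)%:R * excess R cut (e + i) J x y) <=
    8 * (ham cut x y)%:R * expR (- (2 ^+ J / 4)).
Proof.
move=> eLM; rewrite Ex_sum; set h := ham cut x y; set q := expR _.
have q0 : 0 <= q by apply: expR_ge0.
have J1 : 1 <= (2 : R) ^+ J by rewrite exprn_ege1 // ler1n.
apply: (@le_trans _ _ (\sum_(i < L) (if (2 ^ (e + i + J) < h)%N then 2 ^+ (e + i) else 0) *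
    2 ^+ J * (4 * q))); last first.
  rewrite -mulr_suml; have := sum_level_below h e J L => /(ler_wpM2r _ ) le.
  apply: le_trans (le (4 * q) _) _; first by rewrite mulr_ge0.
  by rewrite le_eqVlt; apply/orP; left; apply/eqP; ring.
apply: ler_sum => i _; rewrite ExZr /excess -/h; case: ifP => [hJ|_]; last first.
  by rewrite mulr0 !mul0r.
have eM : ((e + i).+1 <= M)%N by have := ltn_ord i; lia.
apply: le_trans (ler_wpM2r _ (Pr_same_le R cut [set: F] x y eM)) _ => //.
rewrite hamAT -/h.
have t0 : 0 < (2 : R) ^+ (e + i) by rewrite exprn_gt0.
set t := 2 ^+ (e + i) in t0 *; rewrite exprS -/t.
have hK : 2 ^+ J * t <= h%:R by rewrite -exprD addnC -natrX ler_nat ltnW.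
set s := h%:R / (2 * t); have sK : 2 ^+ J / 2 <= s.
  rewrite /s ler_pdivlMr ?mulr_gt0 // [leLHS](_ : _ = 2 ^+ J * t) //.
  by field.
have -> : h%:R = s * (2 * t) by rewrite divfK // gt_eqF // mulr_gt0.
have s0 : 0 < s by apply: lt_le_trans sK; lra.
have -> : - s = - (s / 2) + - (s / 2) by field.
rewrite expRD; apply: (@le_trans _ _ (expR (- (s / 2)) * q * (s * (2 * t)))).
  have st0 : 0 <= s * (2 * t) by rewrite mulr_ge0 ?(ltW s0) // mulr_ge0 // ltW.
  apply: ler_wpM2r => //; apply: ler_wpM2l; first exact: expR_ge0.
  by rewrite ler_expR; lra.
have es : expR (- (s / 2)) * s <= 2.
  rewrite expRN mulrC ler_pdivrMr ?expR_gt0 // mulrC -ler_pdivrMr //.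
  by apply: le_trans (expR_ge1Dx _); rewrite lerDr.
rewrite [leLHS](_ : _ = (expR (- (s / 2)) * s) * (2 * t * q)); last by ring.
have tq0 : 0 <= 2 * t * q by rewrite mulr_ge0 // mulr_ge0 // ltW.
apply: le_trans (ler_wpM2r tq0 es) _.
rewrite [leRHS](_ : _ = 2 ^+ J * (2 * (2 * t * q))); last by ring.
by rewrite ler_peMl // mulr_ge0.
Qed.

End LevelWeights.

(** * The estimator as a function of linear counts *)

Section Counts.
Variables (R : realType) (V F U W : finType) (cut : F -> V -> bool) (M Q e J : nat).
Variables (u : V -> U) (pi : U -> W) (c : R).
Local Notation Sketch := {ffun F -> 'I_(2 ^ M)}.
Local Notation HH := ({ffun U -> 'I_(2 ^ M) * bool} * {ffun W -> 'I_(2 ^ M)})%type.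
Local Notation LL := ({ffun U -> 'I_Q.+1} * {ffun W -> 'I_Q.+1})%type.
Variables (a b : nat) (h : HH) (l : LL) (s : Sketch).

Definition shifted_rho (s : Sketch) x y : R := rho R cut e J s x y + c.

(** [None] counts points regardless of parity; together with the odd counts it determines the even
    ones. *)
Definition counter (z : bool) (v v' : 'I_Q.+1) (o : option 'I_J.+1) : {set V} :=
  [set x | [&& kept pi a b h (u x), (h.1 (u x)).2 == z, l.1 (u x) == v,
    l.2 (pi (u x)) == v' & if o is Some g then par cut (e + g) s x else true]].

Local Notation same_counts X X' := (forall z v v' o,
  #|X :&: counter z v v' o| = #|X' :&: counter z v v' o|).

Let sample_transfer (X X' : {set V}) z x : same_counts X X' ->
  x \in sample u pi a b h z X -> exists x', [/\ x' \in sample u pi a b h z X',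
    l.1 (u x') = l.1 (u x) & l.2 (pi (u x')) = l.2 (pi (u x))].
Proof.
move=> XX; rewrite inE => /and3P[xX kx zx].
have : (0 < #|X :&: counter z (l.1 (u x)) (l.2 (pi (u x))) None|)%N.
  by apply/card_gt0P; exists x; rewrite !inE xX kx zx !eqxx.
rewrite XX => /card_gt0P[x']; rewrite !inE => /and5P[x'X' k' z' /eqP v' /andP[/eqP w' _]].
by exists x'; rewrite inE x'X' k' z'.
Qed.

Let passes_transfer (X X' : {set V}) : same_counts X X' ->
  passes u pi a b h l X -> passes u pi a b h l X'.
Proof.
move=> XX; have XX' : same_counts X' X by move=> z v v' o; rewrite XX.
case/and4P => /set0Pn[x0 x0S] /set0Pn[x1 x1S] /forallP same1 /forall_inP same2.
apply/and4P; split.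
- by have [x [xS _ _]] := sample_transfer XX x0S; apply/set0Pn; exists x.
- by have [x [xS _ _]] := sample_transfer XX x1S; apply/set0Pn; exists x.
- apply/forallP => z; apply/forall_inP => x xS; apply/forall_inP => y yS.
  have [x' [xS' <- _]] := sample_transfer XX' xS.
  have [y' [yS' <- _]] := sample_transfer XX' yS.
  by have /forall_inP/(_ x' xS')/forall_inP/(_ y' yS') := same1 z.
- apply/forall_inP => x xS; apply/forall_inP => y yS.
  have [x' [xS' _ <-]] := sample_transfer XX' xS.
  have [y' [yS' _ <-]] := sample_transfer XX' yS.
  by have /forall_inP/(_ y' yS') := same2 x' xS'.
Qed.

Let size_sample (X : {set V}) z (o : option 'I_J.+1) :
  #|[set x in sample u pi a b h z X | if o is Some g then par cut (e + g) s x else true]| =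
  (\sum_v \sum_v' #|X :&: counter z v v' o|)%N.
Proof.
set S := [set x in _ | _].
under eq_bigr => v _ do under eq_bigr => v' _ do rewrite -sum1_card.
rewrite -sum1_card (partition_big (fun x => l.1 (u x)) xpredT) //=.
apply: eq_bigr => v _; rewrite (partition_big (fun x => l.2 (pi (u x))) xpredT) //=.
apply: eq_bigr => v' _; apply: eq_bigl => x; rewrite !inE.
case: (x \in X) => //=; case: (kept _ _ _ _ _) => //=; case: (_ == z) => //=.
by case: (l.1 (u x) == v); case: (l.2 (pi (u x)) == v'); rewrite /= ?andbT ?andbF.
Qed.

(** Pairs of different parity are counted by a product formula, so sizes and numbers of odd points
    suffice. *)
Let mean_rhoE (X : {set V}) :
  let n z := #|sample u pi a b h z X|%:R in
  let k z g := #|[set x in sample u pi a b h z X | par cut (e + g) s x]|%:R in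
  mean (shifted_rho s) (sample u pi a b h true X) (sample u pi a b h false X) =
  (\sum_(g < J.+1) 2 ^+ (e + g) * (k true g * (n false - k false g) +
       (n true - k true g) * k false g) + c * (n true * n false)) / (n true * n false) :> R.
Proof.
move=> n k; rewrite /mean; congr (_ / _).
set A := sample u pi a b h true X; set B := sample u pi a b h false X.
have -> : \sum_(x in A) \sum_(y in B) shifted_rho s x y =
    \sum_(x in A) \sum_(y in B) rho R cut e J s x y + \sum_(x in A) \sum_(y in B) c.
  by rewrite -big_split; apply: eq_bigr => x _; rewrite -big_split.
congr (_ + _); last first.
  by rewrite !sumr_const -mulrnA -[_ *+ _]mulr_natr mulnC natrM.
transitivity (\sum_(g < J.+1) 2 ^+ (e + g) *
   \sum_(x in A) \sum_(y in B) (par cut (e + g) s x != par cut (e + g) s y)%:R : R).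
  under eq_bigr => x _ do rewrite exchange_big /=.
  rewrite exchange_big /=; apply: eq_bigr => g _; rewrite mulr_sumr.
  by apply: eq_bigr => x _; rewrite mulr_sumr.
apply: eq_bigr => g _; congr (_ * _).
set p := par cut (e + g) s.
have cnt (D : {set V}) : \sum_(x in D) (p x)%:R = #|[set x in D | p x]|%:R :> R.
  rewrite -natr_sum -sum1_card; congr _%:R; rewrite [LHS]big_mkcond [RHS]big_mkcond /=.
  by apply: eq_bigr => x _; rewrite inE; case: (x \in D) => //=; case: (p x).
have cntN (D : {set V}) : \sum_(x in D) (~~ p x)%:R = #|D|%:R - #|[set x in D | p x]|%:R :> R.
  rewrite -cnt -sum1_card natr_sum -sumrB; apply: eq_bigr => x _.
  by case: (p x); rewrite ?subrr ?subr0.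
rewrite /n /k -!cntN -!cnt !mulr_suml -big_split; apply: eq_bigr => x _ /=.
rewrite !mulr_sumr -big_split; apply: eq_bigr => y _ /=.
by case: (p x) (p y) => [] []; rewrite /= ?mulr0 ?mul0r ?mulr1 ?mul1r ?addr0 ?add0r.
Qed.

Lemma pair_value_counts (X X' : {set V}) : same_counts X X' ->
  pair_value u pi shifted_rho a b h l s X = pair_value u pi shifted_rho a b h l s X'.
Proof.
move=> XX; have XX' : same_counts X' X by move=> z v v' o; rewrite XX.
rewrite /pair_value; congr (_%:R * _).
  by congr nat_of_bool; apply/idP/idP; apply: passes_transfer.
have sz z o := etrans (size_sample X z o) (etrans
  (eq_bigr _ (fun v _ => eq_bigr _ (fun v' _ => XX z v v' o))) (esym (size_sample X' z o))).
have n z : #|sample u pi a b h z X| = #|sample u pi a b h z X'|.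
  have := sz z None; have E (Y : {set V}) : [set x in sample u pi a b h z Y | true] = sample u pi a b h z Y.
    by apply/setP => x; rewrite !inE andbT.
  by rewrite !E.
have k z (g : 'I_J.+1) := sz z (Some g).
rewrite !mean_rhoE !n; congr ((_ + _) / _); apply: eq_bigr => g _.
by rewrite !k.
Qed.

End Counts.

(** * One run of the algorithm *)

Section Run.
Variables (R : realType) (V F : finType) (cut : F -> V -> bool).
Variables (M Q e0 J L T R0 : nat) (c0 : R).
Local Notation Omega := {ffun F -> 'I_(2 ^ M)}.
Local Notation U := {set V}.
Local Notation HH := ({ffun U -> 'I_(2 ^ M) * bool} * {ffun U -> 'I_(2 ^ M)})%type.
Local Notation LL := ({ffun U -> 'I_Q.+1} * {ffun U -> 'I_Q.+1})%type.
Local Notation Shot := (HH * (LL * {ffun F -> 'I_(2 ^ M)}))%type.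
Local Notation Run := (Omega * {ffun 'I_R0.+1 -> Shot})%type.
Local Notation t i := (2 ^+ (e0 + i) : R).
Implicit Types (w : Omega) (X : {set V}).

(** Cells serve as their own labels; hash values for all sets of points belong to the free
    randomness. *)
Definition lvl w i : V -> U := cell cut (e0 + i) w.
Definition up w i : U -> U := parent cut (e0 + i).+1 w.

Definition shot_estimate w (i j : nat) X (s : Shot) : R :=
  estimate (lvl w i) (up w i) (shifted_rho cut (e0 + i) J (c0 * t i)) j X s.

Definition shot_mean (o : Run) (i j : nat) X : R :=
  (\sum_r shot_estimate o.1 i j X (o.2 r)) / R0.+1%:R.

(* The penalty [2 ^+ j * t i] dominates the sampling error at rate [2 ^- j], so
   that the maximum over all rates needs no estimate of the number of cells. *)
Definition level_value (o : Run) (i : nat) X : R :=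
  \big[Num.max/0]_(j < T) (shot_mean o i j X - 2 ^+ j * t i).

Definition run_value (o : Run) X : R := \sum_(i < L) level_value o i X.

Definition level_cost w (i : nat) X : R :=
  sibling_cost X (lvl w i) (up w i) (fun x y => rho_bar R cut M (e0 + i) J x y + c0 * t i).

Definition cells w i X : nat := #|labels X (lvl w i)|.

(** For [j < T] both rates [a] and [j - a] lie below [T], so the counters are shared by all values
    of [j]. *)
Definition counter_index : finType :=
  ('I_R0.+1 * 'I_L * ('I_T * 'I_T) * (bool * 'I_Q.+1 * 'I_Q.+1 * option 'I_J.+1))%type.

Definition run_counter (o : Run) (k : counter_index) : {set V} :=
  let: (r, i, (a, b), (z, v, v', g)) := k in
  counter cut (e0 + i) (lvl o.1 i) (up o.1 i) a b (o.2 r).1 (o.2 r).2.1 (o.2 r).2.2 z v v' g.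

Lemma run_value_counts (o : Run) (X X' : {set V}) :
  (forall k, #|X :&: run_counter o k| = #|X' :&: run_counter o k|) ->
  run_value o X = run_value o X'.
Proof.
move=> XX; apply: eq_bigr => i _; apply: eq_bigr => j _; congr (_ / _ - _).
apply: eq_bigr => r _; rewrite /shot_estimate /estimate; congr (_ * _).
apply: eq_bigr => a _; apply: pair_value_counts => z v v' g.
have aT : (a < T)%N by have := ltn_ord a; have := ltn_ord j; lia.
have bT : (j - a < T)%N by have := ltn_ord j; lia.
exact: (XX (r, i, (Ordinal aT, Ordinal bT), (z, v, v', g))).
Qed.

Section Fixed.
Variable X : {set V}.
Hypotheses (X0 : X != finset.set0) (c00 : 1 <= c0).
Hypotheses (e00 : (0 < e0)%N) (eM : (e0 + L + J <= M)%N) (TM : (T <= M)%N).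
Hypothesis XT : (16 * #|X| < 2 ^ T)%N.
Local Notation range := (2 * 2 ^+ J + c0).

Let t0 i : 0 < t i.
Proof. by rewrite exprn_gt0. Qed.

Let range0 : 0 <= range.
Proof. by have := exprn_ge0 J (ler0n R 2); have := c00; lra. Qed.

Lemma lvl_up w i : up w i \o lvl w i = lvl w i.+1.
Proof. by apply/funext => x; rewrite /up /lvl /= parent_cell addnS. Qed.

Let shifted_rho_bounds i (s : Omega) x y :
  0 <= shifted_rho cut (e0 + i) J (c0 * t i) s x y <= range * t i.
Proof.
rewrite /shifted_rho addr_ge0 ?rho_ge0 ?mulr_ge0 ?exprn_ge0 //=; last by have := c00; lra.
by rewrite mulrDl lerD // rho_le.
Qed.

Let Ex_shifted_rho i : (fun x y => Ex (fun s : Omega => shifted_rho cut (e0 + i) J (c0 * t i) s x y)) =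
  (fun x y => rho_bar R cut M (e0 + i) J x y + c0 * t i).
Proof.
apply/funext => x; apply/funext => y; rewrite ExD Ex_const //.
by rewrite card_ffun card_ord !expn_gt0.
Qed.

Lemma shot_estimate_bounds w i j (s : Shot) :
  0 <= shot_estimate w i j X s <= 2 ^+ j * (j.+1%:R * (range * t i)).
Proof.
apply: estimate_bounds => [|s' x y|s' x y]; first by rewrite mulr_ge0 ?(ltW (t0 i)).
  by case/andP: (shifted_rho_bounds i s' x y).
by case/andP: (shifted_rho_bounds i s' x y).
Qed.

Lemma cells_le w i : (cells w i X <= #|X|)%N.
Proof. exact: leq_imset_card. Qed.

Lemma cells_gt0 w i : (0 < cells w i X)%N.
Proof. by case/set0Pn: X0 => x xX; apply/card_gt0P; exists (lvl w i x); apply: imset_f. Qed.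

Lemma level_cost_ge0 w i : 0 <= level_cost w i X.
Proof.
apply: sibling_cost_ge0 => x y; rewrite addr_ge0 ?rho_bar_ge0 ?mulr_ge0 ?exprn_ge0 //.
by have := c00; lra.
Qed.

Definition good_shots w (z : {ffun 'I_R0.+1 -> Shot}) : bool :=
  [forall i : 'I_L, forall j : 'I_T,
    `|shot_mean (w, z) i j X - Ex (shot_estimate w i j X)| < 2 ^+ j * t i / 4].

(** The range of a shot and the tolerated error are both proportional to [2 ^ j * t i], so the
    number of shots needed by Chebyshev is free of [2 ^ j]; the factor [L * T] pays for the union
    bound. *)
Lemma Pr_bad_shots w :
  200 * L%:R * T%:R * (4 * T%:R * range) ^+ 2 <= R0.+1%:R ->
  Pr R (fun z => ~~ good_shots w z) <= 1 / 200.
Proof.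
move=> hR.
have Sh0 : (0 < #|{: Shot}|)%N.
  by rewrite !card_prod !card_ffun !card_prod !card_ord card_bool !(muln_gt0, expn_gt0).
have R00 : 0 < R0.+1%:R :> R by rewrite ltr0n.
pose bad (ij : 'I_L * 'I_T) (z : {ffun 'I_R0.+1 -> Shot}) : bool :=
  2 ^+ ij.2 * t ij.1 / 4 <= `|shot_mean (w, z) ij.1 ij.2 X - Ex (shot_estimate w ij.1 ij.2 X)|.
apply: (@le_trans _ _ (\sum_(ij : 'I_L * 'I_T) Pr R (bad ij))).
  apply: le_trans (Pr_exists R xpredT bad); apply: le_Pr => z.
  move=> /forallPn[i /forallPn[j]]; rewrite -leNgt => le.
  by apply/existsP; exists (i, j).
apply: (@le_trans _ _ (\sum_(ij : 'I_L * 'I_T) (4 * T%:R * range) ^+ 2 / R0.+1%:R)).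
  apply: ler_sum => -[i j] _; rewrite /bad /=.
  have x0 : 0 < (2 : R) ^+ j by rewrite exprn_gt0.
  have a0 : 0 < 2 ^+ j * t i / 4 by rewrite divr_gt0 // mulr_gt0.
  have B0 : 0 <= 2 ^+ j * (j.+1%:R * (range * t i)).
    by rewrite mulr_ge0 ?(ltW x0) // mulr_ge0 // mulr_ge0 // ltW.
  apply: le_trans (chebyshev R0 B0 a0 Sh0 (shot_estimate_bounds w i j)) _.
  rewrite [leLHS](_ : _ = (4 * j.+1%:R * range) ^+ 2 / R0.+1%:R); last first.
    have := gt_eqF x0; have := gt_eqF (t0 i); have := gt_eqF R00.
    move: (2 ^+ j) (t i) R0.+1%:R j.+1%:R range => {}x y r m B /negbT r0 /negbT y0 /negbT x0'.
    by field; rewrite r0 y0 x0'.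
  rewrite ler_wpM2r ?invr_ge0 ?(ltW R00) // lerXn2r ?nnegrE ?mulr_ge0 //.
  by rewrite ler_wpM2r // ler_wpM2l // ler_nat.
rewrite sumr_const card_prod !card_ord -[_ *+ _]mulr_natl mulrA ler_pdivrMr //.
by rewrite natrM; lra.
Qed.

Hypothesis hQ : 2 * T%:R * range <= Q.+1%:R.

Lemma level_value_le w z i : (i < L)%N -> good_shots w z ->
  level_value (w, z) i X <= level_cost w i X.
Proof.
move=> iL /forallP/(_ (Ordinal iL))/forallP gz; apply/bigmax_leP; split=> [|j _].
  exact: level_cost_ge0.
have := gz j; rewrite /= ltr_norml => /andP[_ up1].
have jM : (j <= M)%N by have := ltn_ord j; lia.
have B0 : 0 <= range * t i by rewrite mulr_ge0 // ltW.
have := @estimate_upper R V U U Omega (lvl w i) (up w i) M Q _ _ B0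
  (fun s x y => (andP (shifted_rho_bounds i s x y)).1)
  (fun s x y => (andP (shifted_rho_bounds i s x y)).2) X j jM.
rewrite Ex_shifted_rho -/(level_cost w i X) => up2.
have x0 : 0 < (2 : R) ^+ j by rewrite exprn_gt0.
have Q0 : 0 < Q.+1%:R :> R by rewrite ltr0n.
(* False positives use at most half of the penalty and the sampling error at most a quarter, so the
   penalised mean stays below the cost. *)
have false_pos : 2 ^+ j * (j.+1%:R * (range * t i / Q.+1%:R)) <= 2 ^+ j * (t i / 2).
  rewrite ler_wpM2l ?(ltW x0) // mulrA ler_pdivrMr //.
  have jT : j.+1%:R <= T%:R :> R by rewrite ler_nat.
  have : j.+1%:R * range <= T%:R * range by rewrite ler_wpM2r.
  have := t0 i; move: (t i) => ti ti0 jr.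
  rewrite mulrA [leRHS](_ : _ = (Q.+1%:R / 2) * ti); last by field.
  by rewrite ler_wpM2r ?(ltW ti0) //; have := hQ; lra.
move: up1 up2 false_pos; rewrite /shot_mean /=.
set s := Ex _; set s' := _ / R0.+1%:R; set fp := 2 ^+ j * (_ * _).
have -> : 2 ^+ j * (t i / 2) = 2 ^+ j * t i / 2 by rewrite mulrA.
have := mulr_gt0 x0 (t0 i); move: (2 ^+ j * t i) => y y0.
by rewrite -/s => *; lra.
Qed.

Lemma level_cost_single w i : (cells w i X <= 1)%N -> level_cost w i X = 0.
Proof.
move=> N1; rewrite /level_cost /sibling_cost big1 // => a aC.
rewrite big1 ?mul0r // => b /andP[]; rewrite inE => /andP[bC _].
by have /card_le1_eqP/(_ b a bC aC) -> := N1; rewrite eqxx.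
Qed.

Lemma level_value_ge0 (o : Run) i : 0 <= level_value o i X.
Proof.
exact: bigmax_ge_id.
Qed.

Lemma level_value_ge w z i : (i < L)%N -> good_shots w z ->
  level_cost w i X / 64 - 40 * ((cells w i X)%:R - 1) * t i <= level_value (w, z) i X.
Proof.
move=> iL /forallP/(_ (Ordinal iL))/forallP gz.
have [N1|N1] := leqP (cells w i X) 1.
  rewrite level_cost_single // mul0r sub0r.
  have -> : cells w i X = 1%N by apply/eqP; rewrite eqn_leq N1 cells_gt0.
  by rewrite subrr mulr0 mul0r oppr0 level_value_ge0.
set N := cells w i X in N1 *.
(* The right rate for [N] cells. Penalty and sampling error amount to [5 / 4 * 2 ^ j <= 20 * N]
   times the scale, and [N <= 2 * (N - 1)] as [N >= 2]: hence the 40. *)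
have [j [Nj jN]] : exists j, (8 * N < 2 ^ j)%N /\ (2 ^ j <= 16 * N)%N.
  exists (trunc_log 2 (8 * N)).+1; split; first exact: trunc_log_ltn.
  have : (2 ^ trunc_log 2 (8 * N) <= 8 * N)%N by apply: trunc_logP => //; lia.
  by rewrite expnS; lia.
have jT : (j < T)%N.
  by rewrite -(@ltn_exp2l 2) //; apply: leq_ltn_trans XT; have := cells_le w i; rewrite -/N; lia.
have := gz (Ordinal jT); rewrite /= ltr_norml => /andP[lo1 _].
have jM : (j <= M)%N by lia.
have B0 : 0 <= range * t i by rewrite mulr_ge0 // ltW.
have := @estimate_lower R V U U Omega (lvl w i) (up w i) M Q _ _ B0
  (fun s x y => (andP (shifted_rho_bounds i s x y)).1)
  (fun s x y => (andP (shifted_rho_bounds i s x y)).2) X j jM (ltnW Nj).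
rewrite Ex_shifted_rho -/(level_cost w i X) => lo2.
apply: (@le_trans _ _ (shot_mean (w, z) i j X - 2 ^+ j * t i)); last first.
  rewrite /level_value.
  exact: (le_bigmax 0 (fun j0 : 'I_T => shot_mean (w, z) i j0 X - 2 ^+ j0 * t i) (Ordinal jT)).
have x16 : (2 : R) ^+ j <= 16 * N%:R by rewrite -natrX -natrM ler_nat.
have N2 : 2 <= N%:R :> R by rewrite ler_nat.
have : 2 ^+ j * t i <= 32 * (N%:R - 1) * t i.
  apply: ler_wpM2r; first exact: ltW.
  by move: (2 ^+ j) (N%:R) x16 N2 => *; lra.
move: lo1 lo2; rewrite /shot_mean /= -/(shot_estimate w i j X).
set s := Ex _; set s' := _ / R0.+1%:R => lo1 lo2.
have -> : 40 * (N%:R - 1) * t i = 32 * (N%:R - 1) * t i * (5 / 4) by field.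
by move: (32 * _ * t i) (2 ^+ j * t i) lo1 => y y'; lra.
Qed.

Lemma level_cost_ge_cells w i :
  c0 * t i * ((cells w i X)%:R - (cells w i.+1 X)%:R) <= level_cost w i X.
Proof.
rewrite /cells -lvl_up -sibling_cost_const /level_cost.
by apply: sibling_cost_le => x y _ _ _ _; rewrite lerDr rho_bar_ge0.
Qed.

(* The subtracted terms telescope against the constant part [c0 * t i] of the
   costs. *)
Lemma run_value_ge w z : 10240 <= c0 -> cells w L X = 1%N -> good_shots w z ->
  (\sum_(i < L) level_cost w i X) / 128 <= run_value (w, z) X.
Proof.
move=> c1 NL gz; pose x i : R := (cells w i X)%:R - 1.
have x0 : 0 <= x 0%N by rewrite subr_ge0 ler1n cells_gt0.
have xL : x L = 0 by rewrite /x NL subrr.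
have := sum_level_abel e0 x0 xL.
(* [10240 = 128 * 80]: by summation by parts the subtracted terms are at most 80 times this sum,
   hence at most [1 / 128] of the costs, out of [1 / 64]. *)
have : 10240 * (\sum_(i < L) t i * (x i - x i.+1)) <= \sum_(i < L) level_cost w i X.
  rewrite mulr_sumr; apply: ler_sum => i _.
  apply: le_trans (level_cost_ge_cells w i).
  have -> : x i - x i.+1 = (cells w i X)%:R - (cells w i.+1 X)%:R by rewrite /x; ring.
  have N0 : 0 <= (cells w i X)%:R - (cells w i.+1 X)%:R :> R.
    rewrite subr_ge0 ler_nat /cells -lvl_up.
    have -> : labels X (up w i \o lvl w i) = [set up w i a | a in labels X (lvl w i)].
      by rewrite /labels -imset_comp.
    exact: leq_imset_card.
  rewrite -!mulrA; apply: ler_pM => //.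
  by rewrite mulr_ge0 // ltW.
have : \sum_(i < L) (level_cost w i X / 64 - 40 * (t i * x i)) <= run_value (w, z) X.
  apply: ler_sum => i _; apply: le_trans (level_value_ge (ltn_ord i) gz).
  by rewrite lerD2l lerN2 /x [t i * _]mulrC mulrA.
rewrite sumrB -mulr_suml -mulr_sumr.
set S1 := \sum_(_ < _) _; set S2 := \sum_(_ < _) _; set S3 := \sum_(_ < _) _ * (_ - _).
by lra.
Qed.

Lemma run_value_le w z : good_shots w z ->
  run_value (w, z) X <= \sum_(i < L) level_cost w i X.
Proof. by move=> gz; apply: ler_sum => i _; apply: level_value_le. Qed.

End Fixed.
End Run.

(** * Level costs against the Hamming length of a tree *)

Section TreeCuts.
Variables (R : realType) (V F : finType) (cut : F -> V -> bool) (M : nat).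
Variables (X : {set V}) (E : {set V * V}).
Hypotheses (cE : connected_on X E).
Hypothesis XE : forall x y, (x, y) \in E -> (x \in X) && (y \in X).

Definition tree_ham : nat := (\sum_(e in E) ham cut e.1 e.2)%N.

(** Used in contrapositive form: whatever separates two points of [X] separates the ends of some
    edge. *)
Lemma cut_edge (P : rel V) : reflexive P -> symmetric P -> transitive P ->
  (forall e, e \in E -> P e.1 e.2) -> forall x y, x \in X -> y \in X -> P x y.
Proof.
move=> Pr Ps Pt edge x y xX yX; have /connectP[l + ->] := cE xX yX.
elim: l x {xX} => //= v l IHl x /andP[xv /IHl]; apply: Pt.
by case/orP: xv => [/edge//|/edge]; rewrite Ps.
Qed.

Lemma ham_sum x y : ham cut x y = (\sum_f (cut f x != cut f y))%N.
Proof.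
rewrite /ham -sum1_card big_mkcond /=; apply: eq_bigr => f _.
by rewrite inE; case: (_ != _).
Qed.

Lemma ham_le_tree x y : x \in X -> y \in X -> (ham cut x y <= tree_ham)%N.
Proof.
move=> xX yX; rewrite ham_sum /tree_ham.
under [leqRHS]eq_bigr => e _ do rewrite ham_sum.
rewrite exchange_big /=; apply: leq_sum => f _.
case: (boolP [exists e in E, cut f e.1 != cut f e.2]) => [/exists_inP[e eE ce]|nE].
  by rewrite (bigD1 e) //= ce; apply: leq_trans (leq_addr _ _); case: (_ != _).
have -> // : cut f x = cut f y; last by rewrite eqxx.
pose P a b := cut f a == cut f b.
have Pref : reflexive P by move=> a; rewrite /P.
have Psym : symmetric P by move=> a b; rewrite /P eq_sym.
have Ptr : transitive P by move=> b a c /eqP ab; rewrite /P ab.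
apply/eqP/(cut_edge Pref Psym Ptr) => // e eE.
by apply: contraNT nE => ce; apply/exists_inP; exists e.
Qed.

Lemma Pr_split_level e : (e <= M)%N ->
  Pr R (fun w : {ffun F -> 'I_(2 ^ M)} => (1 < #|labels X (cell cut e w)|)%N) <=
    tree_ham%:R / 2 ^+ e.
Proof.
move=> eM; rewrite natr_sum mulr_suml.
apply: (@le_trans _ _ (\sum_(a in E) Pr R (fun w : {ffun F -> 'I_(2 ^ M)} =>
    ~~ same cut [set: F] e w a.1 a.2))); last first.
  by apply: ler_sum => a _; rewrite -hamAT Pr_not_same_le.
apply: le_trans (Pr_exists R (fun a => a \in E) (fun a (w : {ffun F -> 'I_(2 ^ M)}) =>
  ~~ same cut [set: F] e w a.1 a.2)); apply: le_Pr => w.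
apply: contraTT => /existsPn nE; rewrite -leqNgt; apply/card_le1_eqP.
move=> _ _ /imsetP[x xX ->] /imsetP[y yX ->]; apply/eqP; rewrite cell_eq.
apply: (@cut_edge (same cut [set: F] e w)) => //.
- exact: same_refl.
- by move=> a b; rewrite same_sym.
- by move=> b a c; apply: same_trans.
- by move=> a aE; have := nE a; rewrite aE /= negbK.
Qed.

Lemma Pr_merge_level e (r : R) : (e <= M)%N ->
  (forall x y, x \in X -> y \in X -> x != y -> r <= (ham cut x y)%:R / 2 ^+ e) ->
  Pr R (fun w : {ffun F -> 'I_(2 ^ M)} => ~~ [forall x in X, forall y in X,
    same cut [set: F] e w x y ==> (x == y)]) <= #|X|%:R ^+ 2 * expR (- r).
Proof.
move=> eM far; pose P (xy : V * V) := [&& xy.1 \in X, xy.2 \in X & xy.1 != xy.2].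
apply: (@le_trans _ _ (\sum_(xy | P xy) Pr R (fun w : {ffun F -> 'I_(2 ^ M)} =>
    same cut [set: F] e w xy.1 xy.2))).
  apply: le_trans (Pr_exists R P (fun xy (w : {ffun F -> 'I_(2 ^ M)}) =>
    same cut [set: F] e w xy.1 xy.2)); apply: le_Pr => w.
  move=> /forall_inPn[x xX /forall_inPn[y yX]]; rewrite negb_imply => /andP[s xy].
  by apply/existsP; exists (x, y); rewrite /P /= xX yX xy.
apply: (@le_trans _ _ (\sum_(xy | P xy) expR (- r))).
  apply: ler_sum => -[x y] /and3P[/= xX yX xy].
  apply: le_trans (Pr_same_le R cut [set: F] x y eM) _.
  by rewrite hamAT ler_expR lerN2 far.
rewrite sumr_const -[_ *+ _]mulr_natl ler_wpM2r ?expR_ge0 // -natrX ler_nat.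
rewrite -[(_ ^ 2)%N]/(#|X| * #|X|)%N -cardsX; apply/subset_leq_card/fintype.subsetP => -[x y].
by rewrite !inE => /and3P[/= -> ->].
Qed.

Section Levels.
Variables (e0 J L : nat) (c0 : R).
Hypotheses (c00 : 1 <= c0) (e00 : (0 < e0)%N) (Je : (J <= e0)%N).
Hypothesis eM : (e0 + L + J <= M)%N.
Local Notation Omega := {ffun F -> 'I_(2 ^ M)}.
Local Notation t i := (2 ^+ (e0 + i) : R).
Local Notation K := (2 ^+ J : R).
Local Notation cost w i := (level_cost cut (M := M) e0 J c0 w i X).

Let t0 i : 0 < t i.
Proof. by rewrite exprn_gt0. Qed.

Let W0 : (0 < #|{: Omega}|)%N.
Proof. by rewrite card_ffun card_ord !expn_gt0. Qed.

Lemma level_cost_small w i : cost w i <= #|X|%:R * ((2 * K + c0) * t i).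
Proof.
apply: (@le_trans _ _ (#|labels X (lvl cut e0 w i)|%:R * ((2 * K + c0) * t i))).
  have B0 : 0 <= (2 * K + c0) * t i.
    by rewrite mulr_ge0 ?(ltW (t0 i)) //; have := exprn_ge0 J (ler0n R 2); have := c00; lra.
  apply: sibling_cost_le_card => // x y; apply/andP; split.
    rewrite addr_ge0 ?rho_bar_ge0 ?mulr_ge0 ?exprn_ge0 //; have := c00; lra.
  rewrite mulrDl lerD2r; apply: Ex_le_const => [|s]; last exact: rho_le.
  by rewrite !mulr_ge0 ?exprn_ge0.
rewrite ler_wpM2r ?ler_nat ?leq_imset_card // mulr_ge0 ?(ltW (t0 i)) //.
by have := exprn_ge0 J (ler0n R 2); have := c00; lra.
Qed.

Lemma sum_level_cost_small w m :
  \sum_(i < m) cost w i <= #|X|%:R * ((2 * K + c0) * t m).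
Proof.
have c1 : 0 <= (2 * K + c0).
  by have := exprn_ge0 J (ler0n R 2); have := c00; lra.
elim: m => [|m IHm].
  by rewrite big_ord0 !mulr_ge0 ?(ltW (t0 0)).
rewrite big_ord_recr /= addnS exprS.
have -> : #|X|%:R * ((2 * K + c0) * (2 * t m)) =
  #|X|%:R * ((2 * K + c0) * t m) + #|X|%:R * ((2 * K + c0) * t m) by ring.
by apply: lerD => //; apply: level_cost_small.
Qed.

Let term (w : Omega) i z z' : R := (~~ same cut [set: F] (e0 + i) w z z')%:R *
  (J.+1%:R * (mean_dist R cut [set: F] (e0 + i) w X z +
              mean_dist R cut [set: F] (e0 + i).+1 w X z) + 2 * (c0 * t i)).

Lemma level_cost_edges w i : (i < L)%N ->
  cost w i <= 2 * \sum_(e in E) (term w i e.1 e.2 + term w i e.2 e.1).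
Proof.
move=> iL; pose g x y : R := J.+1%:R * (ham cut x y)%:R + c0 * t i.
have ct0 : 0 <= c0 * t i by rewrite mulr_ge0 ?(ltW (t0 i)) //; have := c00; lra.
have g0 x y : 0 <= g x y by rewrite addr_ge0 // mulr_ge0.
have gC x y : g x y = g y x by rewrite /g -!hamAT hamAC.
have g_tri x y z : g x z <= g x y + g y z.
  have : (ham cut x z)%:R <= (ham cut x y)%:R + (ham cut y z)%:R :> R.
    by rewrite -natrD ler_nat -!hamAT hamA_triangle.
  move=> /(ler_wpM2l (ler0n R J.+1)); rewrite /g mulrDr.
  by move: (c0 * t i) ct0 => c ct0 *; lra.
apply: (@le_trans _ _ (sibling_cost X (lvl cut e0 w i) (up cut e0 w i) g)).
  apply: sibling_cost_le => x y _ _ _ _; rewrite lerD2r rho_bar_le //; have := eM; lia.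
apply: le_trans (sibling_cost_le_edges (lvl cut e0 w i) (up cut e0 w i) g0 gC g_tri cE XE) _.
rewrite ler_wpM2l //; apply: ler_sum => a aE.
have spreadE (k : nat) z : z \in X ->
    (\sum_(y in fiber X (cell cut k w) (cell cut k w z)) g z y) /
      #|fiber X (cell cut k w) (cell cut k w z)|%:R =
    J.+1%:R * mean_dist R cut [set: F] k w X z + c0 * t i.
  move=> zX; have fE : fiber X (cell cut k w) (cell cut k w z) = near cut [set: F] k w X z.
    by apply/setP => y; rewrite !inE cell_eq same_sym.
  rewrite fE /mean_dist /g big_split /= sumr_const mulrDl -[X in _ + X / _]mulr_natr.
  rewrite mulfK; last by rewrite pnatr_eq0 -lt0n near_gt0.
  rewrite -mulr_sumr mulrA; congr (_ * _ / _ + _).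
  by apply: eq_bigr => y _; rewrite hamAT.
have /andP[X1 X2] : (a.1 \in X) && (a.2 \in X) by apply: XE; rewrite -surjective_pairing.
have lvlE z z' : lvl cut e0 w i z != lvl cut e0 w i z' = ~~ same cut [set: F] (e0 + i) w z z'.
  by rewrite cell_eq.
rewrite !lvlE /term lvl_up /lvl addnS !spreadE // le_eqVlt; apply/orP; left; apply/eqP.
by congr (_ * _ + _ * _); ring.
Qed.

(** The 4 is 2 for the detour through the parent times 2 for the ends of an edge; [J.+1] is the
    distortion of the sketch, and the last term comes from the shift by [c0]. *)
Definition mid_const (n N : nat) : R :=
  4 * (J.+1%:R * (6 * level_bound R n J N + 2 * n%:R) + 2 * c0 * n%:R).

Lemma Ex_mid_levels ia n : (ia + n <= L)%N ->
  #|X|%:R * expR (- (K / 2)) <= 1 :> R ->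
  Ex (fun w => \sum_(k < n) cost w (ia + k)) <= mid_const n #|X| * tree_ham%:R.
Proof.
move=> inL small.
pose md e (w : Omega) z := mean_dist R cut [set: F] e w X z.
pose ns k (w : Omega) z z' : R := (~~ same cut [set: F] (e0 + ia + k) w z z')%:R.
pose G := J.+1%:R * (6 * level_bound R n J #|X| + 2 * n%:R) + 2 * c0 * n%:R.
have edge z z' : z \in X -> \sum_(k < n) Ex (fun w => term w (ia + k) z z') <= (ham cut z z')%:R * G.
  move=> zX.
  have term_E (k : 'I_n) : Ex (fun w => term w (ia + k) z z') =
      J.+1%:R * Ex (fun w => ns k w z z' * (md (e0 + ia + k)%N w z + md (e0 + ia + k).+1 w z)) +
      2 * c0 * (2 ^+ (e0 + ia + k) * Ex (fun w => ns k w z z')).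
    rewrite -!ExZl -ExD; apply: eq_Ex => w; rewrite /term /ns /md addnA; ring.
  rewrite (eq_bigr _ (fun k _ => term_E k)) big_split /= -!mulr_sumr.
  have an : (e0 + ia + n <= M)%N by have := eM; lia.
  have Ja : (J <= e0 + ia)%N by have := Je; lia.
  have h1 := @cut_edge_level_sum R V F cut M X z zX z' (e0 + ia) n J #|X| (leqnn _) Ja an small.
  have h2 : \sum_(k < n) 2 ^+ (e0 + ia + k) * Ex (fun w => ns k w z z') <=
      (ham cut z z')%:R * n%:R.
    have -> : (ham cut z z')%:R * n%:R = \sum_(k < n) (ham cut z z')%:R :> R.
      by rewrite sumr_const card_ord mulr_natr.
    apply: ler_sum => k _.
    have kM : (e0 + ia + k <= M)%N by have := ltn_ord k; lia.
    rewrite mulrC -ler_pdivlMr ?exprn_gt0 // -hamAT.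
    exact: Pr_not_same_le.
  have J0 : 0 <= J.+1%:R :> R by [].
  have c2 : 0 <= 2 * c0 by have := c00; lra.
  apply: le_trans (lerD (ler_wpM2l J0 h1) (ler_wpM2l c2 h2)) _.
  by rewrite le_eqVlt; apply/orP; left; apply/eqP; rewrite /G; ring.
rewrite Ex_sum; apply: (@le_trans _ _ (\sum_(k < n) Ex (fun w =>
    2 * \sum_(e in E) (term w (ia + k) e.1 e.2 + term w (ia + k) e.2 e.1)))).
  apply: ler_sum => k _; apply: ler_Ex => w.
  have kL : (ia + k < L)%N by have := ltn_ord k; lia.
  exact: level_cost_edges.
under eq_bigr => k _ do rewrite ExZl Ex_sum.
rewrite -mulr_sumr exchange_big /= /mid_const -/G /tree_ham natr_sum.
apply: (@le_trans _ _ (2 * \sum_(e in E) (2 * ((ham cut e.1 e.2)%:R * G)))); last first.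
  rewrite -!mulr_sumr -mulr_suml le_eqVlt; apply/orP; left; apply/eqP; ring.
rewrite ler_wpM2l //; apply: ler_sum => e eE.
have /andP[X1 X2] : (e.1 \in X) && (e.2 \in X) by apply: XE; rewrite -surjective_pairing.
under eq_bigr => k _ do rewrite ExD.
rewrite big_split /= mulr2n mulrDl !mul1r lerD ?edge //.
have -> : ham cut e.1 e.2 = ham cut e.2 e.1 by rewrite -!hamAT hamAC.
exact: edge.
Qed.

(** What the sketches miss: pairs that share a parent cell although their distance exceeds the range
    of scales. *)
Definition loss (w : Omega) : R := \sum_(x in X) \sum_(y in X) \sum_(i < L)
  (same cut [set: F] (e0 + i).+1 w x y)%:R * excess R cut (e0 + i) J x y.

Lemma loss_ge0 w : 0 <= loss w.
Proof.
apply: sumr_ge0 => x _; apply: sumr_ge0 => y _; apply: sumr_ge0 => i _.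
by rewrite mulr_ge0 // excess_ge0.
Qed.

Lemma Ex_loss : Ex loss <= #|X|%:R ^+ 2 * (8 * tree_ham%:R * expR (- (K / 4))).
Proof.
have eLM : (e0 + L <= M)%N by have := eM; lia.
rewrite Ex_sum expr2 -mulrA mulr_natl -sumr_const; apply: ler_sum => x xX.
rewrite Ex_sum mulr_natl -sumr_const; apply: ler_sum => y yX.
apply: le_trans (Ex_excess R cut J x y eLM) _.
by rewrite ler_wpM2r ?expR_ge0 // ler_wpM2l // ler_nat ham_le_tree.
Qed.

Lemma sum_sibling_excess w :
  \sum_(i < L) sibling_cost X (lvl cut e0 w i) (up cut e0 w i) (excess R cut (e0 + i) J)
    <= loss w.
Proof.
rewrite /loss [leRHS](_ : _ = \sum_(i < L) \sum_(x in X) \sum_(y in X)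
    (same cut [set: F] (e0 + i).+1 w x y)%:R * excess R cut (e0 + i) J x y); last first.
  rewrite [RHS]exchange_big /=; apply: eq_bigr => x _.
  by rewrite [RHS]exchange_big.
apply: ler_sum => i _; apply: le_trans (sibling_cost_le_sum _ _ _ _) _ => [x y|].
  exact: excess_ge0.
apply: ler_sum => x _; apply: ler_sum => y _.
by rewrite /up /lvl !parent_cell cell_eq.
Qed.

End Levels.
End TreeCuts.

(** * Correctness of one run *)

Section RunCorrect.
Variables (R : realType) (p : R) (d Delta : nat) (F : finType).
Local Notation V := (point d Delta).
Local Notation dist := (@point_dist R p d Delta).
Variables (cut : F -> V -> bool) (A C1 : R) (M Q e0 J L T R0 lg : nat) (c0 : R).
Hypotheses (p0 : 0 < p) (A0 : 0 < A) (C11 : 1 <= C1).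
Hypothesis emb : forall x y,
  (A * dist x y <= (ham cut x y)%:R) && ((ham cut x y)%:R <= C1 * (A * dist x y)).
Hypotheses (c00 : 10240 <= c0) (e00 : (0 < e0)%N) (Je : (J <= e0)%N).
Hypotheses (eM : (e0 + L + J <= M)%N) (TM : (T <= M)%N).
Hypothesis eJA : 2 ^+ (e0 + J) <= A.
Local Notation Omega := {ffun F -> 'I_(2 ^ M)}.
Local Notation U := {set V}.
Local Notation HH := ({ffun U -> 'I_(2 ^ M) * bool} * {ffun U -> 'I_(2 ^ M)})%type.
Local Notation LL := ({ffun U -> 'I_Q.+1} * {ffun U -> 'I_Q.+1})%type.
Local Notation Shots := ({ffun 'I_R0.+1 -> HH * (LL * {ffun F -> 'I_(2 ^ M)})})%type.
Local Notation Run := (Omega * Shots)%type.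
Local Notation t i := (2 ^+ (e0 + i) : R).
Local Notation K := (2 ^+ J : R).
Variable X : {set V}.
Hypothesis X2 : (1 < #|X|)%N.
Local Notation n := #|X|.
Local Notation cost w i := (level_cost cut (M := M) e0 J c0 w i X).

Let c01 : 1 <= c0. Proof. by apply: le_trans c00; rewrite ler1n. Qed.

(** [MST_refine] telescopes: at the bottom each cell holds one point and costs nothing, at the top
    one cell is all of [X]. *)
Lemma MST_le_levels (w : Omega) :
  (forall x y, x \in X -> y \in X -> same cut [set: F] e0 w x y -> x = y) ->
  cells cut e0 w L X = 1%N ->
  MST p X <= \sum_(i < L) sibling_cost X (lvl cut e0 w i) (up cut e0 w i) dist.
Proof.
move=> sep one; pose S i := \sum_(a in labels X (lvl cut e0 w i)) MST p (fiber X (lvl cut e0 w i) a).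
have S0 : S 0%N = 0.
  rewrite /S big1 // => a _; apply: MST_small; apply/card_le1_eqP => x y.
  rewrite !inE => /andP[xX /eqP xa] /andP[yX /eqP ya]; apply: sep => //.
  by rewrite -cell_eq -[e0]addn0 -!/(lvl cut e0 w 0 _) xa ya.
have SL : S L = MST p X.
  have [a aE] : exists a, labels X (lvl cut e0 w L) = [set a].
    by apply/cards1P; rewrite -/(cells cut e0 w L X) one.
  rewrite /S aE finset.big_set1; congr (MST p _); apply/setP => x; rewrite inE.
  case: (boolP (x \in X)) => //= xX; apply/eqP/set1P.
  by rewrite -aE; apply: imset_f.
rewrite -SL; elim: (L) => [|m IHm]; first by rewrite S0 big_ord0.
rewrite big_ord_recr /=; apply: le_trans (lerD IHm (lexx _)).
have := MST_refine p X (lvl cut e0 w m) (up cut e0 w m).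
by rewrite lvl_up.
Qed.

Lemma cost_ge_MST (w : Omega) :
  (forall x y, x \in X -> y \in X -> same cut [set: F] e0 w x y -> x = y) ->
  cells cut e0 w L X = 1%N ->
  A * MST p X <= 4 * \sum_(i < L) cost w i + loss R cut X e0 J L w.
Proof.
move=> sep one; apply: le_trans (ler_wpM2l (ltW A0) (MST_le_levels sep one)) _.
apply: (@le_trans _ _ (\sum_(i < L) (4 * cost w i +
    sibling_cost X (lvl cut e0 w i) (up cut e0 w i) (excess R cut (e0 + i) J)))).
  rewrite mulr_sumr; apply: ler_sum => i _; rewrite -!sibling_costZ -sibling_costD.
  apply: sibling_cost_le => x y _ _ _ _.
  have [/andP[lo _] iL] := (emb x y, ltn_ord i).
  apply: le_trans lo _.
  have ei0 : (0 < e0 + i)%N by rewrite addn_gt0 e00.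
  have eiM : (e0 + i + J <= M)%N by apply: leq_trans eM; rewrite leq_add2r leq_add2l ltnW.
  apply: le_trans (ham_le_rho_bar R cut x y ei0 eiM) _; rewrite lerD2r mulrDr lerD2l.
  (* The additive term of the sketch is dominated by the shift, as [c0 >= 1]. *)
  have t0 : 0 <= t i by rewrite exprn_ge0.
  by have := c01; move: (t i) t0 => y0 *; nra.
by rewrite big_split /= -mulr_sumr lerD2l sum_sibling_excess.
Qed.

Variables (E : {set V * V}).
Hypotheses (tE : spanning_tree X E) (costE : MST p X = tree_cost p E).
Local Notation Mh := (tree_ham cut E).

Let cE : connected_on X E. Proof. by case: tE. Qed.

Let XE x y : (x, y) \in E -> (x \in X) && (y \in X).
Proof. by case: tE => sE _ _ /sE[-> ->]. Qed.

Lemma tree_ham_le : Mh%:R <= C1 * (A * MST p X).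
Proof.
rewrite costE /tree_cost !mulr_sumr natr_sum; apply: ler_sum => e _.
by case/andP: (emb e.1 e.2).
Qed.

(** The scale [A] is so large that even neighbouring grid points differ in [2 ^ (e0 + J)] cuts;
    hence the bottom level is likely to separate all points. *)
Let far x y : x != y -> 2 ^+ (e0 + J) <= (ham cut x y)%:R :> R.
Proof.
move=> xy; apply: le_trans eJA _; have /andP[lo _] := emb x y; apply: le_trans lo.
by rewrite ler_peMr ?(ltW A0) // point_dist_ge1.
Qed.

Lemma tree_ham_ge : (2 ^ (e0 + J) <= Mh)%N.
Proof.
have [x [y [xX yX xy]]] := card_gt1P X2; rewrite -(ler_nat R) natrX.
by apply: le_trans (far xy) _; rewrite ler_nat (ham_le_tree cut cE).
Qed.

Hypothesis nlg : (n < 2 ^ lg.+1)%N.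
Hypothesis nT : (16 * n < 2 ^ T)%N.
Hypothesis hQ : 2 * T%:R * (2 * K + c0) <= Q.+1%:R.
Hypothesis hR : 200 * L%:R * T%:R * (4 * T%:R * (2 * K + c0)) ^+ 2 <= R0.+1%:R.
Hypothesis hL : (512 * Mh <= 2 ^ (e0 + L))%N.
Hypothesis hK : 3200 * (C1 * n%:R ^+ 2) * expR (- (K / 4)) <= 1.

(* The levels below [ia] cost too little to matter, even with [n] clusters each;
   at the levels above [ib] a single cluster is left. *)
Let mh := trunc_log 2 Mh.
Let ia := (mh - lg - J - e0)%N.
Let ib := (mh + 9 - e0)%N.

Let Mh0 : (0 < Mh)%N.
Proof. by apply: leq_trans tree_ham_ge; rewrite expn_gt0. Qed.

Let mh_le : (2 ^ mh <= Mh)%N. Proof. exact: trunc_logP. Qed.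

Let mh_lt : (Mh < 2 ^ mh.+1)%N. Proof. exact: trunc_log_ltn. Qed.

Let mh_ge : (e0 + J <= mh)%N. Proof. exact: trunc_log_max tree_ham_ge. Qed.

Let ibL : (ib <= L)%N.
Proof.
rewrite /ib leq_subLR -(@leq_exp2l 2) // addnC expnD.
by apply: leq_trans hL; rewrite leq_mul2l mh_le orbT.
Qed.

Let ia_ib : (ia <= ib)%N. Proof. by rewrite /ia /ib; move: (mh); clear; lia. Qed.

Let mid_len : (ib - ia <= lg + J + 9)%N.
Proof. by rewrite /ia /ib; have := mh_ge; move: (mh); clear; lia. Qed.

(** The sum is geometric, so its last scale decides; [ia] is chosen to make [n * 2 ^ J * t ia] at
    most [2 * Mh]. *)
Let small_cost (w : Omega) : \sum_(i < ia) cost w i <= 2 * (2 + c0) * Mh%:R.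
Proof.
have Mh1 : 0 <= Mh%:R :> R by [].
have [ia0|ia0] := posnP ia.
  rewrite ia0 big_ord0 !mulr_ge0 //; have := c01; lra.
apply: le_trans (sum_level_cost_small cut X e0 J c01 w ia) _.
have eia : (e0 + ia + lg + J = mh)%N by move: ia0; rewrite /ia; move: (mh); clear; lia.
have K1 : 1 <= K by rewrite exprn_ege1 // ler1n.
have small : n%:R * (K * t ia) <= 2 * Mh%:R :> R.
  rewrite -!(natrX R 2) -!natrM ler_nat; apply: (@leq_trans (2 * 2 ^ mh)); last by rewrite leq_mul2l mh_le.
  have -> : (2 * 2 ^ mh = 2 ^ lg.+1 * (2 ^ J * 2 ^ (e0 + ia)))%N.
    rewrite -!expnD -expnS -eia; congr (2 ^ _)%N.
    by move: ia; clear => ?; lia.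
  by rewrite leq_mul2r ltnW ?orbT.
have t1 : 0 <= n%:R * t ia by rewrite mulr_ge0 // exprn_ge0.
have : n%:R * t ia <= n%:R * (K * t ia).
  by rewrite mulrCA ler_peMl.
move: small t1; rewrite [n%:R * (K * _)]mulrCA [n%:R * ((_ + _) * _)]mulrCA.
move: (n%:R * t ia) Mh%:R Mh1 => a m m0 s a0 aK.
have -> : (2 * K + c0) * a = 2 * (K * a) + c0 * a by ring.
have : c0 * a <= c0 * (2 * m).
  by apply: ler_wpM2l; [have := c01; lra | lra].
by lra.
Qed.

(** Each of the four events fails with probability at most [1 / 200]: the first two by union bounds,
    the last two by Markov's inequality. *)
Let good_w (w : Omega) : bool :=
  [&& (cells cut e0 w ib X <= 1)%N,
      [forall x in X, forall y in X, same cut [set: F] e0 w x y ==> (x == y)],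
      loss R cut X e0 J L w < Mh%:R / (2 * C1) &
      \sum_(k < ib - ia) cost w (ia + k) < 200 * (mid_const J c0 (lg + J + 9) n * Mh%:R)].

Let Mh1 : 0 < Mh%:R :> R. Proof. by rewrite ltr0n. Qed.

Let n1 : 1 <= n%:R :> R. Proof. by rewrite ler1n ltnW. Qed.

Let K0 : 0 < K. Proof. by rewrite exprn_gt0. Qed.

Let Pr_cells : Pr R (fun w : Omega => ~~ (cells cut e0 w ib X <= 1)%N) <= 1 / 200.
Proof.
apply: (@le_trans _ _ (Mh%:R / t ib)).
  have eM' : (e0 + ib <= M)%N by apply: leq_trans eM; rewrite -addnA leq_add2l (leq_trans ibL) ?leq_addr.
  by apply: le_trans (Pr_split_level R cut cE eM'); apply: le_Pr => w; rewrite -ltnNge.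
rewrite ler_pdivrMr ?exprn_gt0 //.
(* The offset 9 in [ib] is 1 for rounding the logarithm and 8 because [2 ^ 8 >= 200]. *)
have eib : (e0 + ib = mh.+1 + 8)%N by have := mh_ge; rewrite /ib; move: (mh); clear; lia.
have : Mh%:R <= (2 ^ mh.+1)%:R :> R by rewrite ler_nat ltnW.
rewrite eib exprD natrX; have : 200 <= 2 ^+ 8 :> R by rewrite -natrX ler_nat.
have := exprn_ge0 mh.+1 (ler0n R 2).
by move: (2 ^+ 8) (2 ^+ mh.+1) => a b *; nra.
Qed.

Let expK : n%:R ^+ 2 * expR (- (K / 4)) <= 1 / 3200.
Proof.
rewrite ler_pdivlMr // mulrC; apply: le_trans hK; rewrite -mulrA ler_wpM2l //.
rewrite -[leRHS]mulrA ler_peMl // mulr_ge0 ?expR_ge0 // exprn_ge0 //.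
Qed.

Let Pr_merge : Pr R (fun w : Omega => ~~ [forall x in X, forall y in X,
    same cut [set: F] e0 w x y ==> (x == y)]) <= 1 / 200.
Proof.
have eM' : (e0 <= M)%N by apply: leq_trans eM; rewrite -addnA leq_addr.
apply: le_trans (@Pr_merge_level R V F cut M X e0 K eM' _) _.
  move=> x y _ _ /far; rewrite exprD ler_pdivlMr ?exprn_gt0 // mulrC //.
have : expR (- K) <= expR (- (K / 4)) by rewrite ler_expR; have := K0; lra.
move=> /(ler_wpM2l (sqr_ge0 (n%:R : R))).
by have := expK; lra.
Qed.

Let Pr_loss : Pr R (fun w : Omega => ~~ (loss R cut X e0 J L w < Mh%:R / (2 * C1))) <= 1 / 200.
Proof.
have a0 : 0 < Mh%:R / (2 * C1) by rewrite divr_gt0 //; have := C11; lra.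
apply: (@le_trans _ _ (Pr R (fun w : Omega => Mh%:R / (2 * C1) <= loss R cut X e0 J L w))).
  by apply: le_Pr => w; rewrite -leNgt.
apply: le_trans (markov a0 (loss_ge0 R cut X e0 J L)) _.
rewrite ler_pdivrMr //; apply: le_trans (Ex_loss cut cE c01 e00 Je eM) _.
rewrite [leRHS]mulrA ler_pdivlMr; last by have := C11; lra.
rewrite [leLHS](_ : _ = (3200 * (C1 * n%:R ^+ 2) * expR (- (K / 4))) * (1 / 200 * Mh%:R)); last by field.
by apply: ler_piMl => //; rewrite mulr_ge0 // divr_ge0.
Qed.

Let midc0 : 0 < mid_const J c0 (lg + J + 9) n.
Proof.
have ln0 : 0 <= ln n%:R :> R by rewrite ln_ge0.
have m0 : 0 < (lg + J + 9)%:R :> R by rewrite ltr0n addnS.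
rewrite /mid_const pmulr_rgt0 // ltr_wpDl //; last by rewrite pmulr_rgt0 //; have := c01; lra.
rewrite mulr_ge0 // addr_ge0 ?mulr_ge0 // /level_bound addr_ge0 ?mulr_ge0 //.
  by rewrite addr_ge0 ?mulr_ge0.
Qed.

Let mid_mono : mid_const J c0 (ib - ia) n <= mid_const J c0 (lg + J + 9) n.
Proof.
have : (ib - ia)%:R <= (lg + J + 9)%:R :> R by rewrite ler_nat.
rewrite /mid_const /level_bound; set a := (ib - ia)%:R; set b := (lg + J + 9)%:R => ab.
have J0 : 0 <= J%:R :> R by [].
have J1 : 0 <= J.+1%:R :> R by [].
have h1 : a * (7 + 8 * J%:R) <= b * (7 + 8 * J%:R) by rewrite ler_wpM2r //; lra.
have h2 : c0 * a <= c0 * b by rewrite ler_wpM2l //; have := c01; lra.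
rewrite ler_wpM2l // lerD //; last by rewrite -!mulrA ler_wpM2l.
by rewrite ler_wpM2l // lerD ?ler_wpM2l // lerD2r.
Qed.

Let Pr_mid : Pr R (fun w : Omega => ~~ (\sum_(k < ib - ia) cost w (ia + k) <
    200 * (mid_const J c0 (lg + J + 9) n * Mh%:R))) <= 1 / 200.
Proof.
set G := mid_const J c0 (lg + J + 9) n * Mh%:R.
have G0 : 0 < G by rewrite mulr_gt0.
have a0 : 0 < 200 * G by rewrite mulr_gt0.
have f0 (w : Omega) : 0 <= \sum_(k < ib - ia) cost w (ia + k).
  by apply: sumr_ge0 => k _; apply: level_cost_ge0.
apply: (@le_trans _ _ (Pr R (fun w : Omega => 200 * G <= \sum_(k < ib - ia) cost w (ia + k)))).
  by apply: le_Pr => w; rewrite -leNgt.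
apply: le_trans (markov a0 f0) _; rewrite ler_pdivrMr // mulrA divfK ?pnatr_eq0 //.
have len : (ia + (ib - ia) <= L)%N by rewrite subnKC.
have small : n%:R * expR (- (K / 2)) <= 1 :> R.
  have : expR (- (K / 2)) <= expR (- (K / 4)) by rewrite ler_expR; have := K0; lra.
  have : n%:R * expR (- (K / 4)) <= n%:R ^+ 2 * expR (- (K / 4)) :> R.
    by rewrite ler_wpM2r ?expR_ge0 // expr2 ler_peMl.
  have := expK; have n0 : 0 <= n%:R :> R by [].
  move=> h1 h2 /(ler_wpM2l n0); lra.
apply: le_trans (Ex_mid_levels cut cE XE c01 e00 Je eM len small) _.
by rewrite mul1r ler_wpM2r // ltW.
Qed.

Lemma Pr_good_w : Pr R (fun w : Omega => ~~ good_w w) <= 4 / 200.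
Proof.
pose B1 (w : Omega) := ~~ (cells cut e0 w ib X <= 1)%N.
pose B2 (w : Omega) := ~~ [forall x in X, forall y in X, same cut [set: F] e0 w x y ==> (x == y)].
pose B3 (w : Omega) := ~~ (loss R cut X e0 J L w < Mh%:R / (2 * C1)).
pose B4 (w : Omega) := ~~ (\sum_(k < ib - ia) cost w (ia + k) < 200 * (mid_const J c0 (lg + J + 9) n * Mh%:R)).
apply: (@le_trans _ _ (Pr R (fun w : Omega => (B1 w || B2 w) || (B3 w || B4 w)))).
  by apply: le_Pr => w; rewrite /good_w /B1 /B2 /B3 /B4 !negb_and -!orbA.
apply: le_trans (PrU _ _ _) _.
have := lerD (PrU R B1 B2) (PrU R B3 B4).
have := Pr_cells; have := Pr_merge; have := Pr_loss; have := Pr_mid.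
rewrite -/B1 -/B2 -/B3 -/B4.
by move: (Pr R B1) (Pr R B2) (Pr R B3) (Pr R B4) => *; lra.
Qed.

Lemma good_w_cost w : good_w w -> cells cut e0 w L X = 1%N /\
  A * MST p X / 8 <= \sum_(i < L) cost w i <=
  C1 * (2 * (2 + c0) + 200 * mid_const J c0 (lg + J + 9) n) * (A * MST p X).
Proof.
case/and4P => one sep lossw midw.
have cells1 i : (ib <= i)%N -> (cells cut e0 w i X <= 1)%N.
  move=> ibi; apply/card_le1_eqP => _ _ /imsetP[x xX ->] /imsetP[y yX ->].
  apply/eqP; rewrite cell_eq; apply: (@same_mono _ _ _ _ _ (e0 + ib)); first by rewrite leq_add2l.
  by rewrite -cell_eq; apply/eqP/(card_le1_eqP one); apply: imset_f.
have X0 : X != finset.set0 by rewrite -card_gt0 ltnW.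
have oneL : cells cut e0 w L X = 1%N.
  by apply/eqP; rewrite eqn_leq cells1 // cells_gt0.
have sep' x y : x \in X -> y \in X -> same cut [set: F] e0 w x y -> x = y.
  by move=> xX yX s; apply/eqP; move/forall_inP/(_ x xX)/forall_inP/(_ y yX)/implyP: sep; apply.
have lower := cost_ge_MST sep' oneL.
have C0 : 0 < C1 by apply: lt_le_trans C11.
have loss_le : loss R cut X e0 J L w <= A * MST p X / 2.
  apply: le_trans (ltW lossw) _; rewrite ler_pdivrMr ?mulr_gt0 //.
  rewrite [leRHS](_ : _ = C1 * (A * MST p X)); last by field.
  exact: tree_ham_le.
split=> //; apply/andP; split; first by move: (\sum_(_ < L) _) lower loss_le => *; lra.
have -> : \sum_(i < L) cost w i = \sum_(i < ia) cost w i + \sum_(k < ib - ia) cost w (ia + k).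
  rewrite -(big_mkord xpredT (fun i => cost w i)) (@big_cat_nat _ _ _ ib) //=.
  have -> : \sum_(ib <= i < L) cost w i = 0.
    by rewrite big_nat_cond big1 // => i /andP[/andP[ibi _] _]; rewrite level_cost_single ?cells1.
  rewrite addr0.
  rewrite (@big_cat_nat _ _ _ ia) //= big_mkord; congr (_ + _).
  rewrite -[X in \sum_(X <= _ < _) _]add0n big_addn big_mkord.
  by apply: eq_bigr => k _; rewrite addnC.
apply: (@le_trans _ _ ((2 * (2 + c0) + 200 * mid_const J c0 (lg + J + 9) n) * Mh%:R)).
  by have := small_cost w; move: midw; move: (\sum_(_ < ia) _) (\sum_(_ < _) _) => *; lra.
rewrite [C1 * _]mulrC -mulrA; apply: ler_wpM2l tree_ham_le.
have := midc0; have := c01; lra.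
Qed.

(** [1024 = 8 * 128]: the costs reach an eighth of the scaled tree length, and a run recovers
    [1 / 128] of them. The failures add up to [5 / 200], below [1 / 32]. *)
Lemma Pr_run_correct :
  Pr R (fun o : Run => ~~ (MST p X <= 1024 / A * run_value cut e0 J L T c0 o X <=
    1024 * C1 * (2 * (2 + c0) + 200 * mid_const J c0 (lg + J + 9) n) * MST p X)) <= 1 / 32.
Proof.
have Sh0 : (0 < #|{: Shots}|)%N.
  by rewrite !card_ffun !card_prod !card_ffun !card_prod !card_ord card_bool !(expn_gt0, muln_gt0).
apply: (@le_trans _ _ (Pr R (fun o : Run => ~~ good_w o.1 || ~~ good_shots cut e0 J L T c0 X o.1 o.2))).
  apply: le_Pr => -[w z] /=; apply: contraNT; rewrite negb_or !negbK => /andP[gw gz].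
  have [one /andP[lo hi]] := good_w_cost gw.
  have X0 : X != finset.set0 by rewrite -card_gt0 ltnW.
  have rlo := run_value_ge X0 c01 e00 eM TM nT hQ c00 one gz.
  have rhi := run_value_le X0 c01 e00 eM TM nT hQ gz.
  rewrite mulrAC; apply/andP; split.
    by rewrite ler_pdivlMr // mulrC; move: (run_value _ _ _ _ _ _ _ _) rlo lo => *; lra.
  rewrite ler_pdivrMr //.
  set G := 2 * (2 + c0) + _ in hi *.
  rewrite [leRHS](_ : _ = 1024 * (C1 * G * (A * MST p X))); last by ring.
  by rewrite ler_wpM2l // (le_trans rhi).
apply: le_trans (PrU _ _ _) _; rewrite /Pr.
rewrite (@Ex_fst R _ _ (fun w => (~~ good_w w)%:R)) //.
rewrite (@Ex_pair R _ _ (fun w z => (~~ good_shots cut e0 J L T c0 X w z)%:R)).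
have := Pr_good_w; have : Ex (fun w : Omega => Ex (fun z : Shots =>
    (~~ good_shots cut e0 J L T c0 X w z)%:R)) <= 1 / 200 :> R.
  by apply: Ex_le_const => [|w]; [rewrite divr_ge0 | apply: Pr_bad_shots].
by rewrite /Pr; lra.
Qed.

End RunCorrect.

(** * The algorithm for given parameters *)

Section PowersOfTwo.

Definition power_of_2 (N : nat) : Prop := exists m, N = (2 ^ m)%N.

Lemma power_of_2M N N' : power_of_2 N -> power_of_2 N' -> power_of_2 (N * N').
Proof. by move=> [m ->] [m' ->]; exists (m + m')%N; rewrite expnD. Qed.

Lemma power_of_2X N k : power_of_2 N -> power_of_2 (N ^ k).
Proof. by move=> [m ->]; exists (m * k)%N; rewrite expnM. Qed.

End PowersOfTwo.

Section RunAlgorithm.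
Variables (R : realType) (p : R).
Hypothesis hp : 1 <= p <= 2.

Let p0 : 0 < p. Proof. by case/andP: hp => p1 _; apply: lt_le_trans p1. Qed.

Lemma point_dist_le (d Delta : nat) (x y : point d Delta) : (0 < d)%N ->
  point_dist p x y <= (d * Delta)%:R.
Proof.
move=> d0; case/andP: hp => p1 _.
have Dp : (d%:R : R) <= d%:R `^ p.
  rewrite -[leLHS]powRr1 // ler_powR ?ler1n //.
suff : \sum_(i < d) `|coords R x 0 i - coords R y 0 i| `^ p <= (d * Delta)%:R `^ p.
  move=> le; rewrite /point_dist /lp_dist.
  have -> : (d * Delta)%:R = ((d * Delta)%:R `^ p) `^ p^-1 :> R.
    by rewrite -powRrM divff ?gt_eqF // powRr1.
  apply: ge0_ler_powR => //; rewrite ?invr_ge0 ?(ltW p0) ?nnegrE ?powR_ge0 //.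
  by apply: sumr_ge0 => i _; apply: powR_ge0.
apply: (@le_trans _ _ (\sum_(i < d) Delta%:R `^ p)).
  apply: ler_sum => i _; apply: ge0_ler_powR; rewrite ?(ltW p0) ?nnegrE //.
  rewrite !mxE; have := ltn_ord (x i); have := ltn_ord (y i).
  rewrite -!(ler_nat R) ler_norml => hy hx.
  have x0 : 0 <= (x i)%:R :> R by []. 
  have y0 : 0 <= (y i)%:R :> R by [].
  by move: hx hy; rewrite -!natr1 => *; apply/andP; split; lra.
rewrite sumr_const card_ord -[_ *+ _]mulr_natl natrM powRM //.
by rewrite ler_wpM2r ?powR_ge0.
Qed.

Lemma run_algorithm : exists C1 c1, [/\ 1 <= C1, C1 <= 2 ^+ c1 &
  forall (cc n d Delta lg D J T L q R0 k : nat),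
  10240 <= cc%:R :> R -> (1 < n)%N -> (0 < d)%N -> (0 < Delta)%N ->
  (n < 2 ^ lg.+1)%N -> (d * Delta <= 2 ^ D)%N -> (16 * n < 2 ^ T)%N ->
  L = (2 * lg + D + J + c1 + 12)%N ->
  (2 * T * (2 * 2 ^ J + cc) <= 2 ^ q)%N ->
  R0.+1 = (200 * L * T * (4 * T * (2 * 2 ^ J + cc)) ^ 2)%N ->
  3200 * (C1 * n%:R ^+ 2) * expR (- (2 ^+ J / 4)) <= 1 ->
  exists (m : nat) (alg : streaming_algorithm (update d Delta) R
      (k * #|counter_index (2 ^ q).-1 J L T R0| * lg.+1) m),
    forall (X : {set point d Delta}) sigma, #|X| = n -> stream_of X sigma ->
      1 - (9 / 16) ^+ k <= bits_prob R (fun omega => MST p X <= run alg sigma omega <=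
        1024 * C1 * (2 * (2 + cc%:R) + 200 * mid_const J cc%:R (lg + J + 9) n) * MST p X)].
Proof.
have [C1 [C11 embP]] := lp_cut_embedding hp.
have [c1 c1P] : exists c1, C1 <= 2 ^+ c1.
  exists (trunc_log 2 (Num.truncn C1)).+1; rewrite -natrX.
  apply: (@le_trans _ _ (Num.truncn C1).+1%:R); first by rewrite ltW // truncnS_gt.
  by rewrite ler_nat trunc_log_ltn.
exists C1, c1; split=> // cc n d Delta lg D J T L q R0 k hcc n2 d0 Dl0 nlg dD nT hL hQ hR hK.
(* A scale of at least [2 ^ (2 * J + 2)] leaves room for [e0 >= J], so that the radii [2 ^ (e - J)]
   make sense, together with [2 ^ (e0 + J) <= A]. *)
have [F [cut [A [A0 AJ emb]]]] := embP d Delta (2 ^+ (2 * J + 2)) d0 Dl0.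
have [a [aA Aa]] : exists a, 2 ^+ a <= A /\ A <= 2 ^+ a.+1.
  have A1 : (0 < Num.truncn A)%N.
    rewrite truncn_gt0; apply: le_trans AJ; by rewrite exprn_ege1 // ler1n.
  exists (trunc_log 2 (Num.truncn A)); rewrite -!natrX; split.
    apply: (@le_trans _ _ (Num.truncn A)%:R); first by rewrite ler_nat trunc_logP.
    by rewrite truncn_le ltW.
  apply: (@le_trans _ _ (Num.truncn A).+1%:R); first by rewrite ltW // truncnS_gt.
  by rewrite ler_nat trunc_log_ltn.
have aJ : (2 * J + 2 <= a.+1)%N.
  by rewrite -(@leq_exp2l 2) // -(ler_nat R) !natrX (le_trans AJ).
pose e0 := (a - J)%N; pose M := (e0 + L + J + T)%N.
have e0J : (e0 + J = a)%N by rewrite /e0 subnK //; move: aJ; clear; lia.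
have e00 : (0 < e0)%N by rewrite /e0; move: aJ; clear; lia.
have Je : (J <= e0)%N by rewrite /e0; move: aJ; clear; lia.
have eM : (e0 + L + J <= M)%N by rewrite /M leq_addr.
have TM : (T <= M)%N by rewrite /M leq_addl.
set Q := (2 ^ q).-1; have QE : Q.+1 = (2 ^ q)%N by rewrite prednK ?expn_gt0.
pose V := point d Delta; pose U := {set V}.
pose Run := ({ffun F -> 'I_(2 ^ M)} * {ffun 'I_R0.+1 ->
  ({ffun U -> 'I_(2 ^ M) * bool} * {ffun U -> 'I_(2 ^ M)}) *
  (({ffun U -> 'I_Q.+1} * {ffun U -> 'I_Q.+1}) * {ffun F -> 'I_(2 ^ M)})})%type.
have [m Runm] : power_of_2 #|{: Run}|.
  have pM : power_of_2 (2 ^ M) by exists M.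
  have pQ : power_of_2 Q.+1 by exists q.
  have p2 : power_of_2 2 by exists 1%N.
  rewrite card_prod !card_ffun !card_prod !card_ffun !card_prod !card_ord card_bool.
  by do ![apply: power_of_2M | apply: power_of_2X].
have := @amplified_algorithm R d Delta n Run (counter_index Q J L T R0) m lg.+1 k
  (fun o i => run_counter cut e0 o i)
  (fun o X => 1024 / A * run_value cut e0 J L T cc%:R o X)
  (fun X => MST p X) (fun X => 1024 * C1 * (2 * (2 + cc%:R) + 200 * mid_const J cc%:R (lg + J + 9) n) * MST p X).
apply => // [o X X' XX|X Xn]; first by congr (_ * _); apply: run_value_counts.
have [E tE [costE _]] := MST_min p X.
have hQ' : 2 * T%:R * (2 * 2 ^+ J + cc%:R) <= Q.+1%:R :> R.
  by move: hQ; rewrite QE -(ler_nat R) !(natrM, natrD, natrX).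
have hR' : 200 * L%:R * T%:R * (4 * T%:R * (2 * 2 ^+ J + cc%:R)) ^+ 2 <= R0.+1%:R :> R.
  by rewrite hR !(natrM, natrD, natrX).
rewrite -Xn; apply: (Pr_run_correct (M := M) (e0 := e0) p0 A0 C11 emb hcc e00 Je eM TM _ _ tE costE) => //.
- by rewrite e0J.
- by rewrite Xn.
- by rewrite Xn.
- by rewrite Xn.
(* Enough levels: the tree has at most [n ^ 2] edges, of length at most [d * Delta], and
   [A <= 2 ^ a.+1]. The 12 in [L] is 9 for the factor 512, 1 for [a.+1] and 2 for [2 * lg.+1]. *)
- have E_le : (#|E| <= n * n)%N.
    rewrite -Xn -cardsX; apply/subset_leq_card/fintype.subsetP => -[x y] xyE.
    by case: tE => /(_ x y xyE)[xX yX _ _] _ _; rewrite inE /= xX yX.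
  have MST_le : MST p X <= 2 ^+ (2 * lg.+1 + D).
    rewrite costE; apply: (@le_trans _ _ (\sum_(e in E) (d * Delta)%:R)).
      by apply: ler_sum => e _; apply: point_dist_le.
    rewrite sumr_const -[_ *+ _]mulr_natl -natrM -natrX ler_nat expnD.
    by rewrite leq_mul // (leq_trans E_le) // mul2n -addnn expnD leq_mul // ltnW.
  have MST0 := MST_ge0 p X.
  have AMST : A * MST p X <= 2 ^+ a.+1 * 2 ^+ (2 * lg.+1 + D).
    by rewrite ler_pM // ltW.
  have := tree_ham_le emb costE => le; rewrite -(ler_nat R) natrM natrX.
  have -> : (e0 + L = 9 + (c1 + (a.+1 + (2 * lg.+1 + D))))%N.
    by rewrite hL -e0J; move: (e0); clear => ?; lia.
  rewrite exprD -[2 ^+ 9]natrX ler_pM // ?ler_nat //; apply: le_trans le _.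
  rewrite exprD ler_pM //; [exact: le_trans C11 | by rewrite mulr_ge0 // ltW | by rewrite exprD].
- by rewrite Xn.
Qed.

End RunAlgorithm.

(** * Choice of the parameters *)

Section Logarithms.
Variable R : realType.

Let ln2 : 0 < ln 2 :> R.
Proof. by rewrite ln_gt0 // ltr1n. Qed.

Lemma log2_ge0 n : 0 <= log2 n%:R :> R.
Proof.
rewrite divr_ge0 ?(ltW ln2) //; case: n => [|n]; first by rewrite ln0.
by rewrite ln_ge0 // ler1n.
Qed.

Lemma ler_log2 (x y : R) : 0 < x -> x <= y -> log2 x <= log2 y.
Proof.
move=> x0 xy; rewrite /log2 ler_wpM2r ?invr_ge0 ?(ltW ln2) // ler_ln // posrE //.
exact: lt_le_trans xy.
Qed.

Lemma log2X k : log2 (2 ^+ k) = k%:R :> R.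
Proof. by rewrite /log2 lnXn // -[_ *+ _]mulr_natl mulfK // gt_eqF. Qed.

Lemma log2_double (x : R) : 0 < x -> log2 (2 * x) = 1 + log2 x.
Proof. by move=> x0; rewrite /log2 lnM ?posrE // mulrDl divff // gt_eqF. Qed.

Lemma trunc_log_le_log2 n : (0 < n)%N -> (trunc_log 2 n)%:R <= log2 n%:R :> R.
Proof.
move=> n0; rewrite -log2X ler_log2 ?exprn_gt0 // -natrX ler_nat.
exact: trunc_logP.
Qed.

Lemma ln_le_log2 n : ln n%:R <= log2 n%:R :> R.
Proof.
have : ln 2 <= 1 :> R by have := @le_ln1Dx R 1; rewrite (_ : 1 + 1 = 2) //; apply; lra.
have -> : ln n%:R = log2 n%:R * ln 2 :> R by rewrite divfK // gt_eqF.
by move=> ?; rewrite ler_piMr // log2_ge0.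
Qed.

(** Meant for [l = log2 n] and [z = 1 + log2 (log2 n)]: [level_bound] yields [l * z ^ 2] and the
    distortion [J.+1] of the sketch one more [z], whence the exponent 3 of the final factor. *)
Lemma mid_const_le (J N n : nat) (c0 j h l z : R) :
  0 <= c0 -> 1 <= j -> 1 <= z -> 0 <= l -> 0 <= h ->
  J.+1%:R <= j * z -> N%:R <= h * (l * z) -> 0 <= (ln n%:R : R) <= l ->
  mid_const J c0 N n <=
    4 * (j * (90 * h * j + 48 * j ^+ 2 + 2 * h) + 2 * c0 * h) * (l * z ^+ 3).
Proof.
move=> c00 j1 z1 l0 h0 Jjz Nh /andP[ln0 lnl].
have j0 : 0 <= j := le_trans ler01 j1; have z0 : 0 <= z := le_trans ler01 z1.
have jz1 : 1 <= j * z by rewrite mulr_ege1.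
have jz0 : 0 <= j * z := le_trans ler01 jz1.
have J0 : 0 <= J%:R :> R by [].
have J8 : 7 + 8 * J%:R <= 15 * (j * z) by move: Jjz; rewrite -natr1; lra.
have lz0 : 0 <= l * z by rewrite mulr_ge0.
have b1 : N%:R * (7 + 8 * J%:R) <= h * (l * z) * (15 * (j * z)).
  by rewrite ler_pM // addr_ge0 // mulr_ge0.
have b2 : 8 * J%:R ^+ 2 * ln n%:R <= 8 * (j * z) ^+ 2 * l.
  rewrite ler_pM // ?mulr_ge0 ?sqr_ge0 // ler_wpM2l // lerXn2r ?nnegrE //.
  by apply: le_trans Jjz; rewrite ler_nat.
have b3 : N%:R <= h * (l * z ^+ 2).
  apply: le_trans Nh _; rewrite ler_wpM2l // ler_wpM2l // expr2 ler_peMr //.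
have b4 : c0 * N%:R <= c0 * (h * (l * z ^+ 3)).
  rewrite ler_wpM2l //; apply: le_trans b3 _; rewrite ler_wpM2l // ler_wpM2l //.
  by rewrite [leRHS]exprS ler_peMl ?sqr_ge0.
have b5 : J.+1%:R * (6 * level_bound R N J n + 2 * N%:R) <=
    (j * z) * (6 * (h * (l * z) * (15 * (j * z)) + 8 * (j * z) ^+ 2 * l) + 2 * (h * (l * z ^+ 2))).
  rewrite ler_pM //; last by rewrite /level_bound; lra.
  rewrite /level_bound addr_ge0 // !mulr_ge0 // addr_ge0 // mulr_ge0 //.
  - by rewrite addr_ge0 // mulr_ge0.
  - by rewrite mulr_ge0 // sqr_ge0.
rewrite [leRHS](_ : _ = 4 * ((j * z) * (6 * (h * (l * z) * (15 * (j * z)) +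
   8 * (j * z) ^+ 2 * l) + 2 * (h * (l * z ^+ 2))) + 2 * (c0 * (h * (l * z ^+ 3))))); last by ring.
by rewrite /mid_const ler_wpM2l // lerD // -[leLHS]mulrA ler_wpM2l.
Qed.

End Logarithms.

(** * Counting the bits of memory *)

Section SpaceBound.

Lemma pow2_trunc_log_le lg J1 : (2 ^ (trunc_log 2 lg.+1 + J1) <= lg.+1 * 2 ^ J1)%N.
Proof. by rewrite expnD leq_mul2r trunc_logP ?orbT. Qed.

(** The exponent 16 counts factors [Y]: 6 in [R0.+1], 1 in [L], 2 in [T * T], 4 in the two
    fingerprints, 1 in [J.+2], and 2 for the number of runs and the width of a counter. *)
Lemma space_bound (c lg ld lD J1 c1 cc q R0 J T L X a b l : nat) :
  J = (trunc_log 2 lg.+1 + J1)%N -> T = (lg + 5)%N ->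
  L = (2 * lg + (ld.+1 + lD.+1) + J + c1 + 12)%N ->
  X = (2 * T * (2 * 2 ^ J + cc))%N -> (2 ^ q <= 2 * X)%N ->
  R0.+1 = (200 * L * T * (4 * T * (2 * 2 ^ J + cc)) ^ 2)%N ->
  a = (2 ^ J1)%N -> b = (2 * a + cc)%N -> l = (a + c1 + 16)%N ->
  (2 * c * lg.+1 * #|counter_index (2 ^ q).-1 J L T R0| * lg.+1 <=
    2 * c * (200 * l * 5 * (20 * b) ^ 2 * l * 25 * (2 * (20 * b) * (20 * b) * (2 * a))) *
    (1 + lg + ld + lD) ^ 16)%N.
Proof.
move=> hJ hT hL hX hq hR ha hb hl; set Y := (1 + lg + ld + lD)%N.
have Y1 : (0 < Y)%N by [].
have lgY : (lg.+1 <= Y)%N by rewrite /Y; lia.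
have KY : (2 ^ J <= a * Y)%N.
  by rewrite hJ ha (leq_trans (pow2_trunc_log_le _ _)) // mulnC leq_mul2l lgY orbT.
have JK : (J.+1 <= 2 ^ J)%N by apply: ltn_expl.
have aY : (0 < a * Y)%N by rewrite ha muln_gt0 expn_gt0.
have JY : (J.+2 <= 2 * a * Y)%N by rewrite -mulnA; lia.
have TY : (T <= 5 * Y)%N by rewrite hT /Y; lia.
have bY : (2 * 2 ^ J + cc <= b * Y)%N.
  by rewrite hb mulnDl leq_add //; [rewrite -mulnA leq_mul2l KY orbT | rewrite leq_pmulr].
have LY : (L <= l * Y)%N.
  have -> : (l * Y = a * Y + c1 * Y + 16 * Y)%N by rewrite hl; ring.
  have : (c1 <= c1 * Y)%N by rewrite leq_pmulr.
  by rewrite hL; move: (a * Y)%N (c1 * Y)%N KY JK; rewrite /Y; lia.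
have XY : (4 * T * (2 * 2 ^ J + cc) <= 20 * b * (Y * Y))%N.
  have -> : (20 * b * (Y * Y) = 4 * (5 * Y) * (b * Y))%N by ring.
  by rewrite leq_mul // leq_mul2l TY orbT.
have qY : ((2 ^ q).-1.+1 <= 20 * b * (Y * Y))%N.
  rewrite prednK ?expn_gt0 //; apply: leq_trans XY; apply: leq_trans hq _; rewrite hX.
  by rewrite !mulnA.
have RY : (R0.+1 <= 200 * (l * Y) * (5 * Y) * (20 * b * (Y * Y)) ^ 2)%N.
  by rewrite hR; apply: leq_mul; [rewrite !leq_mul | rewrite leq_exp2r].
have -> : #|counter_index (2 ^ q).-1 J L T R0| =
    (R0.+1 * L * (T * T) * (2 * (2 ^ q).-1.+1 * (2 ^ q).-1.+1 * J.+2))%N.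
  by rewrite !card_prod card_option !card_ord card_bool.
apply: (@leq_trans (2 * c * Y * (200 * (l * Y) * (5 * Y) * (20 * b * (Y * Y)) ^ 2 * (l * Y) *
    (5 * Y * (5 * Y)) * (2 * (20 * b * (Y * Y)) * (20 * b * (Y * Y)) * (2 * a * Y))) * Y)).
  by rewrite !leq_mul.
by rewrite leq_eqVlt; apply/orP; left; apply/eqP; move: (Y) => y; ring.
Qed.

End SpaceBound.

Section Final.
Variable R : realType.

(** As [3200 <= 2 ^ 12] and [n ^ 2 <= 2 ^ (2 * lg + 2)], the exponent [N = 14 + c1 + 2 * lg]
    suffices. The 17 in [J] is 2 for the division by 4, 1 for rounding the logarithm and 14 from
    [N]. *)
Lemma small_merge_probability (C1 : R) (c1 n lg J : nat) :
  0 <= C1 -> C1 <= 2 ^+ c1 -> (n < 2 ^ lg.+1)%N -> J = (trunc_log 2 lg.+1 + (c1 + 17))%N ->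
  3200 * (C1 * n%:R ^+ 2) * expR (- (2 ^+ J / 4)) <= 1.
Proof.
move=> C10 c1P nlg hJ; set N := (14 + c1 + 2 * lg)%N.
have JN : (4 * N <= 2 ^ J)%N.
  have gt_lg : (lg.+1 < 2 ^ (trunc_log 2 lg.+1).+1)%N by apply: trunc_log_ltn.
  have gt_c : (14 + c1 <= 2 ^ (14 + c1))%N by apply/ltnW/ltn_expl.
  have -> : (2 ^ J = 4 * (2 ^ (trunc_log 2 lg.+1).+1 * 2 ^ (14 + c1)))%N.
    by rewrite (_ : 4 = 2 ^ 2)%N // -!expnD hJ; congr (2 ^ _)%N; lia.
  rewrite leq_mul2l /=; apply: leq_trans (leq_mul (ltnW gt_lg) gt_c).
  by rewrite /N; nia.
have eN : expR (- (2 ^+ J / 4)) <= (2 ^+ N)^-1 :> R.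
  apply: (@le_trans _ _ (expR (- N%:R))).
    rewrite ler_expR lerN2 ler_pdivlMr // mulrC -natrX -natrM ler_nat //.
  rewrite expRN lef_pV2 ?posrE ?expR_gt0 ?exprn_gt0 // -[N%:R]mulr1 expRM_natl.
  rewrite lerXn2r ?nnegrE ?expR_ge0 //; apply: le_trans (expR_ge1Dx _).
  by rewrite (_ : 1 + 1 = 2).
rewrite -[leRHS](@divff _ (2 ^+ N)) ?expf_neq0 ?pnatr_eq0 //.
have -> : N = (12 + (c1 + (lg.+1 + lg.+1)))%N by rewrite /N; lia.
rewrite ler_pM ?expR_ge0 ?mulr_ge0 ?exprn_ge0 //.
  rewrite exprD ler_pM ?mulr_ge0 ?exprn_ge0 //.
    by rewrite -natrX ler_nat.
  rewrite exprD ler_pM ?exprn_ge0 // exprD expr2.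
  by rewrite ler_pM // -natrX ler_nat ltnW.
by apply: le_trans eN _; rewrite (_ : N = (12 + (c1 + (lg.+1 + lg.+1)))%N) // /N; lia.
Qed.

(** [(9 / 16) ^ 2 <= 1 / 2], so every [2 * lg.+1] runs contribute a factor of at most [2 ^- lg.+1],
    which is below [1 / n]. *)
Lemma amplified_failure c n lg : (0 < n)%N -> (n < 2 ^ lg.+1)%N ->
  (9 / 16) ^+ (2 * c * lg.+1) <= n%:R ^- c :> R.
Proof.
move=> n0 nlg; rewrite -mulnA [(c * _)%N]mulnC mulnA exprM -exprVn.
rewrite lerXn2r ?nnegrE ?invr_ge0 ?exprn_ge0 ?divr_ge0 //.
apply: (@le_trans _ _ ((2 ^+ lg.+1)^-1)).
  rewrite exprM -exprVn lerXn2r ?nnegrE ?exprn_ge0 ?divr_ge0 ?invr_ge0 //.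
  by rewrite expr2; lra.
rewrite lef_pV2 ?posrE ?exprn_gt0 ?ltr0n // -natrX ler_nat; exact: ltnW.
Qed.

Lemma polylog_ge0 (B : R) l n d Delta : 0 <= B -> 0 <= polylog B l n d Delta.
Proof. by move=> B0; rewrite mulr_ge0 // exprn_ge0 // !addr_ge0 ?log2_ge0. Qed.

(** Answering 0 without memory settles [n <= 1] and the sizes too large for the grid. *)
Lemma zero_algorithm (p : R) (d Delta n c : nat) (C : R) (k : nat) :
  (forall X : {set point d Delta}, #|X| = n -> MST p X = 0) ->
  exists alg : streaming_algorithm (update d Delta) R 0 0,
    forall (X : {set point d Delta}) (sigma : seq (update d Delta)),
      #|X| = n -> stream_of X sigma ->
      1 - n%:R ^- c <= bits_prob R (fun omega =>
        MST p X <= run alg sigma omega <= soft_log C k n * MST p X).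
Proof.
move=> MST0; exists (StreamingAlgorithm (fun _ => [tuple]) (fun _ s _ => s) (fun _ _ => 0)).
move=> X sigma Xn _; rewrite /bits_prob expr0 divr1 (eq_card (B := xpredT)).
  by rewrite card_tuple expn0 lerBlDr lerDl invr_ge0 exprn_ge0.
by move=> omega; rewrite unfold_in /run /= (MST0 X Xn) mulr0 lexx.
Qed.

End Final.

Theorem theorem1p1 (R : realType) (p : R) (hp : 1 <= p <= 2) :
  exists (C : R) (k : nat),
  forall c : nat,
  exists (B : R) (l : nat),
  forall n d Delta : nat,
  exists (s m : nat)
         (alg : streaming_algorithm (update d Delta) R s m),
    s%:R <= polylog B l n d Delta /\
    forall (X : {set point d Delta}) (sigma : seq (update d Delta)),
      #|X| = n -> stream_of X sigma ->
      1 - n%:R ^- c <=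
        bits_prob R (fun omega =>
          MST p X <= run alg sigma omega <= soft_log C k n * MST p X).
Proof.
have [C1 [c1 [C11 c1P runP]]] := run_algorithm hp.
have C10 : 0 <= C1 := le_trans ler01 C11.
have [cc hcc] : exists cc : nat, 10240 <= cc%:R :> R by exists 10240%N.
(* [j] and [h] are the constants in [J.+1 <= j * z] and in the bound [h * (log2 n * z)] on the
   number of middle levels. *)
pose J1 := (c1 + 17)%N; pose j : R := (J1 + 2)%:R; pose h := j + 10.
have j1 : 1 <= j by rewrite ler1n addnS.
have cc0 : 0 <= cc%:R :> R by [].
pose mid := 4 * (j * (90 * h * j + 48 * j ^+ 2 + 2 * h) + 2 * cc%:R * h).
exists (1024 * C1 * (2 * (2 + cc%:R) + 200 * mid)), 3%N => c.
pose a := (2 ^ J1)%N; pose b := (2 * a + cc)%N; pose l := (a + c1 + 16)%N.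
pose B := (2 * c * (200 * l * 5 * (20 * b) ^ 2 * l * 25 * (2 * (20 * b) * (20 * b) * (2 * a))))%N.
exists B%:R, 16%N => n d Delta.
have B0 : 0 <= B%:R :> R by [].
(* In the remaining case some set has a nonzero tree cost, which forces [n >= 2] and positive [d]
   and [Delta]. *)
case: (pselect (forall X : {set point d Delta}, #|X| = n -> MST p X = 0)) => [MST0|nMST0].
  have [alg algP] := zero_algorithm c (1024 * C1 * (2 * (2 + cc%:R) + 200 * mid)) 3 MST0.
  by exists 0%N, 0%N, alg; split; [apply: polylog_ge0 | apply: algP].
have n2 : (1 < n)%N.
  by rewrite ltnNge; apply/negP => n1; apply: nMST0 => X Xn; apply: MST_small; rewrite Xn.
have cV : (n <= Delta ^ d)%N.
  rewrite leqNgt; apply/negP => lt; apply: nMST0 => X Xn; move: lt.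
  rewrite -Xn -[X in (X ^ _)%N]card_ord -[X in (_ ^ X)%N]card_ord -card_ffun.
  by rewrite ltnNge max_card.
have d0 : (0 < d)%N by case: d cV {nMST0} => //; rewrite expn0; move: n2; clear; lia.
have D0 : (0 < Delta)%N.
  by case: Delta cV {nMST0} => //; rewrite exp0n //; move: n2; clear; lia.
pose lg := trunc_log 2 n; pose ld := trunc_log 2 d; pose lD := trunc_log 2 Delta.
have n0 : (0 < n)%N := ltnW n2.
have nlg : (n < 2 ^ lg.+1)%N by apply: trunc_log_ltn.
pose J := (trunc_log 2 lg.+1 + J1)%N; pose T := (lg + 5)%N.
pose L := (2 * lg + (ld.+1 + lD.+1) + J + c1 + 12)%N.
pose X := (2 * T * (2 * 2 ^ J + cc))%N.
have X0 : (0 < X)%N.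
  by rewrite !(muln_gt0, addn_gt0, expn_gt0) orbT.
have [q qX Xq] : exists2 q, (2 ^ q <= 2 * X)%N & (X <= 2 ^ q)%N.
  exists (trunc_log 2 X).+1; first by rewrite expnS leq_mul2l trunc_logP.
  exact/ltnW/trunc_log_ltn.
have [R0 hR] : exists R0, R0.+1 = (200 * L * T * (4 * T * (2 * 2 ^ J + cc)) ^ 2)%N.
  exists (200 * L * T * (4 * T * (2 * 2 ^ J + cc)) ^ 2).-1; rewrite prednK //.
  have T0 : (0 < T)%N by rewrite addn_gt0 orbT.
  have L0 : (0 < L)%N by rewrite addn_gt0 orbT.
  by rewrite !(muln_gt0, addn_gt0, expn_gt0, L0, T0).
have dD : (d * Delta <= 2 ^ (ld.+1 + lD.+1))%N.
  by rewrite expnD leq_mul // ltnW // trunc_log_ltn.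
have nT : (16 * n < 2 ^ T)%N.
  have -> : (2 ^ T = 16 * 2 ^ lg.+1)%N.
    by rewrite (_ : 16 = 2 ^ 4)%N // -expnD /T; congr (2 ^ _)%N; move: (lg); clear; lia.
  by rewrite ltn_mul2l.
have hK := small_merge_probability C10 c1P nlg (erefl J).
have [m [alg algP]] := runP cc n d Delta lg (ld.+1 + lD.+1)%N J T L q R0 (2 * c * lg.+1)%N
  hcc n2 d0 D0 nlg dD nT erefl Xq hR hK.
exists (2 * c * lg.+1 * #|counter_index (2 ^ q).-1 J L T R0| * lg.+1)%N, m, alg; split.
  apply: (@le_trans _ _ (B * (1 + lg + ld + lD) ^ 16)%:R).
    by rewrite ler_nat (space_bound c (erefl J) (erefl T) (erefl L) (erefl X) qX hR).
  rewrite natrM natrX ler_wpM2l //.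
  have log0 := log2_ge0 R.
  rewrite lerXn2r ?nnegrE ?addr_ge0 // !natrD !lerD // trunc_log_le_log2 //.
move=> Y sigma Yn sY; have := algP Y sigma Yn sY; set G := 1024 * C1 * _ => le.
have n1 : 0 < n%:R :> R by rewrite ltr0n.
have l1 : 1 <= log2 n%:R :> R.
  by rewrite -[leLHS](log2X R 1) expr1; apply: ler_log2 => //; rewrite ler_nat.
have l0 : 0 < log2 n%:R :> R by apply: lt_le_trans l1.
set z := 1 + log2 (log2 n%:R : R).
have z1 : 1 <= z.
  have := ler_log2 ltr01 l1; have := log2X R 0; rewrite expr0 => -> ?.
  by rewrite lerDl.
have lgl : lg%:R <= log2 n%:R :> R by apply: trunc_log_le_log2.
have Jz : J.+1%:R <= j * z.
  (* [lg.+1 <= 2 * log2 n] as [n >= 2]; the doubling is the 1 in [z]. *)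
  have gz : (trunc_log 2 lg.+1)%:R <= z.
    apply: le_trans (trunc_log_le_log2 R (ltn0Sn _)) _; rewrite /z -log2_double //.
    by apply: ler_log2 => //; rewrite -natr1; lra.
  have : J1.+1%:R <= J1.+1%:R * z by rewrite ler_peMr.
  rewrite /J -addnS natrD => ?; have -> : j = 1 + J1.+1%:R by rewrite /j addn2 -natr1 addrC.
  by rewrite mulrDl mul1r lerD.
have Nz : (lg + J + 9)%:R <= h * (log2 n%:R * z).
  have lz1 : 1 <= log2 n%:R * z by rewrite mulr_ege1.
  have e1 : log2 n%:R <= log2 n%:R * z by rewrite ler_peMr // ltW.
  have e2 : z <= log2 n%:R * z by rewrite ler_peMl // (le_trans ler01).
  have e3 : j * z <= j * (log2 n%:R * z) by rewrite ler_wpM2l // (le_trans ler01).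
  move: Jz e3; rewrite 2!natrD -natr1 /h mulrDl; move: (j * z) (j * (_ * z)).
  by move: (log2 n%:R * z) J%:R e1 lz1 => u J' e1 lz1 x y Jz e3; lra.
have lnn : 0 <= (ln n%:R : R) <= log2 n%:R by rewrite ln_ge0 ?ler1n // ln_le_log2.
have hj : 0 <= h by rewrite /h; lra.
have Gle := mid_const_le cc0 j1 z1 (ltW l0) hj Jz Nz lnn.
apply: le_trans (le_trans _ le) _.
  by rewrite lerD2l lerN2 amplified_failure.
have MST0 := MST_ge0 p Y.
rewrite /bits_prob ler_wpM2r ?invr_ge0 ?exprn_ge0 // ler_nat; apply: subset_leq_card.
apply/fintype.subsetP => o; rewrite !unfold_in => /andP[-> /le_trans]; apply.
rewrite ler_wpM2r // /G /soft_log -/z -[leRHS]mulrA -[leRHS]mulrA ler_wpM2l ?mulr_ge0 //.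
have lz1 : 1 <= log2 n%:R * z ^+ 3 by rewrite mulr_ege1 // exprn_ege1.
rewrite [leRHS]mulrDl lerD //; first by rewrite ler_peMr // mulr_ge0 // addr_ge0.
by rewrite -[leRHS]mulrA ler_wpM2l.
Qed.
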